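(* Let $\Sigma=\mathbb{C}/(\mathbb{Z}+\mathbb{Z}\sqrt{-1})$ and let $E$ be the indecomposable rank $2$ vector bundle of degree zero over $\Sigma$ whose total space $X$ is the quotient of $\mathbb{C}\times\mathbb{C}^2$ by the group generated by $(z,v^1,v^2)\mapsto(z+1,v^1,v^2)$ and $(z,v^1,v^2)\mapsto(z+\sqrt{-1},v^1+v^2,v^2)$. Endow $E$ with the Hermitian metric $h$ induced by $$|(v^1,v^2)|_h^2=|v^1-(\operatorname{Im}z)v^2|^2+k|v^2|^2,\qquad k>0.$$ Then for any complete K\''ahler metric $g$ on $X$ of the Calabi type, $d_{Hmin}(X,g)\ge2$. Moreover, there exists a complete K\''ahler metric $g$ on $X$ of the Calabi type such that $d_{Hmin}(X,g)=2$.
   Context: A K\''ahler metric on $X$ is of the Calabi type if its K\''ahler form is $\pi^*\omega_0+\sqrt{-1}\,\partial\bar\partial u(t)$, where $\pi:X\to\Sigma$ is the projection, $\omega_0=\sqrt{-1}\,dz\wedge d\bar z$ is the flat metric on $\Sigma$, $t=h(v,\bar v)=|v|_h^2$ is viewed as a function on $X$, and $u$ is a smooth function of one variable on $[0,\infty)$. Fix a point $p\in X$ and let $d_g$ be the distance function of $g$. For $f\in\mathcal{O}(X)$ its (Hadamard) order of growth is $$d_{H,f}=\inf\{\rho>0\mid\exists\,C_1,C_2>0:\ |f(q)|\le C_1e^{C_2(d_g(q,p)+1)^\rho}\ \text{for all }q\in X\},$$ and $d_{Hmin}(X,g)=\inf\{d_{H,f}\mid f\in\mathcal{O}(X)\ \text{nonconstant}\}$.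 *)

(* Defs.v *)
From Stdlib Require Import Reals Lra List Relations.
From Coquelicot Require Export Coquelicot.

Open Scope R_scope.

(** * The manifold [X] *)

(** Points and tangent vectors of the universal cover C x C^2, as (z, v1, v2). *)
Definition C3 : Type := (C * C * C)%type.

Inductive idx := Iz | Iv1 | Iv2.

Definition coord (w : C3) (a : idx) : C :=
  match a with Iz => fst (fst w) | Iv1 => snd (fst w) | Iv2 => snd w end.

Definition sum3 (F : idx -> C) : C := (F Iz + F Iv1 + F Iv2)%C.

Definition basis3 (lam : C) (a : idx) : C3 :=
  match a with
  | Iz => (lam, RtoC 0, RtoC 0)
  | Iv1 => (RtoC 0, lam, RtoC 0)
  | Iv2 => (RtoC 0, RtoC 0, lam)
  end.

Definition deck1 (w : C3) : C3 :=
  let '(z, v1, v2) := w in ((z + 1)%C, v1, v2).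

Definition deck2 (w : C3) : C3 :=
  let '(z, v1, v2) := w in ((z + Ci)%C, (v1 + v2)%C, v2).

(** Differential of [deck2]; the differential of [deck1] is the identity. *)
Definition ddeck2 (xi : C3) : C3 :=
  let '(xz, x1, x2) := xi in (xz, (x1 + x2)%C, x2).

Definition deck_step (w w' : C3) : Prop := w' = deck1 w \/ w' = deck2 w.

(** Since [deck1] and [deck2] are bijections, the orbits of the group they
    generate are the classes of the equivalence relation they generate. *)
Definition same_orbit : relation C3 := clos_refl_sym_trans C3 deck_step.

Definition X : Type := {A : C3 -> Prop | exists w, A = same_orbit w}.

Definition proj (w : C3) : X :=
  exist _ (same_orbit w) (ex_intro _ w eq_refl).

(** [proj] is a local biholomorphism, so [f] is holomorphic on [X] exactly when
    its pullback to C^3 is complex differentiable everywhere. *)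
Definition holomorphic (f : X -> C) : Prop :=
  forall w : C3,
    ex_filterdiff (K := C_AbsRing)
      (U := prod_NormedModule C_AbsRing
              (prod_NormedModule C_AbsRing C_NormedModule C_NormedModule)
              C_NormedModule)
      (V := C_NormedModule)
      (fun w' => f (proj w')) (locally w).

(** * Differential calculus on the cover *)

Definition move (w : C3) (s : R) (e : C3) : C3 :=
  let '(z, v1, v2) := w in
  let '(ez, e1, e2) := e in
  ((z + s * ez)%C, (v1 + s * e1)%C, (v2 + s * e2)%C).

Definition ex_dir_deriv (e : C3) (F : C3 -> C) (w : C3) : Prop :=
  ex_derive (fun s : R => Re (F (move w s e))) 0 /\
  ex_derive (fun s : R => Im (F (move w s e))) 0.

Definition dir_deriv (e : C3) (F : C3 -> C) (w : C3) : C :=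
  (Derive (fun s : R => Re (F (move w s e))) 0,
   Derive (fun s : R => Im (F (move w s e))) 0).

Definition iter_deriv (l : list C3) (F : C3 -> C) : C3 -> C :=
  fold_right dir_deriv F l.

(** C^infinity in the real sense: all iterated directional derivatives exist
    and are continuous. *)
Definition smooth3 (F : C3 -> C) : Prop :=
  forall (l : list C3) (w : C3),
    continuous (iter_deriv l F : C * C * C -> C) w /\
    (forall e : C3, ex_dir_deriv e (iter_deriv l F) w).

(** Wirtinger derivatives (d/dx - i d/dy)/2 and (d/dx + i d/dy)/2. *)
Definition dw (a : idx) (F : C3 -> C) (w : C3) : C :=
  ((dir_deriv (basis3 1 a) F w - Ci * dir_deriv (basis3 Ci a) F w) / 2)%C.

Definition dwbar (a : idx) (F : C3 -> C) (w : C3) : C :=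
  ((dir_deriv (basis3 1 a) F w + Ci * dir_deriv (basis3 Ci a) F w) / 2)%C.

(** * Kähler metrics on [X] *)

(** [g w a b] is the coefficient g_{a \bar b}(w) of the pullback to C^3 of the
    Kähler form  i * sum_{a,b} g_{a \bar b} dw^a /\ d\bar w^b. *)
Definition metric : Type := C3 -> idx -> idx -> C.

Definition hform (g : metric) (w xi eta : C3) : C :=
  sum3 (fun a => sum3 (fun b => g w a b * coord xi a * Cconj (coord eta b))%C).

Definition descends (g : metric) : Prop :=
  (forall w xi eta, hform g (deck1 w) xi eta = hform g w xi eta) /\
  (forall w xi eta,
     hform g (deck2 w) (ddeck2 xi) (ddeck2 eta) = hform g w xi eta).

(** The (2,1) and (1,2) parts of  d omega = 0. *)
Definition closed_form (g : metric) : Prop :=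
  (forall a b c w,
     dw c (fun w' => g w' a b) w = dw a (fun w' => g w' c b) w) /\
  (forall a b c w,
     dwbar c (fun w' => g w' a b) w = dwbar b (fun w' => g w' a c) w).

Record kahler (g : metric) : Prop := {
  kahler_descends : descends g;
  kahler_smooth : forall a b, smooth3 (fun w => g w a b);
  kahler_hermitian : forall w a b, g w b a = Cconj (g w a b);
  kahler_positive :
    forall w xi, xi <> (RtoC 0, RtoC 0, RtoC 0) -> 0 < Re (hform g w xi xi);
  kahler_closed : closed_form g
}.

(** * Metrics of the Calabi type *)

(** The function t = |v|_h^2, pulled back to C^3. *)
Definition fiber_norm2 (k : R) (w : C3) : R :=
  let '(z, v1, v2) := w in
  Cmod (v1 - Im z * v2)%C ^ 2 + k * Cmod v2 ^ 2.

Lemma fiber_norm2_deck (k : R) (w : C3) :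
  fiber_norm2 k (deck1 w) = fiber_norm2 k w /\
  fiber_norm2 k (deck2 w) = fiber_norm2 k w.
Proof.
destruct w as [[[x y] [a b]] [c d]]; unfold fiber_norm2, deck1, deck2; split;
  (apply f_equal2; [apply f_equal2; [apply f_equal|]|]); try reflexivity;
  apply injective_projections; simpl; ring.
Qed.

(** Smoothness on [0, +oo): u is smooth on an open neighbourhood. *)
Definition smooth_half_line (u : R -> R) : Prop :=
  exists eps : R, 0 < eps /\
    forall (n : nat) (t : R), - eps < t -> ex_derive_n u n t.

Definition base_form (a b : idx) : C :=
  match a, b with Iz, Iz => RtoC 1 | _, _ => RtoC 0 end.

Definition calabi_type (k : R) (g : metric) : Prop :=
  exists u : R -> R, smooth_half_line u /\
    forall w a b,
      g w a b =
      (base_form a b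
       + dw a (dwbar b (fun w' => RtoC (u (fiber_norm2 k w')))) w)%C.

(** * Distance and completeness *)

(** Norm of the Riemannian metric g(x, y) = omega(x, J y) underlying the Kähler
    form; this convention makes |xi|^2 = 2 sum g_{a \bar b} xi^a \bar xi^b. *)
Definition gnorm (g : metric) (w xi : C3) : R :=
  sqrt (2 * Re (hform g w xi xi)).

Definition C1_curve (c : R -> C3) : Prop :=
  forall (a : idx) (s : R), 0 <= s <= 1 ->
    ex_derive (fun r => Re (coord (c r) a)) s /\
    ex_derive (fun r => Im (coord (c r) a)) s /\
    continuous (Derive (fun r => Re (coord (c r) a))) s /\
    continuous (Derive (fun r => Im (coord (c r) a))) s.

Definition velocity (c : R -> C3) (s : R) : C3 :=
  let D a := (Derive (fun r => Re (coord (c r) a)) s,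
              Derive (fun r => Im (coord (c r) a)) s) in
  (D Iz, D Iv1, D Iv2).

Definition curve_length (g : metric) (c : R -> C3) : R :=
  RInt (fun s => gnorm g (c s) (velocity c s)) 0 1.

(** [path_length g x y l]: some piecewise C^1 path in [X] from [x] to [y] has
    length [l].  Each C^1 piece is given by a lift to the cover, parametrised
    by [0, 1]. *)
Inductive path_length (g : metric) : X -> X -> R -> Prop :=
| path_nil : forall x, path_length g x x 0
| path_cons : forall (c : R -> C3) (y : X) (l : R),
    C1_curve c ->
    path_length g (proj (c 1)) y l ->
    path_length g (proj (c 0)) y (curve_length g c + l).

Definition dist (g : metric) (x y : X) : R :=
  real (Glb_Rbar (path_length g x y)).

Definition complete (g : metric) : Prop :=
  forall x : nat -> X,
    (forall eps, 0 < eps -> exists N : nat, forall m n : nat,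
        (N <= m)%nat -> (N <= n)%nat -> dist g (x m) (x n) < eps) ->
    exists y : X, forall eps, 0 < eps -> exists N : nat, forall n : nat,
        (N <= n)%nat -> dist g (x n) y < eps.

(** * Hadamard order *)

(** The infima are taken in the extended reals; that of the empty set is +oo. *)
Definition hadamard_order (g : metric) (p : X) (f : X -> C) : Rbar :=
  Glb_Rbar (fun rho => 0 < rho /\
    exists C1 C2 : R, 0 < C1 /\ 0 < C2 /\
      forall q : X,
        Cmod (f q) <= C1 * exp (C2 * Rpower (dist g q p + 1) rho)).

Definition d_Hmin (g : metric) (p : X) : Rbar :=
  Rbar_glb (fun d => exists f : X -> C,
    holomorphic f /\ (exists q q' : X, f q <> f q') /\
    d = hadamard_order g p f).

(* Main.v *)
Require Import Defs.
From Stdlib Require Import Reals Lra Lia Relations ClassicalEpsilon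
  FunctionalExtensionality PropExtensionality ProofIrrelevance.
From Coquelicot Require Import Coquelicot.
(* Imported again because the real library has its own [dist]. *)
Require Import Defs.
Open Scope R_scope.

(** In suitable vertical coordinates the form of [u] is
      (1 + u' (k |b|^2 - |a|^2) / (4 k)) |dz|^2 + (the U(2)-invariant fibre metric of [u]),
    where [a = v1 - (Im z) v2] and [b = v2].  Since the curvature of [h] takes both
    signs, positivity forces the moment [t u'(t)], which increases, to stay below
    [4 k].  The radial length element is the square root of its derivative in [log t],
    so by Cauchy-Schwarz the distance is [O(sqrt (log t))] along a fibre.  A
    holomorphic function of order less than 2 therefore grows more slowly than any
    power on each fibre, hence is constant there; what remains is a doubly periodic
    entire function of [z].

    Conversely, if [4 k - t u'(t)] decays like [1 / log log t], the distance to the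
    zero section is at least [sqrt (log t) / log log t] up to a constant.  The metric
    is then complete, and the linear function [v2] has order 2.

    Liouville's theorem for pointwise differentiable functions is obtained from
    Goursat's lemma, in the form that a pointwise differentiable closed form
    [P dx + Q dy] on the plane has a primitive. *)

(** * Goursat's lemma and Liouville's theorem *)

(** Put s = log t and m = t u'(t). The value 2 is a balance of scales: log |v2| is of size s/2,
    while a bounded m allows distances of size sqrt s at most. The example needs the derivative of m
    in s to be integrable and its square root not to be. A tail s^(-1-delta) yields distances
    s^((1-delta)/2), so v2 would have order 2/(1-delta) > 2; the tail 1/(s (log s)^2) loses less
    than any power, whence the double logarithm. [holomorphic] asks for a derivative at each point,
    with no continuity of that derivative, so a circle integral cannot be differentiated under the
    integral sign. Primitives restore class C^1, and growth o(|z|) is transferred to their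
    increments under a fixed shift. Smoothness and closedness of a metric involve derivatives of
    every order of u(|v|_h^2). These are computed on syntactic expressions: smoothness becomes
    closure of a class under differentiation, and d omega = 0 becomes commutation of formal
    derivatives. *)

Lemma div_pow2_split (C : R) (n : nat) :
  C / 2 ^ n = C / 2 ^ S n + C / 2 ^ S n.
Proof. simpl. field. apply pow_nonzero. lra. Qed.

(** The intervals of centre [x n] and radius [C / 2 ^ n] are nested; [l] is the supremum of their
    left ends, which gives the rate along with the limit. *)
Lemma geometric_limit (x : nat -> R) (C : R) :
  (forall n, Rabs (x (S n) - x n) <= C / 2 ^ S n) ->
  exists l, forall n, Rabs (l - x n) <= C / 2 ^ n.
Proof.
intros Hx.
assert (Hlow : forall n m, x n - C / 2 ^ n <= x (m + n)%nat - C / 2 ^ (m + n)).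
{ intros n m; induction m as [|m IH]; [simpl; lra|].
  change (S m + n)%nat with (S (m + n)).
  pose proof (div_pow2_split C (m + n)).
  pose proof (Hx (m + n)%nat) as H1. apply Rabs_le_between in H1. lra. }
assert (Hup : forall n m, x (m + n)%nat + C / 2 ^ (m + n) <= x n + C / 2 ^ n).
{ intros n m; induction m as [|m IH]; [simpl; lra|].
  change (S m + n)%nat with (S (m + n)).
  pose proof (div_pow2_split C (m + n)).
  pose proof (Hx (m + n)%nat) as H1. apply Rabs_le_between in H1. lra. }
assert (HC : forall n, 0 <= C / 2 ^ n).
{ assert (0 <= C).
  { pose proof (Hx 0%nat). pose proof (Rabs_pos (x 1%nat - x 0%nat)). simpl in *. lra. }
  intros n. apply Rdiv_le_0_compat; [lra|]. apply pow_lt; lra. }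
assert (Hcross : forall m n, x m - C / 2 ^ m <= x n + C / 2 ^ n).
{ intros m n.
  pose proof (Hlow m n). pose proof (Hup n m). rewrite (Nat.add_comm n m) in *.
  pose proof (HC (m + n)%nat). lra. }
destruct (completeness (fun r => exists n, r = x n - C / 2 ^ n)) as [l [Hl1 Hl2]].
- exists (x 0%nat + C / 2 ^ 0). intros r [n ->]. apply Hcross.
- exists (x 0%nat - C / 2 ^ 0). now exists 0%nat.
- exists l. intros n. apply Rabs_le_between. split.
  + assert (x n - C / 2 ^ n <= l) by (apply Hl1; now exists n). lra.
  + assert (l <= x n + C / 2 ^ n) by (apply Hl2; intros r [m ->]; apply Hcross). lra.
Qed.

(** Dependent choice for subdivision arguments: [T n] packs a corner with its proof of [Bad], so
    that the recursion can apply [Hstep] again. *)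
Lemma bisection (Bad : R -> R -> nat -> Prop) (W H x0 y0 : R) :
  Bad x0 y0 0%nat ->
  (forall x y n, Bad x y n -> exists x' y', Bad x' y' (S n) /\
     Rabs (x' - x) <= Rabs W / 2 ^ S n /\ Rabs (y' - y) <= Rabs H / 2 ^ S n) ->
  exists X Y, forall n, exists x y, Bad x y n /\
     Rabs (X - x) <= Rabs W / 2 ^ n /\ Rabs (Y - y) <= Rabs H / 2 ^ n.
Proof.
intros H0 Hstep.
set (T n := {p : R * R | Bad (fst p) (snd p) n}).
assert (step : forall n (p : T n), {q : T (S n) |
   Rabs (fst (proj1_sig q) - fst (proj1_sig p)) <= Rabs W / 2 ^ S n /\
   Rabs (snd (proj1_sig q) - snd (proj1_sig p)) <= Rabs H / 2 ^ S n}).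
{ intros n [[x y] Hp]. apply constructive_indefinite_description.
  destruct (Hstep x y n Hp) as (x' & y' & Hb & Hx & Hy).
  exists (exist _ (x', y') Hb). now split. }
set (s := nat_rect T (exist _ (x0, y0) H0) (fun n p => proj1_sig (step n p))).
destruct (geometric_limit (fun n => fst (proj1_sig (s n))) (Rabs W)) as [X HX].
{ intros n. apply (proj2_sig (step n (s n))). }
destruct (geometric_limit (fun n => snd (proj1_sig (s n))) (Rabs H)) as [Y HY].
{ intros n. apply (proj2_sig (step n (s n))). }
exists X, Y. intros n. exists (fst (proj1_sig (s n))), (snd (proj1_sig (s n))).
split; [apply (proj2_sig (s n))|split; auto].
Qed.

(** * Boundary integrals over rectangles and primitives of closed forms *)

Lemma continuity_2d_line (f : R -> R -> R) (a b : R -> R) (s : R) :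
  continuity_2d_pt f (a s) (b s) -> continuous a s -> continuous b s ->
  continuous (fun r => f (a r) (b r)) s.
Proof.
intros Hf Ha Hb. apply filterlim_locally. intros eps.
destruct (Hf eps) as [d Hd].
pose proof (proj1 (filterlim_locally a (a s)) Ha d) as H1.
pose proof (proj1 (filterlim_locally b (b s)) Hb d) as H2.
generalize (filter_and _ _ H1 H2). apply filter_imp.
intros r [Hr1 Hr2]. apply Hd; [apply Hr1|apply Hr2].
Qed.

Lemma continuity_2d_fst (f : R -> R -> R) (x y : R) :
  continuity_2d_pt f x y -> continuous (fun s => f s y) x.
Proof.
intros H. apply (continuity_2d_line f (fun s => s) (fun _ => y)); auto.
apply continuous_id. apply continuous_const.
Qed.

Lemma continuity_2d_snd (f : R -> R -> R) (x y : R) :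
  continuity_2d_pt f x y -> continuous (fun s => f x s) y.
Proof.
intros H. apply (continuity_2d_line f (fun _ => x) (fun s => s)); auto.
apply continuous_const. apply continuous_id.
Qed.

Lemma differentiable_continuity (f : R -> R -> R) (x y lx ly : R) :
  differentiable_pt_lim f x y lx ly -> continuity_2d_pt f x y.
Proof. intros H. apply differentiable_continuity_pt. now exists lx, ly. Qed.

(** The counterclockwise integral of [P dx + Q dy] around a rectangle. *)
Definition boundary_int (P Q : R -> R -> R) (x0 x1 y0 y1 : R) : R :=
  RInt (fun s => P s y0 - P s y1) x0 x1 + RInt (fun t => Q x1 t - Q x0 t) y0 y1.

Lemma ex_RInt_fst (P : R -> R -> R) (y a b : R) :
  (forall x y, continuity_2d_pt P x y) -> ex_RInt (fun s => P s y) a b.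
Proof.
intros HP. apply (ex_RInt_continuous (V := R_CompleteNormedModule)).
intros s _. now apply continuity_2d_fst.
Qed.

Lemma ex_RInt_snd (P : R -> R -> R) (x a b : R) :
  (forall x y, continuity_2d_pt P x y) -> ex_RInt (fun s => P x s) a b.
Proof.
intros HP. apply (ex_RInt_continuous (V := R_CompleteNormedModule)).
intros s _. now apply continuity_2d_snd.
Qed.

Lemma boundary_int_expand (P Q : R -> R -> R) (x0 x1 y0 y1 : R) :
  (forall x y, continuity_2d_pt P x y) -> (forall x y, continuity_2d_pt Q x y) ->
  boundary_int P Q x0 x1 y0 y1 =
  RInt (fun s => P s y0) x0 x1 - RInt (fun s => P s y1) x0 x1 +
  (RInt (fun t => Q x1 t) y0 y1 - RInt (fun t => Q x0 t) y0 y1).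
Proof.
intros HP HQ. unfold boundary_int.
f_equal.
- exact (RInt_minus (fun s => P s y0) (fun s => P s y1) x0 x1
    (ex_RInt_fst P y0 x0 x1 HP) (ex_RInt_fst P y1 x0 x1 HP)).
- exact (RInt_minus (fun t => Q x1 t) (fun t => Q x0 t) y0 y1
    (ex_RInt_snd Q x1 y0 y1 HQ) (ex_RInt_snd Q x0 y0 y1 HQ)).
Qed.

Lemma boundary_int_quarter (P Q : R -> R -> R) (x0 x1 x2 y0 y1 y2 : R) :
  (forall x y, continuity_2d_pt P x y) -> (forall x y, continuity_2d_pt Q x y) ->
  boundary_int P Q x0 x2 y0 y2 =
  boundary_int P Q x0 x1 y0 y1 + boundary_int P Q x1 x2 y0 y1 +
  (boundary_int P Q x0 x1 y1 y2 + boundary_int P Q x1 x2 y1 y2).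
Proof.
intros HP HQ. rewrite !boundary_int_expand by auto.
assert (EP : forall y, RInt (fun s => P s y) x0 x2 =
  RInt (fun s => P s y) x0 x1 + RInt (fun s => P s y) x1 x2).
{ intros y. symmetry. apply (RInt_Chasles (V := R_CompleteNormedModule));
  apply ex_RInt_fst; auto. }
assert (EQ : forall x, RInt (fun s => Q x s) y0 y2 =
  RInt (fun s => Q x s) y0 y1 + RInt (fun s => Q x s) y1 y2).
{ intros y. symmetry. apply (RInt_Chasles (V := R_CompleteNormedModule));
  apply ex_RInt_snd; auto. }
rewrite !EP, !EQ. ring.
Qed.

(** Both orientations are covered because [goursat] puts no order on the corners: a side may have
    negative length. *)
Lemma RInt_near_const (f : R -> R) (a b c M : R) :
  ex_RInt f a b ->
  (forall t, Rmin a b <= t <= Rmax a b -> Rabs (f t - c) <= M) ->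
  Rabs (RInt f a b - (b - a) * c) <= Rabs (b - a) * M.
Proof.
intros Hf HM.
assert (E : forall a b, ex_RInt f a b -> RInt f a b - (b - a) * c = RInt (fun t => f t - c) a b).
{ clear. intros a b Hf. rewrite (RInt_minus (V := R_CompleteNormedModule) f (fun _ => c)).
  - rewrite RInt_const. reflexivity.
  - exact Hf.
  - apply ex_RInt_const. }
destruct (Rle_dec a b) as [Hab|Hab].
- rewrite E by auto. rewrite (Rabs_pos_eq (b - a)) by lra.
  apply abs_RInt_le_const; auto.
  + apply (ex_RInt_minus (V := R_NormedModule)); [auto|apply ex_RInt_const].
  + intros t Ht. apply HM. rewrite Rmin_left, Rmax_right by lra. lra.
- replace (RInt f a b - (b - a) * c) with (- (RInt f b a - (a - b) * c)).
  2:{ rewrite <- (opp_RInt_swap f b a) by now apply ex_RInt_swap.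
      change (opp (RInt f b a)) with (- RInt f b a). ring. }
  rewrite Rabs_Ropp, E by now apply ex_RInt_swap.
  rewrite (Rabs_left1 (b - a)) by lra.
  replace (- (b - a)) with (a - b) by ring.
  apply abs_RInt_le_const; [lra| |].
  + apply (ex_RInt_minus (V := R_NormedModule)); [now apply ex_RInt_swap|apply ex_RInt_const].
  + intros t Ht. apply HM. rewrite Rmin_right, Rmax_left by lra. lra.
Qed.

Lemma Rabs_between (a w t X r : R) :
  Rmin a (a + w) <= t <= Rmax a (a + w) -> Rabs (X - a) <= r -> Rabs w <= r ->
  Rabs (t - X) <= 2 * r.
Proof.
intros Ht HX Hw. apply Rabs_le_between in HX. apply Rabs_le_between in Hw.
apply Rabs_le_between. unfold Rmin, Rmax in Ht.
destruct (Rle_dec a (a + w)); lra.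
Qed.

(* The boundary integral of the affine part vanishes because [P_y = Q_x]. *)
Lemma boundary_int_local (P Q : R -> R -> R) (X Y px py qy : R) :
  (forall x y, continuity_2d_pt P x y) -> (forall x y, continuity_2d_pt Q x y) ->
  differentiable_pt_lim P X Y px py -> differentiable_pt_lim Q X Y py qy ->
  forall eps : posreal, exists d : posreal, forall x y w h r,
    r < d -> Rabs (X - x) <= r -> Rabs (Y - y) <= r -> Rabs w <= r -> Rabs h <= r ->
    Rabs (boundary_int P Q x (x + w) y (y + h)) <= eps * r ^ 2.
Proof.
intros HP HQ DP DQ eps.
(* The rectangle stays within [2 * r] of [(X, Y)]. Each of its four sides, of length at most [r],
   contributes an error [eps / 8 * (2 * r) * r], in total [eps * r ^ 2]. *)
assert (He : 0 < eps / 8) by (pose proof (cond_pos eps); lra).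
destruct (DP (mkposreal _ He)) as [d1 H1]. destruct (DQ (mkposreal _ He)) as [d2 H2].
simpl in H1, H2.
assert (Hd : 0 < Rmin d1 d2 / 2).
{ pose proof (Rmin_pos _ _ (cond_pos d1) (cond_pos d2)). lra. }
exists (mkposreal _ Hd). simpl. intros x y w h r Hr Hx Hy Hw Hh.
pose proof (Rmin_l d1 d2). pose proof (Rmin_r d1 d2).
assert (Hr0 : 0 <= r) by (pose proof (Rabs_pos w); lra).
assert (Hmul : forall m, m <= 2 * r -> eps / 8 * m <= eps * r / 4).
{ intros m Hm. replace (eps * r / 4) with (eps / 8 * (2 * r)) by field.
  apply Rmult_le_compat_l; lra. }
assert (BP : forall s t, Rabs (s - X) <= 2 * r -> Rabs (t - Y) <= 2 * r ->
   Rabs (P s t - P X Y - (px * (s - X) + py * (t - Y))) <= eps * r / 4).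
{ intros s t Hs Ht. eapply Rle_trans; [apply H1; lra|]. apply Hmul. now apply Rmax_lub. }
assert (BQ : forall s t, Rabs (s - X) <= 2 * r -> Rabs (t - Y) <= 2 * r ->
   Rabs (Q s t - Q X Y - (py * (s - X) + qy * (t - Y))) <= eps * r / 4).
{ intros s t Hs Ht. eapply Rle_trans; [apply H2; lra|]. apply Hmul. now apply Rmax_lub. }
assert (Exw : Rabs (x + w - X) <= 2 * r).
{ apply (Rabs_between x w); auto. split; [apply Rmin_r|apply Rmax_r]. }
assert (Ex : Rabs (x - X) <= 2 * r).
{ apply (Rabs_between x w); auto. split; [apply Rmin_l|apply Rmax_l]. }
assert (Eyh : Rabs (y + h - Y) <= 2 * r).
{ apply (Rabs_between y h); auto. split; [apply Rmin_r|apply Rmax_r]. }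
assert (Ey : Rabs (y - Y) <= 2 * r).
{ apply (Rabs_between y h); auto. split; [apply Rmin_l|apply Rmax_l]. }
unfold boundary_int.
pose proof (RInt_near_const (fun s => P s y - P s (y + h)) x (x + w) (- py * h) (eps * r / 2)) as IP.
pose proof (RInt_near_const (fun t => Q (x + w) t - Q x t) y (y + h) (py * w) (eps * r / 2)) as IQ.
replace (x + w - x) with w in IP by ring. replace (y + h - y) with h in IQ by ring.
assert (IP' : Rabs (RInt (fun s => P s y - P s (y + h)) x (x + w) - w * (- py * h)) <= r * (eps * r / 2)).
{ eapply Rle_trans; [apply IP|].
  - apply (ex_RInt_minus (V := R_NormedModule)); apply ex_RInt_fst; auto.
  - intros t Ht. assert (Et : Rabs (t - X) <= 2 * r) by now apply (Rabs_between x w).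
    pose proof (BP t y Et Ey) as B1. pose proof (BP t (y + h) Et Eyh) as B2.
    apply Rabs_le_between in B1. apply Rabs_le_between in B2. apply Rabs_le_between. lra.
  - apply Rmult_le_compat_r; auto. pose proof (cond_pos eps).
    apply Rmult_le_pos; [apply Rmult_le_pos|]; lra. }
assert (IQ' : Rabs (RInt (fun t => Q (x + w) t - Q x t) y (y + h) - h * (py * w)) <= r * (eps * r / 2)).
{ eapply Rle_trans; [apply IQ|].
  - apply (ex_RInt_minus (V := R_NormedModule)); apply ex_RInt_snd; auto.
  - intros t Ht. assert (Et : Rabs (t - Y) <= 2 * r) by now apply (Rabs_between y h).
    pose proof (BQ x t Ex Et) as B1. pose proof (BQ (x + w) t Exw Et) as B2.
    apply Rabs_le_between in B1. apply Rabs_le_between in B2. apply Rabs_le_between. lra.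
  - apply Rmult_le_compat_r; auto. pose proof (cond_pos eps).
    apply Rmult_le_pos; [apply Rmult_le_pos|]; lra. }
apply Rabs_le_between in IP'. apply Rabs_le_between in IQ'. apply Rabs_le_between. simpl. lra.
Qed.

(** Bisection keeps a rectangle whose integral is at least [K / 4 ^ n] in modulus, whereas
    differentiability at the limit point makes the integral o(4^(-n)). *)
Lemma goursat (P Q : R -> R -> R) :
  (forall x y, exists px py qy,
     differentiable_pt_lim P x y px py /\ differentiable_pt_lim Q x y py qy) ->
  forall x0 x1 y0 y1, boundary_int P Q x0 x1 y0 y1 = 0.
Proof.
intros HD x0 x1 y0 y1.
assert (HP : forall x y, continuity_2d_pt P x y).
{ intros x y. destruct (HD x y) as (px & py & qy & H & _). eapply differentiable_continuity; eauto. }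
assert (HQ : forall x y, continuity_2d_pt Q x y).
{ intros x y. destruct (HD x y) as (px & py & qy & _ & H). eapply differentiable_continuity; eauto. }
set (W := x1 - x0). set (H := y1 - y0).
replace x1 with (x0 + W) by (unfold W; ring). replace y1 with (y0 + H) by (unfold H; ring).
destruct (Req_dec (boundary_int P Q x0 (x0 + W) y0 (y0 + H)) 0) as [|NZ]; auto. exfalso.
set (K := Rabs (boundary_int P Q x0 (x0 + W) y0 (y0 + H))).
assert (HK : 0 < K) by now apply Rabs_pos_lt.
assert (P2 : forall n, 0 < 2 ^ n) by (intros; apply pow_lt; lra).
assert (P4 : forall n, 0 < 4 ^ n) by (intros; apply pow_lt; lra).
destruct (bisection (fun x y n =>
   K / 4 ^ n <= Rabs (boundary_int P Q x (x + W / 2 ^ n) y (y + H / 2 ^ n))) W H x0 y0) as (X & Y & HXY).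
- simpl. unfold Rdiv. rewrite Rinv_1, !Rmult_1_r. apply Rle_refl.
- intros x y n Hn.
  set (w := W / 2 ^ S n). set (h := H / 2 ^ S n).
  assert (Ew : W / 2 ^ n = w + w) by apply div_pow2_split.
  assert (Eh : H / 2 ^ n = h + h) by apply div_pow2_split.
  rewrite Ew, Eh, <- !Rplus_assoc in Hn.
  rewrite (boundary_int_quarter P Q x (x + w) (x + w + w) y (y + h) (y + h + h)) in Hn by auto.
  assert (E4 : K / 4 ^ n = 4 * (K / 4 ^ S n)).
  { simpl. field. specialize (P4 n). lra. }
  assert (Bw : Rabs (x + w - x) <= Rabs W / 2 ^ S n).
  { replace (x + w - x) with (W / 2 ^ S n) by (unfold w; ring).
    rewrite Rabs_div by (specialize (P2 (S n)); lra).
    rewrite (Rabs_pos_eq (2 ^ S n)) by (specialize (P2 (S n)); lra). lra. }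
  assert (Bh : Rabs (y + h - y) <= Rabs H / 2 ^ S n).
  { replace (y + h - y) with (H / 2 ^ S n) by (unfold h; ring).
    rewrite Rabs_div by (specialize (P2 (S n)); lra).
    rewrite (Rabs_pos_eq (2 ^ S n)) by (specialize (P2 (S n)); lra). lra. }
  assert (Z : forall a b, Rabs (a - a) <= Rabs b / 2 ^ S n).
  { intros a b. rewrite Rminus_diag, Rabs_R0. apply Rdiv_le_0_compat; [apply Rabs_pos|apply P2]. }
  destruct (Rle_dec (K / 4 ^ S n) (Rabs (boundary_int P Q x (x + w) y (y + h)))) as [|N1];
    [exists x, y; auto|].
  destruct (Rle_dec (K / 4 ^ S n) (Rabs (boundary_int P Q (x + w) (x + w + w) y (y + h)))) as [|N2];
    [exists (x + w), y; auto|].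
  destruct (Rle_dec (K / 4 ^ S n) (Rabs (boundary_int P Q x (x + w) (y + h) (y + h + h)))) as [|N3];
    [exists x, (y + h); auto|].
  exists (x + w), (y + h). split; auto.
  fold w h.
  pose proof (Rabs_triang (boundary_int P Q x (x + w) y (y + h) + boundary_int P Q (x + w) (x + w + w) y (y + h))
    (boundary_int P Q x (x + w) (y + h) (y + h + h) + boundary_int P Q (x + w) (x + w + w) (y + h) (y + h + h))).
  pose proof (Rabs_triang (boundary_int P Q x (x + w) y (y + h)) (boundary_int P Q (x + w) (x + w + w) y (y + h))).
  pose proof (Rabs_triang (boundary_int P Q x (x + w) (y + h) (y + h + h)) (boundary_int P Q (x + w) (x + w + w) (y + h) (y + h + h))).
  lra.
- destruct (HD X Y) as (px & py & qy & DP & DQ).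
  set (S := Rmax (Rabs W) (Rabs H) + 1).
  assert (HS : 0 < S).
  { unfold S. pose proof (Rmax_l (Rabs W) (Rabs H)). pose proof (Rabs_pos W). lra. }
  (* With this precision the local estimate for side length [S / 2 ^ n] is half of [K / 4 ^ n]. *)
  assert (He : 0 < K / (2 * S ^ 2)).
  { apply Rdiv_lt_0_compat; auto. pose proof (pow_lt S 2 HS). lra. }
  destruct (boundary_int_local P Q X Y px py qy HP HQ DP DQ (mkposreal _ He)) as [d Hd].
  assert (exists n, S / 2 ^ n < d) as [n Hn].
  { destruct (pow_lt_1_zero (/ 2)) with (y := d / S) as [n Hn].
    - rewrite Rabs_pos_eq; lra.
    - apply Rdiv_lt_0_compat; auto. apply cond_pos.
    - exists n. specialize (Hn n (le_n n)). rewrite pow_inv in Hn.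
      rewrite Rabs_pos_eq in Hn by (left; apply Rinv_0_lt_compat, P2).
      apply Rmult_lt_compat_l with (r := S) in Hn; auto.
      replace (S * (d / S)) with (pos d) in Hn by (field; lra). exact Hn. }
  destruct (HXY n) as (x & y & Hb & Hx & Hy).
  assert (Hdiv : forall a, a <= S -> a / 2 ^ n <= S / 2 ^ n).
  { intros a Ha. apply Rmult_le_compat_r; auto. left. apply Rinv_0_lt_compat, P2. }
  assert (HW : Rabs W <= S) by (unfold S; pose proof (Rmax_l (Rabs W) (Rabs H)); lra).
  assert (HH : Rabs H <= S) by (unfold S; pose proof (Rmax_r (Rabs W) (Rabs H)); lra).
  specialize (Hd x y (W / 2 ^ n) (H / 2 ^ n) (S / 2 ^ n) Hn).
  assert (Hd' : Rabs (boundary_int P Q x (x + W / 2 ^ n) y (y + H / 2 ^ n)) <= K / (2 * S ^ 2) * (S / 2 ^ n) ^ 2).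
  { assert (E2 : Rabs (2 ^ n) = 2 ^ n) by (apply Rabs_pos_eq; left; apply P2).
    assert (N2 : 2 ^ n <> 0) by (specialize (P2 n); lra).
    apply Hd.
    - eapply Rle_trans; [apply Hx|]. now apply Hdiv.
    - eapply Rle_trans; [apply Hy|]. now apply Hdiv.
    - rewrite Rabs_div, E2 by auto. now apply Hdiv.
    - rewrite Rabs_div, E2 by auto. now apply Hdiv. }
  replace (K / (2 * S ^ 2) * (S / 2 ^ n) ^ 2) with (K / 4 ^ n / 2) in Hd'.
  + pose proof (Rdiv_lt_0_compat _ _ HK (P4 n)). lra.
  + replace (4 ^ n) with (2 ^ n * 2 ^ n) by (rewrite <- Rpow_mult_distr; f_equal; lra).
    field. split; [specialize (P2 n)|]; lra.
Qed.

(** By [goursat] the two edge paths from the origin to [(x, y)] define the same function; each path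
    turns one partial derivative into the fundamental theorem of calculus. *)
Lemma closed_form_primitive (P Q : R -> R -> R) :
  (forall x y, exists px py qy,
     differentiable_pt_lim P x y px py /\ differentiable_pt_lim Q x y py qy) ->
  exists F : R -> R -> R, forall x y,
    is_derive (fun s => F s y) x (P x y) /\ is_derive (fun t => F x t) y (Q x y).
Proof.
intros HD.
assert (HP : forall x y, continuity_2d_pt P x y).
{ intros x y. destruct (HD x y) as (px & py & qy & H & _). eapply differentiable_continuity; eauto. }
assert (HQ : forall x y, continuity_2d_pt Q x y).
{ intros x y. destruct (HD x y) as (px & py & qy & _ & H). eapply differentiable_continuity; eauto. }
exists (fun x y => RInt (fun s => P s 0) 0 x + RInt (fun t => Q x t) 0 y).
assert (E : forall x y, RInt (fun s => P s 0) 0 x + RInt (fun t => Q x t) 0 y =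
  RInt (fun s => P s y) 0 x + RInt (fun t => Q 0 t) 0 y).
{ intros x y. pose proof (goursat P Q HD 0 x 0 y) as G.
  rewrite boundary_int_expand in G by auto. lra. }
assert (D : forall (f : R -> R) c x, (forall s, continuous f s) ->
   is_derive (fun z => RInt f 0 z + c) x (f x)).
{ intros f c x Hf. replace (f x) with (plus (f x) zero) by apply Rplus_0_r.
  apply (is_derive_plus (V := R_NormedModule) (fun z => RInt f 0 z) (fun _ => c)); [|exact (is_derive_const (K := R_AbsRing) (V := R_NormedModule) c x)].
  apply (is_derive_RInt f _ 0); auto.
  apply filter_forall. intros z. apply (RInt_correct (V := R_CompleteNormedModule)).
  apply (ex_RInt_continuous (V := R_CompleteNormedModule)). auto. }
intros x y. split.
- apply (is_derive_ext (fun s => RInt (fun z => P z y) 0 s + RInt (fun t => Q 0 t) 0 y));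
    [intros s; symmetry; apply (E s y)|].
  apply (D (fun s => P s y)). intros s. now apply continuity_2d_fst.
- apply (is_derive_ext (fun t => RInt (fun z => Q x z) 0 t + RInt (fun s => P s 0) 0 x));
    [intros s; apply Rplus_comm|].
  apply (D (fun t => Q x t)). intros s. now apply continuity_2d_snd.
Qed.

(** * Complex primitives and Cauchy's estimate *)

Lemma partials_differentiable (F P Q : R -> R -> R) (x y : R) :
  (forall x y, continuity_2d_pt P x y) ->
  (forall x y, is_derive (fun s => F s y) x (P x y)) ->
  is_derive (fun t => F x t) y (Q x y) ->
  differentiable_pt_lim F x y (P x y) (Q x y).
Proof.
intros HP HFx HFy. apply filterdiff_differentiable_pt_lim.
apply (is_derive_filterdiff F x y P (Q x y)).
- apply filter_forall. intros z. apply HFx.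
- exact HFy.
- apply continuity_2d_pt_filterlim, HP.
Qed.

(** This is the statement that U + iV is a complex primitive of u + iv, in real coordinates. *)
Definition cauchy_riemann_primitive (u v U V : R -> R -> R) : Prop :=
  forall x y,
    (is_derive (fun s => U s y) x (u x y) /\ is_derive (fun t => U x t) y (- v x y)) /\
    (is_derive (fun s => V s y) x (v x y) /\ is_derive (fun t => V x t) y (u x y)).

Lemma continuity_2d_polar (u : R -> R -> R) (a b r t : R) :
  (forall x y, continuity_2d_pt u x y) ->
  continuity_2d_pt (fun r t => u (a + r * cos t) (b + r * sin t)) r t.
Proof.
intros Hu.
assert (H1 : continuity_2d_pt (fun r t => a + r * cos t) r t).
{ apply continuity_2d_pt_plus; [apply continuity_2d_pt_const|].
  apply continuity_2d_pt_mult; [apply continuity_2d_pt_id1|].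
  apply (continuity_1d_2d_pt_comp cos (fun _ t => t)); [apply continuity_cos|apply continuity_2d_pt_id2]. }
assert (H2 : continuity_2d_pt (fun r t => b + r * sin t) r t).
{ apply continuity_2d_pt_plus; [apply continuity_2d_pt_const|].
  apply continuity_2d_pt_mult; [apply continuity_2d_pt_id1|].
  apply (continuity_1d_2d_pt_comp sin (fun _ t => t)); [apply continuity_sin|apply continuity_2d_pt_id2]. }
intros eps. destruct (Hu (a + r * cos t) (b + r * sin t) eps) as [d Hd].
destruct (H1 d) as [d1 H1']. destruct (H2 d) as [d2 H2'].
exists (mkposreal _ (Rmin_pos _ _ (cond_pos d1) (cond_pos d2))). simpl.
intros r' t' Hr Ht. pose proof (Rmin_l d1 d2). pose proof (Rmin_r d1 d2).
apply Hd; [apply H1'|apply H2']; lra.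
Qed.

(* With [N r] the integral of [F(a + r e^it) e^(-it)] and [M r] that of
   [F'(a + r e^it)], one has [N' = M] and [N = r M], so that [M] is constant. *)
Lemma cauchy_estimate (u v U V : R -> R -> R) (a b r B : R) :
  (forall x y, continuity_2d_pt u x y) -> (forall x y, continuity_2d_pt v x y) ->
  cauchy_riemann_primitive u v U V -> 0 < r ->
  (forall t, Rabs (U (a + r * cos t) (b + r * sin t)) <= B /\
             Rabs (V (a + r * cos t) (b + r * sin t)) <= B) ->
  Rabs (u a b) <= 2 * B / r.
Proof.
intros Hu Hv HCR Hr HB.
assert (DU : forall x y, differentiable_pt_lim U x y (u x y) (- v x y)).
{ intros x y. apply (partials_differentiable U u (fun x y => - v x y)); auto; intros; apply HCR. }
assert (DV : forall x y, differentiable_pt_lim V x y (v x y) (u x y)).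
{ intros x y. apply (partials_differentiable V v u); auto; intros; apply HCR. }
assert (CU : forall x y, continuity_2d_pt U x y) by (intros; eapply differentiable_continuity; eauto).
assert (CV : forall x y, continuity_2d_pt V x y) by (intros; eapply differentiable_continuity; eauto).
assert (Dc : forall r t, derivable_pt_lim (fun r => a + r * cos t) r (cos t)).
{ intros; apply is_derive_Reals; auto_derive; auto; ring. }
assert (Ds : forall r t, derivable_pt_lim (fun r => b + r * sin t) r (sin t)).
{ intros; apply is_derive_Reals; auto_derive; auto; ring. }
assert (Dc' : forall r t, derivable_pt_lim (fun t => a + r * cos t) t (- r * sin t)).
{ intros; apply is_derive_Reals; auto_derive; auto; ring. }
assert (Ds' : forall r t, derivable_pt_lim (fun t => b + r * sin t) t (r * cos t)).
{ intros; apply is_derive_Reals; auto_derive; auto; ring. }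
set (G r t := U (a + r * cos t) (b + r * sin t) * cos t + V (a + r * cos t) (b + r * sin t) * sin t).
set (g r t := u (a + r * cos t) (b + r * sin t)).
assert (DG : forall r t, is_derive (fun r => G r t) r (g r t)).
{ intros r' t. unfold G, g.
  pose proof (derivable_pt_lim_comp_2d U _ _ r' _ _ _ _ (DU _ _) (Dc r' t) (Ds r' t)) as H1.
  pose proof (derivable_pt_lim_comp_2d V _ _ r' _ _ _ _ (DV _ _) (Dc r' t) (Ds r' t)) as H2.
  apply is_derive_Reals in H1. apply is_derive_Reals in H2.
  evar_last. apply (is_derive_plus (V := R_NormedModule)).
  apply (is_derive_scal_l (V := R_NormedModule)). exact H1.
  apply (is_derive_scal_l (V := R_NormedModule)). exact H2.
  unfold plus, scal; simpl; unfold mult; simpl.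
  transitivity (u (a + r' * cos t) (b + r' * sin t) * ((sin t)² + (cos t)²)).
  - unfold Rsqr. ring.
  - rewrite sin2_cos2. ring. }
assert (CG : forall r t, continuity_2d_pt G r t).
{ intros r' t. unfold G.
  apply continuity_2d_pt_plus; apply continuity_2d_pt_mult; try now apply continuity_2d_polar.
  apply (continuity_1d_2d_pt_comp cos (fun _ t => t)); [apply continuity_cos|apply continuity_2d_pt_id2].
  apply (continuity_1d_2d_pt_comp sin (fun _ t => t)); [apply continuity_sin|apply continuity_2d_pt_id2]. }
assert (Cg : forall r t, continuity_2d_pt g r t) by (intros; now apply continuity_2d_polar).
set (N r := RInt (G r) 0 (2 * PI)). set (M r := RInt (g r) 0 (2 * PI)).
assert (IG : forall r, ex_RInt (G r) 0 (2 * PI)) by (intros; now apply ex_RInt_snd).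
assert (Ig : forall r, ex_RInt (g r) 0 (2 * PI)) by (intros; now apply ex_RInt_snd).
assert (DN : forall r, is_derive N r (M r)).
{ intros r'. unfold N.
  replace (M r') with (RInt (fun t => Derive (fun u => G u t) r') 0 (2 * PI)).
  2:{ apply RInt_ext. intros t _. now apply is_derive_unique. }
  apply is_derive_RInt_param.
  - apply filter_forall. intros r'' t _. eexists. apply DG.
  - intros t _. apply continuity_2d_pt_ext with (f := g); auto.
    intros. symmetry. now apply is_derive_unique.
  - now apply filter_forall. }
assert (EN : forall r, N r = r * M r).
{ intros r'.
  (* With F = U + iV, [K] is -Im (F e^(-it)), and its derivative along the circle is [G - r' * g].
     Integrating over a period gives N = r M. *)
  set (K t := U (a + r' * cos t) (b + r' * sin t) * sin t - V (a + r' * cos t) (b + r' * sin t) * cos t).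
  assert (DK : forall t, is_derive K t (G r' t - r' * g r' t)).
  { intros t. unfold K.
    pose proof (derivable_pt_lim_comp_2d U _ _ t _ _ _ _ (DU _ _) (Dc' r' t) (Ds' r' t)) as H1.
    pose proof (derivable_pt_lim_comp_2d V _ _ t _ _ _ _ (DV _ _) (Dc' r' t) (Ds' r' t)) as H2.
    pose proof (derivable_pt_lim_minus _ _ t _ _ (derivable_pt_lim_mult _ _ t _ _ H1 (derivable_pt_lim_sin t))
       (derivable_pt_lim_mult _ _ t _ _ H2 (derivable_pt_lim_cos t))) as H3.
    apply is_derive_Reals in H3.
    unfold minus_fct, mult_fct in H3. evar_last. exact H3.
    unfold G, g.
    transitivity (U (a + r' * cos t) (b + r' * sin t) * cos t + V (a + r' * cos t) (b + r' * sin t) * sin t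
       - r' * u (a + r' * cos t) (b + r' * sin t) * ((sin t)² + (cos t)²)).
    - unfold Rsqr. ring.
    - rewrite sin2_cos2. ring. }
  assert (HK : is_RInt (fun t => G r' t - r' * g r' t) 0 (2 * PI) (minus (K (2 * PI)) (K 0))).
  { apply (is_RInt_derive (V := R_CompleteNormedModule)).
    - intros; apply DK.
    - intros t _. apply (continuous_minus (V := R_NormedModule)).
      + now apply continuity_2d_snd.
      + apply (continuous_scal_r (V := R_NormedModule)). now apply continuity_2d_snd. }
  assert (HK0 : minus (K (2 * PI)) (K 0) = 0).
  { unfold K. rewrite sin_2PI, cos_2PI, sin_0, cos_0. unfold minus, plus, opp; simpl. ring. }
  rewrite HK0 in HK. apply (is_RInt_unique (V := R_CompleteNormedModule)) in HK.
  pose proof (RInt_minus (G r') (fun t => r' * g r' t) 0 (2 * PI) (IG r')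
     (ex_RInt_scal (V := R_NormedModule) (g r') 0 (2 * PI) r' (Ig r'))) as E1.
  pose proof (RInt_scal (V := R_CompleteNormedModule) (g r') 0 (2 * PI) r' (Ig r')) as E2.
  unfold minus, plus, opp, scal in E1, E2; simpl in E1, E2; unfold mult in E2; simpl in E2.
  fold (N r') in E1. fold (M r') in E2. unfold Rminus in HK.
  rewrite HK, E2 in E1. lra. }
assert (DM : forall r, 0 < r -> is_derive M r 0).
{ intros r' Hr'. apply is_derive_ext_loc with (fun r => N r / r).
  - exists (mkposreal _ Hr'). intros y Hy. rewrite EN.
    change (Rabs (y - r') < r') in Hy. apply Rabs_lt_between' in Hy.
    change (y * M y / y = M y). field. lra.
  - evar_last. apply is_derive_div; [apply DN|apply is_derive_id|lra].
    unfold one; simpl. rewrite EN. field. lra. }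
assert (HM : M r = 2 * PI * u a b).
{ destruct (Req_dec (M r) (2 * PI * u a b)) as [|NE]; auto. exfalso.
  pose proof PI_RGT_0 as HPI.
  (* On a small circle, continuity at the centre puts [M s] within [2 * PI * eps] of the claimed
     value, which is half of the supposed gap; but [M s = M r]. *)
  set (eps := Rabs (M r - 2 * PI * u a b) / (4 * PI)).
  assert (He : 0 < eps).
  { apply Rdiv_lt_0_compat; [|lra]. apply Rabs_pos_lt. lra. }
  destruct (Hu a b (mkposreal _ He)) as [d Hd]. simpl in Hd.
  set (s := Rmin (d / 2) r).
  assert (Hs : 0 < s) by (apply Rmin_pos; auto; pose proof (cond_pos d); lra).
  assert (Hsd : s < d).
  { pose proof (Rmin_l (d / 2) r). fold s in H. pose proof (cond_pos d). lra. }
  assert (Es : M s = M r).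
  { destruct (MVT_gen M s r (fun _ => 0)) as (c & _ & Hc).
    - intros x Hx. apply DM.
      pose proof (Rmin_pos s r Hs Hr). lra.
    - intros x Hx. apply continuity_pt_filterlim.
      apply (ex_derive_continuous (V := R_NormedModule)). eexists. apply DM.
      pose proof (Rmin_pos s r Hs Hr). lra.
    - lra. }
  pose proof (RInt_near_const (g s) 0 (2 * PI) (u a b) eps (Ig s)) as H.
  rewrite Rminus_0_r, (Rabs_pos_eq (2 * PI)) in H by lra.
  fold (M s) in H. rewrite Es in H.
  assert (Rabs (M r - 2 * PI * u a b) <= 2 * PI * eps).
  { apply H. intros t _. left. apply Hd.
    - replace (a + s * cos t - a) with (s * cos t) by ring.
      rewrite Rabs_mult, (Rabs_pos_eq s) by lra.
      assert (Rabs (cos t) <= 1) by (apply Rabs_le_between; apply COS_bound). nra.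
    - replace (b + s * sin t - b) with (s * sin t) by ring.
      rewrite Rabs_mult, (Rabs_pos_eq s) by lra.
      assert (Rabs (sin t) <= 1) by (apply Rabs_le_between; apply SIN_bound). nra. }
  assert (2 * PI * eps = Rabs (M r - 2 * PI * u a b) / 2) by (unfold eps; field; lra).
  assert (0 < Rabs (M r - 2 * PI * u a b)) by (apply Rabs_pos_lt; lra). lra. }
pose proof PI_RGT_0 as HPI.
assert (BN : Rabs (N r) <= 2 * PI * (2 * B)).
{ replace (2 * PI) with (2 * PI - 0) at 1 by ring.
  apply abs_RInt_le_const; auto; [lra|].
  intros t _. unfold G. destruct (HB t) as [B1 B2].
  eapply Rle_trans; [apply Rabs_triang|]. rewrite !Rabs_mult.
  assert (Rabs (cos t) <= 1) by (apply Rabs_le_between; apply COS_bound).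
  assert (Rabs (sin t) <= 1) by (apply Rabs_le_between; apply SIN_bound).
  pose proof (Rabs_pos (cos t)). pose proof (Rabs_pos (sin t)).
  pose proof (Rabs_pos (U (a + r * cos t) (b + r * sin t))).
  pose proof (Rabs_pos (V (a + r * cos t) (b + r * sin t))). nra. }
rewrite EN, HM, !Rabs_mult, (Rabs_pos_eq r), (Rabs_pos_eq 2), (Rabs_pos_eq PI) in BN by lra.
apply Rmult_le_reg_l with (2 * PI * r).
- apply Rmult_lt_0_compat; lra.
- replace (2 * PI * r * (2 * B / r)) with (2 * PI * (2 * B)) by (field; lra). lra.
Qed.

Lemma increment_bound (f df : R -> R) (x h K : R) :
  (forall s, is_derive f s (df s)) ->
  (forall s, Rabs (s - x) <= Rabs h -> Rabs (df s) <= K) ->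
  Rabs (f (x + h) - f x) <= Rabs h * K.
Proof.
intros Hf HK.
destruct (MVT_gen f x (x + h) df) as (c & Hc & E).
- intros s _. apply Hf.
- intros s _. apply continuity_pt_filterlim.
  apply (ex_derive_continuous (V := R_NormedModule)). eexists. apply Hf.
- rewrite E. replace (x + h - x) with h by ring. rewrite Rabs_mult, Rmult_comm.
  apply Rmult_le_compat_l; [apply Rabs_pos|]. apply HK.
  revert Hc. unfold Rmin, Rmax, Rabs. destruct (Rle_dec x (x + h)); repeat destruct Rcase_abs; lra.
Qed.

Lemma shifted_primitive (u v U V : R -> R -> R) (p q : R) :
  cauchy_riemann_primitive u v U V ->
  cauchy_riemann_primitive
    (fun x y => u (x + p) (y + q) - u x y) (fun x y => v (x + p) (y + q) - v x y)
    (fun x y => U (x + p) (y + q) - U x y) (fun x y => V (x + p) (y + q) - V x y).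
Proof.
intros H.
assert (S2 : forall (F : R -> R -> R) (dF : R -> R -> R) x y,
   (forall x y, is_derive (fun s => F s y) x (dF x y)) ->
   is_derive (fun s => F (s + p) (y + q) - F s y) x (dF (x + p) (y + q) - dF x y)).
{ intros F dF x y HF.
  assert (H1 : is_derive (fun s => F (s + p) (y + q)) x (dF (x + p) (y + q))).
  { evar_last. apply (is_derive_comp (fun s => F s (y + q)) (fun s => s + p)). apply HF.
    apply (is_derive_plus (V := R_NormedModule) (fun s => s)). apply (is_derive_id (K := R_AbsRing)).
    apply (is_derive_const (K := R_AbsRing) (V := R_NormedModule)).
    unfold scal, plus, zero, one; simpl; unfold mult; simpl. ring. }
  apply (is_derive_minus (V := R_NormedModule) (fun s => F (s + p) (y + q)) (fun s => F s y)); auto. }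
assert (S3 : forall (F : R -> R -> R) (dF : R -> R -> R) x y,
   (forall x y, is_derive (fun t => F x t) y (dF x y)) ->
   is_derive (fun t => F (x + p) (t + q) - F x t) y (dF (x + p) (y + q) - dF x y)).
{ intros F dF x y HF.
  assert (H1 : is_derive (fun t => F (x + p) (t + q)) y (dF (x + p) (y + q))).
  { evar_last. apply (is_derive_comp (fun s => F (x + p) s) (fun s => s + q)). apply HF.
    apply (is_derive_plus (V := R_NormedModule) (fun s => s)). apply (is_derive_id (K := R_AbsRing)).
    apply (is_derive_const (K := R_AbsRing) (V := R_NormedModule)).
    unfold scal, plus, zero, one; simpl; unfold mult; simpl. ring. }
  apply (is_derive_minus (V := R_NormedModule) (fun t => F (x + p) (t + q)) (fun t => F x t)); auto. }
intros x y; split; split.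
- exact (S2 U u x y (fun a b => proj1 (proj1 (H a b)))).
- replace (- (v (x + p) (y + q) - v x y)) with (- v (x + p) (y + q) - - v x y) by ring.
  exact (S3 U (fun x y => - v x y) x y (fun a b => proj2 (proj1 (H a b)))).
- exact (S2 V v x y (fun a b => proj1 (proj2 (H a b)))).
- exact (S3 V u x y (fun a b => proj2 (proj2 (H a b)))).
Qed.

(** * Liouville's theorem for sublinear growth *)

Definition sublinear (u : R -> R -> R) : Prop :=
  forall eps, 0 < eps -> exists R0, forall x y,
    R0 <= Rabs x + Rabs y -> Rabs (u x y) <= eps * (Rabs x + Rabs y).

(* Cauchy's estimate is applied to the increments of a primitive, which are of class C^1. *)
Lemma primitive_liouville (u v U V : R -> R -> R) :
  (forall x y, continuity_2d_pt u x y) -> (forall x y, continuity_2d_pt v x y) ->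
  cauchy_riemann_primitive u v U V -> sublinear u -> sublinear v ->
  forall x y p q, u (x + p) (y + q) = u x y.
Proof.
intros Cu Cv HCR Gu Gv x y p q.
set (m := Rabs p + Rabs q).
assert (Hm : 0 <= m) by (pose proof (Rabs_pos p); pose proof (Rabs_pos q); unfold m; lra).
apply Rminus_diag_uniq. apply cond_eq. intros eps Heps. rewrite Rminus_0_r.
apply Rle_lt_trans with (eps / 2); [|lra].
(* On the circle of radius [r] the increments of the primitives are at most [m * (e * (3 * r))];
   Cauchy's estimate turns this into [6 * m * e], which is at most [eps / 2]. *)
set (e := eps / (12 * (m + 1))).
assert (He : 0 < e) by (apply Rdiv_lt_0_compat; lra).
destruct (Gu e He) as [R1 H1]. destruct (Gv e He) as [R2 H2].
(* Since |cos| + |sin| lies between 1 and 2, a point within [2 * m] of the circle has l1 norm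
   between [r - c] and [2 * r + c], hence at most [3 * r]. *)
set (c := Rabs x + Rabs y + 2 * m).
assert (Hc : 0 <= c) by (pose proof (Rabs_pos x); pose proof (Rabs_pos y); unfold c; lra).
set (r := Rmax (Rmax R1 R2) 1 + c).
assert (Hr1 : R1 + c <= r) by (unfold r; pose proof (Rmax_l (Rmax R1 R2) 1); pose proof (Rmax_l R1 R2); lra).
assert (Hr2 : R2 + c <= r) by (unfold r; pose proof (Rmax_l (Rmax R1 R2) 1); pose proof (Rmax_r R1 R2); lra).
assert (Hr3 : 1 + c <= r) by (unfold r; pose proof (Rmax_r (Rmax R1 R2) 1); lra).
pose proof (shifted_primitive u v U V p q HCR) as HS.
eapply Rle_trans.
- apply (cauchy_estimate _ _ _ _ x y r (m * (e * (3 * r)))) in HS; auto.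
  + exact HS.
  + intros x' y'. apply continuity_2d_pt_minus; auto.
    intros ep. destruct (Cu (x' + p) (y' + q) ep) as [d Hd]. exists d. intros a b Ha Hb. apply Hd.
    replace (a + p - (x' + p)) with (a - x') by ring. auto.
    replace (b + q - (y' + q)) with (b - y') by ring. auto.
  + intros x' y'. apply continuity_2d_pt_minus; auto.
    intros ep. destruct (Cv (x' + p) (y' + q) ep) as [d Hd]. exists d. intros a b Ha Hb. apply Hd.
    replace (a + p - (x' + p)) with (a - x') by ring. auto.
    replace (b + q - (y' + q)) with (b - y') by ring. auto.
  + lra.
  + intros t. set (x1 := x + r * cos t). set (y1 := y + r * sin t).
    assert (Hcs : 1 <= Rabs (cos t) + Rabs (sin t) <= 2).
    { pose proof (sin2_cos2 t) as E. unfold Rsqr in E.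
      assert (Rabs (cos t) <= 1) by (apply Rabs_le_between; apply COS_bound).
      assert (Rabs (sin t) <= 1) by (apply Rabs_le_between; apply SIN_bound).
      pose proof (Rabs_pos (cos t)). pose proof (Rabs_pos (sin t)).
      pose proof (Rsqr_abs (cos t)) as E1. pose proof (Rsqr_abs (sin t)) as E2. unfold Rsqr in *.
      nra. }
    assert (Hfar : forall a b, Rabs (a - x1) + Rabs (b - y1) <= 2 * m ->
       r - c <= Rabs a + Rabs b <= 3 * r).
    { intros a b Hab.
      assert (A1 : Rabs (a - x - r * cos t) + Rabs (b - y - r * sin t) <= 2 * m).
      { replace (a - x - r * cos t) with (a - x1) by (unfold x1; ring).
        replace (b - y - r * sin t) with (b - y1) by (unfold y1; ring). auto. }
      pose proof (Rabs_triang_inv (r * cos t) (r * cos t - a)) as T1.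
      pose proof (Rabs_triang_inv (r * sin t) (r * sin t - b)) as T2.
      replace (r * cos t - (r * cos t - a)) with a in T1 by ring.
      replace (r * sin t - (r * sin t - b)) with b in T2 by ring.
      pose proof (Rabs_triang (r * cos t - a + x) (- x)) as T3.
      pose proof (Rabs_triang (r * sin t - b + y) (- y)) as T4.
      replace (r * cos t - a + x + - x) with (r * cos t - a) in T3 by ring.
      replace (r * sin t - b + y + - y) with (r * sin t - b) in T4 by ring.
      rewrite Rabs_Ropp in T3, T4.
      rewrite <- Rabs_Ropp in A1. rewrite <- (Rabs_Ropp (b - y - r * sin t)) in A1.
      replace (- (a - x - r * cos t)) with (r * cos t - a + x) in A1 by ring.
      replace (- (b - y - r * sin t)) with (r * sin t - b + y) in A1 by ring.
      pose proof (Rabs_triang (r * cos t) (- (r * cos t - a))) as T5.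
      pose proof (Rabs_triang (r * sin t) (- (r * sin t - b))) as T6.
      replace (r * cos t + - (r * cos t - a)) with a in T5 by ring.
      replace (r * sin t + - (r * sin t - b)) with b in T6 by ring.
      rewrite Rabs_Ropp in T5, T6.
      rewrite Rabs_mult, (Rabs_pos_eq r) in T1, T2, T5, T6 by lra.
      unfold c in *. clear H1 H2. split; nra. }
    assert (Bu : forall a b, Rabs (a - x1) + Rabs (b - y1) <= 2 * m -> Rabs (u a b) <= e * (3 * r)).
    { intros a b Hab. apply Hfar in Hab. eapply Rle_trans; [apply H1; lra|].
      apply Rmult_le_compat_l; lra. }
    assert (Bv : forall a b, Rabs (a - x1) + Rabs (b - y1) <= 2 * m -> Rabs (v a b) <= e * (3 * r)).
    { intros a b Hab. apply Hfar in Hab. eapply Rle_trans; [apply H2; lra|].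
      apply Rmult_le_compat_l; lra. }
    assert (Hp : Rabs p <= m) by (unfold m; pose proof (Rabs_pos q); lra).
    assert (Hq : Rabs q <= m) by (unfold m; pose proof (Rabs_pos p); lra).
    assert (Z : forall s, Rabs (s - s) = 0) by (intros; rewrite Rminus_diag; apply Rabs_R0).
    assert (Inc : forall F P Q : R -> R -> R,
       (forall x y, is_derive (fun s => F s y) x (P x y)) ->
       (forall x y, is_derive (fun s => F x s) y (Q x y)) ->
       (forall a b, Rabs (a - x1) + Rabs (b - y1) <= 2 * m -> Rabs (P a b) <= e * (3 * r)) ->
       (forall a b, Rabs (a - x1) + Rabs (b - y1) <= 2 * m -> Rabs (Q a b) <= e * (3 * r)) ->
       Rabs (F (x1 + p) (y1 + q) - F x1 y1) <= m * (e * (3 * r))).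
    { intros F P Q DP DQ BP BQ.
      pose proof (increment_bound (fun s => F s (y1 + q)) (fun s => P s (y1 + q)) x1 p (e * (3 * r))) as I1.
      pose proof (increment_bound (fun s => F x1 s) (fun s => Q x1 s) y1 q (e * (3 * r))) as I2.
      replace (F (x1 + p) (y1 + q) - F x1 y1) with
        ((F (x1 + p) (y1 + q) - F x1 (y1 + q)) + (F x1 (y1 + q) - F x1 y1)) by ring.
      eapply Rle_trans; [apply Rabs_triang|].
      unfold m at 1. rewrite Rmult_plus_distr_r. apply Rplus_le_compat.
      - apply I1; [auto|]. intros s Hs. apply BP. replace (y1 + q - y1) with q by ring. lra.
      - apply I2; [auto|]. intros s Hs. apply BQ. rewrite Z. lra. }
    split.
    * apply (Inc U u (fun x y => - v x y)); auto; try (intros; apply HCR).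
      intros a b Hab. rewrite Rabs_Ropp. auto.
    * apply (Inc V v u); auto; intros; apply HCR.
- replace (2 * (m * (e * (3 * r))) / r) with (6 * m * e) by (field; lra).
  unfold e. apply Rmult_le_reg_r with (12 * (m + 1)); [lra|].
  replace (6 * m * (eps / (12 * (m + 1))) * (12 * (m + 1))) with (6 * m * eps) by (field; lra).
  nra.
Qed.

Lemma differentiable_opp (f : R -> R -> R) (x y lx ly : R) :
  differentiable_pt_lim f x y lx ly ->
  differentiable_pt_lim (fun x y => - f x y) x y (- lx) (- ly).
Proof.
intros H eps. destruct (H eps) as [d Hd]. exists d. intros a b Ha Hb.
rewrite <- Rabs_Ropp. eapply Rle_trans; [|apply Hd; eauto].
right. f_equal. ring.
Qed.

Lemma cauchy_riemann_liouville (u v : R -> R -> R) :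
  (forall x y, exists a b, differentiable_pt_lim u x y a (- b) /\ differentiable_pt_lim v x y b a) ->
  sublinear u -> sublinear v ->
  forall x y, u x y = u 0 0 /\ v x y = v 0 0.
Proof.
intros HD Gu Gv.
assert (Cu : forall x y, continuity_2d_pt u x y).
{ intros x y. destruct (HD x y) as (a & b & H & _). eapply differentiable_continuity; eauto. }
assert (Cv : forall x y, continuity_2d_pt v x y).
{ intros x y. destruct (HD x y) as (a & b & _ & H). eapply differentiable_continuity; eauto. }
destruct (closed_form_primitive u (fun x y => - v x y)) as [U HU].
{ intros x y. destruct (HD x y) as (a & b & H1 & H2). exists a, (- b), (- a). split; auto.
  now apply differentiable_opp. }
destruct (closed_form_primitive v u) as [V HV].
{ intros x y. destruct (HD x y) as (a & b & H1 & H2). exists b, a, (- b). auto. }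
assert (HCR : cauchy_riemann_primitive u v U V) by (intros x y; split; auto).
(* Multiplication by -i exchanges the two parts: V - iU is a primitive of v - iu, so the result for
   the real part also yields [v]. *)
assert (HCR' : cauchy_riemann_primitive v (fun x y => - u x y) V (fun x y => - U x y)).
{ intros x y. destruct (HCR x y) as ((A & B) & (C' & D)). split; split; auto.
  - rewrite Ropp_involutive. auto.
  - apply (is_derive_opp (V := R_NormedModule) (fun s => U s y)). auto.
  - replace (v x y) with (- - v x y) by ring.
    apply (is_derive_opp (V := R_NormedModule) (fun s => U x s)). auto. }
intros x y. split.
- pose proof (primitive_liouville u v U V Cu Cv HCR Gu Gv 0 0 x y) as E.
  now rewrite !Rplus_0_l in E.
- assert (Gu' : sublinear (fun x y => - u x y)).
  { intros e He. destruct (Gu e He) as [R0 H0]. exists R0. intros. rewrite Rabs_Ropp. auto. }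
  assert (Cu' : forall x y, continuity_2d_pt (fun x y => - u x y) x y).
  { intros. now apply continuity_2d_pt_opp. }
  pose proof (primitive_liouville v _ V _ Cv Cu' HCR' Gv Gu' 0 0 x y) as E.
  now rewrite !Rplus_0_l in E.
Qed.

Definition complex_differentiable (f : C -> C) : Prop :=
  forall z, exists l : C, forall eps, 0 < eps -> exists d, 0 < d /\
    forall w, Cmod (w - z) < d -> Cmod (f w - f z - l * (w - z)) <= eps * Cmod (w - z).

(** Growth o(|z|) is the form required on a fibre, where a function of order below 2 is only shown
    to be O(|l|^(1/2)). *)
Lemma liouville (f : C -> C) :
  complex_differentiable f ->
  (forall eps, 0 < eps -> exists R0, forall z, R0 <= Cmod z -> Cmod (f z) <= eps * Cmod z) ->
  forall z w, f z = f w.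
Proof.
intros HD HG.
set (u x y := Re (f (x, y))). set (v x y := Im (f (x, y))).
assert (Cl1 : forall x y, Cmod (x, y) <= Rabs x + Rabs y).
{ intros x y. apply Rsqr_incr_0_var.
  - unfold Cmod. rewrite Rsqr_sqrt by (simpl; nra). unfold Rsqr. simpl.
    pose proof (Rsqr_abs x). pose proof (Rsqr_abs y). unfold Rsqr in *.
    pose proof (Rabs_pos x). pose proof (Rabs_pos y). nra.
  - pose proof (Rabs_pos x). pose proof (Rabs_pos y). lra. }
assert (Re_le : forall c, Rabs (Re c) <= Cmod c).
{ intros c. pose proof (Rmax_Cmod c). pose proof (Rmax_l (Rabs (fst c)) (Rabs (snd c))). unfold Re. lra. }
assert (Im_le : forall c, Rabs (Im c) <= Cmod c).
{ intros c. pose proof (Rmax_Cmod c). pose proof (Rmax_r (Rabs (fst c)) (Rabs (snd c))). unfold Im. lra. }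
assert (H0 : forall x y, u x y = u 0 0 /\ v x y = v 0 0).
{ apply cauchy_riemann_liouville.
  - intros x y. destruct (HD (x, y)) as [l Hl]. exists (Re l), (Im l).
    assert (K : forall eps : posreal, exists d : posreal, forall a b,
      Rabs (a - x) < d -> Rabs (b - y) < d ->
      Cmod (f (a, b) - f (x, y) - l * ((a, b) - (x, y))) <= eps * Rmax (Rabs (a - x)) (Rabs (b - y))).
    { intros eps. assert (He : 0 < eps / 2) by (pose proof (cond_pos eps); lra).
      destruct (Hl _ He) as (d & Hd & H). assert (Hd2 : 0 < d / 2) by lra.
      exists (mkposreal _ Hd2). simpl. intros a b Ha Hb.
      assert (E : Cmod ((a, b) - (x, y)) <= Rabs (a - x) + Rabs (b - y)) by apply (Cl1 (a - x) (b - y)).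
      eapply Rle_trans; [apply H; lra|].
      pose proof (Rmax_l (Rabs (a - x)) (Rabs (b - y))).
      pose proof (Rmax_r (Rabs (a - x)) (Rabs (b - y))).
      replace (eps * Rmax (Rabs (a - x)) (Rabs (b - y))) with
        (eps / 2 * (2 * Rmax (Rabs (a - x)) (Rabs (b - y)))) by field.
      apply Rmult_le_compat_l; lra. }
    split; intros eps; destruct (K eps) as [d Hd]; exists d; intros a b Ha Hb;
      (eapply Rle_trans; [|apply (Hd a b Ha Hb)]).
    + eapply Rle_trans; [|apply Re_le]. right. f_equal. unfold u, Re, Im. simpl. ring.
    + eapply Rle_trans; [|apply Im_le]. right. f_equal. unfold v, Re, Im. simpl. ring.
  - intros e He. destruct (HG e He) as [R0 HR]. exists (2 * Rmax R0 0). intros x y Hxy.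
    eapply Rle_trans; [apply Re_le|]. eapply Rle_trans; [apply HR|].
    + pose proof (Re_le (x, y)). pose proof (Im_le (x, y)). simpl in *. pose proof (Rmax_l R0 0). lra.
    + apply Rmult_le_compat_l; [lra|apply Cl1].
  - intros e He. destruct (HG e He) as [R0 HR]. exists (2 * Rmax R0 0). intros x y Hxy.
    eapply Rle_trans; [apply Im_le|]. eapply Rle_trans; [apply HR|].
    + pose proof (Re_le (x, y)). pose proof (Im_le (x, y)). simpl in *. pose proof (Rmax_l R0 0). lra.
    + apply Rmult_le_compat_l; [lra|apply Cl1]. }
intros [x y] [x' y'].
destruct (H0 x y) as [A B], (H0 x' y') as [C' D]. unfold u, v, Re, Im in *.
apply injective_projections; congruence.
Qed.

(** * Symbolic calculus for functions of the norm *)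

(** [EFun n] denotes the n-th derivative of u evaluated at t = |v|_h^2. *)
Inductive jet : Type :=
| ECst (r : R)
| ERe (a : idx)
| EIm (a : idx)
| EAdd (E F : jet)
| EMul (E F : jet)
| EFun (n : nat).

Fixpoint ev (k : R) (u : R -> R) (E : jet) (w : C3) : R :=
  match E with
  | ECst r => r
  | ERe a => Re (coord w a)
  | EIm a => Im (coord w a)
  | EAdd E F => ev k u E w + ev k u F w
  | EMul E F => ev k u E w * ev k u F w
  | EFun n => Derive_n u n (fiber_norm2 k w)
  end.

(** [dT] is the chain-rule factor, the derivative of |v|_h^2 along [e]. It is a parameter because it
    is itself obtained by applying this function to the polynomial [enorm]. *)
Fixpoint ederiv_with (dT : jet) (e : C3) (E : jet) : jet :=
  match E with
  | ECst _ => ECst 0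
  | ERe a => ECst (Re (coord e a))
  | EIm a => ECst (Im (coord e a))
  | EAdd E F => EAdd (ederiv_with dT e E) (ederiv_with dT e F)
  | EMul E F => EAdd (EMul (ederiv_with dT e E) F) (EMul E (ederiv_with dT e F))
  | EFun n => EMul (EFun (S n)) dT
  end.

Definition enorm (k : R) : jet :=
  let p := EAdd (ERe Iv1) (EMul (ECst (-1)) (EMul (EIm Iz) (ERe Iv2))) in
  let q := EAdd (EIm Iv1) (EMul (ECst (-1)) (EMul (EIm Iz) (EIm Iv2))) in
  EAdd (EAdd (EMul p p) (EMul q q))
    (EMul (ECst k) (EAdd (EMul (ERe Iv2) (ERe Iv2)) (EMul (EIm Iv2) (EIm Iv2)))).

(** [enorm] contains no [EFun], so the placeholder [ECst 0] is never used. *)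
Definition ederiv (k : R) (e : C3) (E : jet) : jet :=
  ederiv_with (ederiv_with (ECst 0) e (enorm k)) e E.

Lemma Cmod_sqr (z : C) : Cmod z ^ 2 = Re z ^ 2 + Im z ^ 2.
Proof.
unfold Cmod. rewrite pow2_sqrt; [reflexivity|].
pose proof (pow2_ge_0 (fst z)). pose proof (pow2_ge_0 (snd z)). lra.
Qed.

Lemma fiber_norm2_coords (k : R) (w : C3) :
  fiber_norm2 k w =
  (Re (coord w Iv1) - Im (coord w Iz) * Re (coord w Iv2)) ^ 2 +
  (Im (coord w Iv1) - Im (coord w Iz) * Im (coord w Iv2)) ^ 2 +
  k * (Re (coord w Iv2) ^ 2 + Im (coord w Iv2) ^ 2).
Proof.
destruct w as [[[x y] [a b]] [c d]]. unfold fiber_norm2. rewrite !Cmod_sqr.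
unfold Re, Im; simpl. ring.
Qed.

Lemma fiber_norm2_enorm (k : R) (u : R -> R) (w : C3) :
  fiber_norm2 k w = ev k u (enorm k) w.
Proof. rewrite fiber_norm2_coords. simpl. ring. Qed.

Lemma fiber_norm2_nonneg (k : R) (w : C3) : 0 < k -> 0 <= fiber_norm2 k w.
Proof.
intros Hk. rewrite fiber_norm2_coords.
apply Rplus_le_le_0_compat; [apply Rplus_le_le_0_compat; apply pow2_ge_0|].
apply Rmult_le_pos; [lra|]. apply Rplus_le_le_0_compat; apply pow2_ge_0.
Qed.

Lemma move_0 (w e : C3) : move w 0 e = w.
Proof.
destruct w as [[[x y] [a b]] [c d]], e as [[[x' y'] [a' b']] [c' d']]. simpl.
repeat (apply injective_projections; simpl); ring.
Qed.

Lemma coord_move (w e : C3) (s : R) (a : idx) :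
  coord (move w s e) a = (coord w a + s * coord e a)%C.
Proof. destruct w as [[? ?] ?], e as [[? ?] ?], a; reflexivity. Qed.

Lemma Derive_n_is_derive (u : R -> R) (eps : R) (n : nat) (t : R) :
  (forall (n : nat) (t : R), - eps < t -> ex_derive_n u n t) ->
  - eps < t -> is_derive (Derive_n u n) t (Derive_n u (S n) t).
Proof. intros Hu Ht. apply (Derive_correct (Derive_n u n)), (Hu (S n) t Ht). Qed.

Lemma is_derive_ederiv_with (k : R) (u : R -> R) (w e : C3) (dT E : jet) :
  (forall n, is_derive (fun s => Derive_n u n (fiber_norm2 k (move w s e))) 0
     (Derive_n u (S n) (fiber_norm2 k w) * ev k u dT w)) ->
  is_derive (fun s => ev k u E (move w s e)) 0 (ev k u (ederiv_with dT e E) w).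
Proof.
intros HF.
assert (L : forall p q : R, is_derive (fun s => p + s * q) 0 q) by (intros; auto_derive; auto; ring).
induction E as [r|a|a|E IHE F IHF|E IHE F IHF|n]; simpl.
- apply (is_derive_const (K := R_AbsRing) (V := R_NormedModule) r).
- apply is_derive_ext with (fun s => Re (coord w a) + s * Re (coord e a)).
  + intros s. rewrite coord_move. unfold Re, Im. simpl. ring.
  + apply L.
- apply is_derive_ext with (fun s => Im (coord w a) + s * Im (coord e a)).
  + intros s. rewrite coord_move. unfold Re, Im. simpl. ring.
  + apply L.
- apply (is_derive_plus (V := R_NormedModule) (fun s => ev k u E (move w s e))); auto.
- evar_last.
  + apply (is_derive_mult (fun s => ev k u E (move w s e)) (fun s => ev k u F (move w s e)));
      [exact IHE|exact IHF|intros; apply Rmult_comm].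
  + unfold plus, mult; simpl. now rewrite !move_0.
- apply HF.
Qed.

Lemma is_derive_ederiv (k : R) (u : R -> R) (w e : C3) (E : jet) :
  0 < k -> smooth_half_line u ->
  is_derive (fun s => ev k u E (move w s e)) 0 (ev k u (ederiv k e E) w).
Proof.
intros Hk (eps & Heps & Hu). apply is_derive_ederiv_with.
intros n. rewrite Rmult_comm.
apply (is_derive_comp (V := R_NormedModule) (Derive_n u n) (fun s => fiber_norm2 k (move w s e))).
- rewrite move_0. apply (Derive_n_is_derive u eps); auto.
  pose proof (fiber_norm2_nonneg k w Hk). lra.
- apply is_derive_ext with (fun s => ev k u (enorm k) (move w s e)).
  + intros s. symmetry. apply fiber_norm2_enorm.
  (* The value of [enorm] does not depend on [u]; with [u = 0] the chain-rule hypothesis is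
     trivial. *)
  + pose proof (is_derive_ederiv_with k (fun _ => 0) w e (ECst 0) (enorm k)) as H.
    apply H. intros m. apply is_derive_ext with (fun _ => 0).
    * intros s. symmetry. destruct m; [reflexivity|]. apply Derive_n_const.
    * rewrite Rmult_0_r. apply (is_derive_const (K := R_AbsRing) (V := R_NormedModule) 0).
Qed.

(** Symmetry of second derivatives is here a polynomial identity between expressions, valid for any
    [u]. *)
Lemma ederiv_comm (k : R) (u : R -> R) (e f : C3) (E : jet) (w : C3) :
  ev k u (ederiv k e (ederiv k f E)) w = ev k u (ederiv k f (ederiv k e E)) w.
Proof.
unfold ederiv. induction E as [r|a|a|E IHE F IHF|E IHE F IHF|n]; cbn [ev ederiv_with]; auto.
- now rewrite IHE, IHF.
- rewrite IHE, IHF. ring.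
- unfold Re, Im. simpl. ring.
Qed.

Lemma continuous_Re_coord (a : idx) (w : C3) :
  continuous (fun w : C * C * C => Re (coord w a)) w.
Proof.
destruct a; simpl; unfold Re.
- apply (continuous_comp (fun w : C * C * C => fst (fst w)) fst); [|apply continuous_fst].
  apply (continuous_comp (fun w : C * C * C => fst w) fst); apply continuous_fst.
- apply (continuous_comp (fun w : C * C * C => snd (fst w)) fst); [|apply continuous_fst].
  apply (continuous_comp (fun w : C * C * C => fst w) snd); [apply continuous_fst|apply continuous_snd].
- apply (continuous_comp (fun w : C * C * C => snd w) fst); [apply continuous_snd|apply continuous_fst].
Qed.

Lemma continuous_Im_coord (a : idx) (w : C3) :
  continuous (fun w : C * C * C => Im (coord w a)) w.
Proof.
destruct a; simpl; unfold Im.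
- apply (continuous_comp (fun w : C * C * C => fst (fst w)) snd); [|apply continuous_snd].
  apply (continuous_comp (fun w : C * C * C => fst w) fst); apply continuous_fst.
- apply (continuous_comp (fun w : C * C * C => snd (fst w)) snd); [|apply continuous_snd].
  apply (continuous_comp (fun w : C * C * C => fst w) snd); [apply continuous_fst|apply continuous_snd].
- apply (continuous_comp (fun w : C * C * C => snd w) snd); [apply continuous_snd|apply continuous_snd].
Qed.

Lemma continuous_ev (k : R) (u : R -> R) (E : jet) (w : C3) :
  0 < k -> smooth_half_line u -> continuous (ev k u E : C * C * C -> R) w.
Proof.
intros Hk (eps & Heps & Hu).
assert (Hgen : forall u, (forall n, continuous (fun w : C * C * C => Derive_n u n (fiber_norm2 k w)) w) ->
   forall E, continuous (ev k u E : C * C * C -> R) w).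
{ clear. intros u HF. induction E as [r|a|a|E IHE F IHF|E IHE F IHF|n]; simpl.
  - apply continuous_const.
  - apply continuous_Re_coord.
  - apply continuous_Im_coord.
  - now apply (continuous_plus (V := R_NormedModule)).
  - now apply (continuous_mult (K := R_AbsRing)).
  - apply HF. }
apply Hgen. intros n.
apply (continuous_comp (fun w : C * C * C => fiber_norm2 k w) (Derive_n u n)).
- apply continuous_ext with (ev k (fun _ => 0) (enorm k)).
  + intros w'. symmetry. apply fiber_norm2_enorm.
  + apply Hgen. intros m. apply continuous_ext with (fun _ => 0).
    * intros w'. symmetry. destruct m; [reflexivity|]. apply Derive_n_const.
    * apply continuous_const.
- apply (ex_derive_continuous (V := R_NormedModule)).
  eexists. apply (Derive_n_is_derive u eps); auto.
  pose proof (fiber_norm2_nonneg k w Hk). lra.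
Qed.

Definition cev (k : R) (u : R -> R) (E : jet * jet) (w : C3) : C :=
  (ev k u (fst E) w, ev k u (snd E) w).

Lemma dir_deriv_cev (k : R) (u : R -> R) (e : C3) (E : jet * jet) :
  0 < k -> smooth_half_line u ->
  dir_deriv e (cev k u E) = cev k u (ederiv k e (fst E), ederiv k e (snd E)).
Proof.
intros Hk Hu. apply functional_extensionality. intros w.
apply injective_projections; simpl; apply is_derive_unique; now apply is_derive_ederiv.
Qed.

(** Every iterated derivative of a [cev] is again a [cev], so continuity and differentiability need
    to be known for this class only. *)
Lemma smooth3_cev (k : R) (u : R -> R) (E : jet * jet) :
  0 < k -> smooth_half_line u -> smooth3 (cev k u E).
Proof.
intros Hk Hu l w.
assert (exists E', iter_deriv l (cev k u E) = cev k u E') as [E' ->].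
{ induction l as [|e l [E' IH]]; [now exists E|].
  change (iter_deriv (e :: l) (cev k u E)) with (dir_deriv e (iter_deriv l (cev k u E))).
  rewrite IH, dir_deriv_cev by auto. eauto. }
split.
- assert (continuous (ev k u (fst E') : C * C * C -> R) w) as H1 by now apply continuous_ev.
  assert (continuous (ev k u (snd E') : C * C * C -> R) w) as H2 by now apply continuous_ev.
  apply filterlim_locally. intros eps.
  generalize (filter_and _ _ (proj1 (filterlim_locally _ _) H1 eps) (proj1 (filterlim_locally _ _) H2 eps)).
  apply filter_imp. intros w' [A B]. now split.
- intros e. split; eexists; now apply is_derive_ederiv.
Qed.

(** [sgn = -1] is the holomorphic Wirtinger derivative, [sgn = 1] the antiholomorphic one. *)
Definition ewirt (sgn k : R) (a : idx) (E : jet * jet) : jet * jet :=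
  let d1 := ederiv k (basis3 1 a) in
  let di := ederiv k (basis3 Ci a) in
  (EMul (ECst (/ 2)) (EAdd (d1 (fst E)) (EMul (ECst (- sgn)) (di (snd E)))),
   EMul (ECst (/ 2)) (EAdd (d1 (snd E)) (EMul (ECst sgn) (di (fst E))))).

Lemma dw_cev (k : R) (u : R -> R) (a : idx) (E : jet * jet) :
  0 < k -> smooth_half_line u -> dw a (cev k u E) = cev k u (ewirt (-1) k a E).
Proof.
intros Hk Hu. apply functional_extensionality. intros w.
unfold dw. rewrite !dir_deriv_cev by auto. unfold ewirt, cev.
apply injective_projections; simpl; field.
Qed.

Lemma dwbar_cev (k : R) (u : R -> R) (a : idx) (E : jet * jet) :
  0 < k -> smooth_half_line u -> dwbar a (cev k u E) = cev k u (ewirt 1 k a E).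
Proof.
intros Hk Hu. apply functional_extensionality. intros w.
unfold dwbar. rewrite !dir_deriv_cev by auto. unfold ewirt, cev.
apply injective_projections; simpl; field.
Qed.

Lemma ewirt_comm (k : R) (u : R -> R) (s s' : R) (a b : idx) (E : jet * jet) (w : C3) :
  cev k u (ewirt s k a (ewirt s' k b E)) w = cev k u (ewirt s' k b (ewirt s k a E)) w.
Proof.
assert (D : forall e c F G, ev k u (ederiv k e (EMul (ECst (/2)) (EAdd F (EMul (ECst c) G)))) w =
   / 2 * (ev k u (ederiv k e F) w + c * ev k u (ederiv k e G) w)).
{ intros. unfold ederiv. simpl. ring. }
unfold ewirt, cev. cbn [fst snd ev].
rewrite !D.
rewrite !(ederiv_comm k u (basis3 1 b) (basis3 1 a)), !(ederiv_comm k u (basis3 1 b) (basis3 Ci a)),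
  !(ederiv_comm k u (basis3 Ci b) (basis3 1 a)), !(ederiv_comm k u (basis3 Ci b) (basis3 Ci a)).
apply injective_projections; cbn [fst snd]; ring.
Qed.

(** * The Hermitian form of a metric of the Calabi type and its positivity *)

Definition calabi_metric (k : R) (u : R -> R) : metric :=
  fun w a b =>
    (base_form a b + dw a (dwbar b (fun w' => RtoC (u (fiber_norm2 k w')))) w)%C.

Definition calabi_expr (k : R) (a b : idx) : jet * jet :=
  let W := ewirt (-1) k a (ewirt 1 k b (EFun 0, ECst 0)) in
  (EAdd (ECst (Re (base_form a b))) (fst W), EAdd (ECst (Im (base_form a b))) (snd W)).

Lemma potential_cev (k : R) (u : R -> R) :
  (fun w => RtoC (u (fiber_norm2 k w))) = cev k u (EFun 0, ECst 0).
Proof. reflexivity. Qed.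

Lemma calabi_metric_cev (k : R) (u : R -> R) (a b : idx) :
  0 < k -> smooth_half_line u ->
  (fun w => calabi_metric k u w a b) = cev k u (calabi_expr k a b).
Proof.
intros Hk Hu. apply functional_extensionality. intros w. unfold calabi_metric.
rewrite potential_cev, dwbar_cev, dw_cev by auto. reflexivity.
Qed.

(** The fibre coordinates of [w] that are unitary up to the factor [k]. *)
Definition fib1 (w : C3) : C := (coord w Iv1 - Im (coord w Iz) * coord w Iv2)%C.
Definition fib2 (w : C3) : C := coord w Iv2.

(** A coframe at [w], besides [dz], in which the complex Hessian of [|v|_h^2] is diagonal. *)
Definition vert1 (w xi : C3) : C :=
  (coord xi Iv1 - Im (coord w Iz) * coord xi Iv2 + Ci / 2 * fib2 w * coord xi Iz)%C.
Definition vert2 (k : R) (w xi : C3) : C :=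
  (coord xi Iv2 + Ci / (2 * k) * fib1 w * coord xi Iz)%C.

(** This is the (1,0)-part of the differential of t = |v|_h^2, evaluated on [xi]. *)
Definition radial (k : R) (w xi : C3) : C :=
  (Cconj (fib1 w) * vert1 w xi + k * Cconj (fib2 w) * vert2 k w xi)%C.

(** The Hessian of u(t) is u' times that of t plus u'' times the square of its (1,0)-differential.
    Completing squares in the Hessian of t leaves the coefficient (k |b|^2 - |a|^2) / (4 k) on dz,
    which is the curvature term. The nine entries are expanded symbolically. *)
Lemma hform_calabi (k : R) (u : R -> R) (w xi eta : C3) :
  0 < k -> smooth_half_line u ->
  let u1 := Derive_n u 1 (fiber_norm2 k w) in
  let u2 := Derive_n u 2 (fiber_norm2 k w) in
  hform (calabi_metric k u) w xi eta =
  ((1 + u1 * ((k * Cmod (fib2 w) ^ 2 - Cmod (fib1 w) ^ 2) / (4 * k)))%R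
     * coord xi Iz * Cconj (coord eta Iz)
   + u1 * (vert1 w xi * Cconj (vert1 w eta) + k * vert2 k w xi * Cconj (vert2 k w eta))
   + u2 * radial k w xi * Cconj (radial k w eta))%C.
Proof.
intros Hk Hu u1 u2. unfold hform, sum3.
assert (E : forall a b, calabi_metric k u w a b = cev k u (calabi_expr k a b) w).
{ intros a b. now rewrite <- calabi_metric_cev. }
rewrite !E. rewrite !Cmod_sqr. unfold calabi_expr, ewirt, cev, ederiv.
destruct w as [[[x y] [a b]] [c d]], xi as [[[x1 y1] [a1 b1]] [c1 d1]], eta as [[[x2 y2] [a2 b2]] [c2 d2]].
unfold radial, vert1, vert2, fib1, fib2, Re, Im.
cbn [ederiv_with enorm ev fst snd coord basis3 base_form Re Im].
change (Derive_n u 1 (fiber_norm2 k (x, y, (a, b), (c, d)))) with u1.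
change (Derive_n u 2 (fiber_norm2 k (x, y, (a, b), (c, d)))) with u2.
clearbody u1 u2. clear E.
apply injective_projections; simpl; field; lra.
Qed.

Definition horizontal_coef (k u1 : R) (w : C3) : R :=
  1 + u1 * ((k * Cmod (fib2 w) ^ 2 - Cmod (fib1 w) ^ 2) / (4 * k)).

Definition vert_norm2 (k : R) (w xi : C3) : R :=
  Cmod (vert1 w xi) ^ 2 + k * Cmod (vert2 k w xi) ^ 2.

Lemma fiber_norm2_fib (k : R) (w : C3) :
  fiber_norm2 k w = Cmod (fib1 w) ^ 2 + k * Cmod (fib2 w) ^ 2.
Proof. destruct w as [[[x y] [a b]] [c d]]. reflexivity. Qed.

Lemma Re_hform_calabi (k : R) (u : R -> R) (w xi : C3) :
  0 < k -> smooth_half_line u ->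
  Re (hform (calabi_metric k u) w xi xi) =
  horizontal_coef k (Derive_n u 1 (fiber_norm2 k w)) w * Cmod (coord xi Iz) ^ 2
  + (Derive_n u 1 (fiber_norm2 k w) * vert_norm2 k w xi
     + Derive_n u 2 (fiber_norm2 k w) * Cmod (radial k w xi) ^ 2).
Proof.
intros Hk Hu. rewrite hform_calabi by auto. cbv zeta.
unfold horizontal_coef, vert_norm2.
set (h := 1 + _ * (_ / _)). clearbody h.
generalize (Derive_n u 1 (fiber_norm2 k w)) (Derive_n u 2 (fiber_norm2 k w)).
generalize (vert1 w xi) (vert2 k w xi) (radial k w xi) (coord xi Iz).
intros [? ?] [? ?] [? ?] [? ?] ? ?. rewrite !Cmod_sqr. unfold Re, Im. simpl. ring.
Qed.

Lemma radial_cauchy_schwarz (k : R) (w xi : C3) :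
  0 < k -> Cmod (radial k w xi) ^ 2 <= fiber_norm2 k w * vert_norm2 k w xi.
Proof.
intros Hk. rewrite fiber_norm2_fib. unfold vert_norm2, radial.
generalize (vert1 w xi) (vert2 k w xi) (fib1 w) (fib2 w).
intros [p q] [r s] [a b] [c d]. rewrite !Cmod_sqr. unfold Re, Im. simpl.
apply Rminus_le_0.
(* Lagrange's identity: the defect is [k] times the squared modulus of
   [fib1 * vert2 - fib2 * vert1]. *)
match goal with |- 0 <= ?X => replace X with
  (k * ((a * r - b * s - c * p + d * q) ^ 2 + (a * s + b * r - c * q - d * p) ^ 2)) by ring end.
apply Rmult_le_pos; [lra|]. apply Rplus_le_le_0_compat; apply pow2_ge_0.
Qed.

Lemma vert_norm2_nonneg (k : R) (w xi : C3) : 0 < k -> 0 <= vert_norm2 k w xi.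
Proof.
intros Hk. apply Rplus_le_le_0_compat; [apply pow2_ge_0|].
apply Rmult_le_pos; [lra|apply pow2_ge_0].
Qed.

(** The gap is [u1 * (t * N - Rd)], a Cauchy-Schwarz defect: for a given radial part, the purely
    radial vector is the shortest. *)
Lemma fiber_form_ge (u1 u2 t N Rd : R) :
  0 <= t -> 0 <= Rd <= t * N -> 0 <= u1 -> (u1 + t * u2) * Rd <= t * (u1 * N + u2 * Rd).
Proof. intros. nra. Qed.

(** The three conditions are positivity at points with [fib2 w = 0], in turn for a fibre vector
    orthogonal to the radial one, for the radial vector, and for the horizontal vector, whose
    coefficient is 1 - t u' / (4 k). They characterise the Kähler metrics among the forms
    [calabi_metric k u]. *)
Definition admissible (k : R) (u : R -> R) : Prop :=
  forall t, 0 <= t ->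
    0 < Derive_n u 1 t /\ 0 < Derive_n u 1 t + t * Derive_n u 2 t /\
    t * Derive_n u 1 t < 4 * k.

Lemma horizontal_coef_pos (k u1 : R) (w : C3) :
  0 < k -> 0 <= u1 -> fiber_norm2 k w * u1 < 4 * k -> 0 < horizontal_coef k u1 w.
Proof.
intros Hk H1 H. rewrite fiber_norm2_fib in H. unfold horizontal_coef.
apply Rmult_lt_reg_r with (4 * k); [lra|]. rewrite Rmult_0_l.
replace ((1 + u1 * ((k * Cmod (fib2 w) ^ 2 - Cmod (fib1 w) ^ 2) / (4 * k))) * (4 * k))
  with (4 * k + u1 * (k * Cmod (fib2 w) ^ 2 - Cmod (fib1 w) ^ 2)) by (field; lra).
assert (0 <= u1 * (k * Cmod (fib2 w) ^ 2)).
{ apply Rmult_le_pos; auto. apply Rmult_le_pos; [lra|apply pow2_ge_0]. }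
nra.
Qed.

Lemma fiber_form_nonneg (k : R) (u : R -> R) (w xi : C3) :
  0 < k -> admissible k u ->
  0 <= Derive_n u 1 (fiber_norm2 k w) * vert_norm2 k w xi
     + Derive_n u 2 (fiber_norm2 k w) * Cmod (radial k w xi) ^ 2 /\
  (0 < vert_norm2 k w xi ->
   0 < Derive_n u 1 (fiber_norm2 k w) * vert_norm2 k w xi
     + Derive_n u 2 (fiber_norm2 k w) * Cmod (radial k w xi) ^ 2).
Proof.
intros Hk Hadm.
pose proof (fiber_norm2_nonneg k w Hk) as Ht. pose proof (radial_cauchy_schwarz k w xi Hk) as HR.
pose proof (vert_norm2_nonneg k w xi Hk) as HN.
pose proof (pow2_ge_0 (Cmod (radial k w xi))) as HR0.
destruct (Hadm _ Ht) as (H1 & H2 & _).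
set (t := fiber_norm2 k w) in *. set (N := vert_norm2 k w xi) in *.
set (Rd := Cmod (radial k w xi) ^ 2) in *. clearbody t N Rd.
set (u1 := Derive_n u 1 t) in *. set (u2 := Derive_n u 2 t) in *. clearbody u1 u2.
assert (t = 0 \/ 0 < t) as [E|Hp] by lra.
- subst t. assert (Rd = 0) as -> by lra. rewrite Rmult_0_r, Rplus_0_r.
  split; [apply Rmult_le_pos; lra|]. intros; apply Rmult_lt_0_compat; lra.
(* For [t > 0] the form splits into a Cauchy-Schwarz defect weighted by u' and a radial part
   weighted by the derivative of the moment. At [t = 0] the radial part vanishes. *)
- assert (E : u1 * N + u2 * Rd = / t * (u1 * (t * N - Rd) + (u1 + t * u2) * Rd)) by (field; lra).
  rewrite E. pose proof (Rinv_0_lt_compat t Hp).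
  split.
  + apply Rmult_le_pos; [lra|]. apply Rplus_le_le_0_compat; apply Rmult_le_pos; lra.
  + intros HN'. apply Rmult_lt_0_compat; auto.
    assert (0 < t * N) by now apply Rmult_lt_0_compat.
    assert (Rd = 0 \/ 0 < Rd) as [->|HR'] by lra.
    * nra.
    * apply Rplus_le_lt_0_compat; [apply Rmult_le_pos|apply Rmult_lt_0_compat]; lra.
Qed.

Lemma Cmod_sqr_pos (z : C) : z <> RtoC 0 -> 0 < Cmod z ^ 2.
Proof. intros Hz. apply pow_lt, Cmod_gt_0, Hz. Qed.

Lemma calabi_metric_positive (k : R) (u : R -> R) (w xi : C3) :
  0 < k -> smooth_half_line u -> admissible k u ->
  xi <> (RtoC 0, RtoC 0, RtoC 0) -> 0 < Re (hform (calabi_metric k u) w xi xi).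
Proof.
intros Hk Hu Hadm Hxi. rewrite Re_hform_calabi by auto.
destruct (fiber_form_nonneg k u w xi Hk Hadm) as [F1 F2].
destruct (Hadm _ (fiber_norm2_nonneg k w Hk)) as (H1 & _ & H3).
pose proof (horizontal_coef_pos k _ w Hk (Rlt_le _ _ H1) H3) as Hh.
pose proof (pow2_ge_0 (Cmod (coord xi Iz))) as Hz.
pose proof (Rmult_le_pos _ _ (Rlt_le _ _ Hh) Hz).
destruct (excluded_middle_informative (coord xi Iz = RtoC 0)) as [Ez|Ez].
- assert (0 < vert_norm2 k w xi); [|specialize (F2 H0); lra].
  destruct (Rle_lt_or_eq_dec _ _ (vert_norm2_nonneg k w xi Hk)) as [|E0]; auto.
  exfalso. apply Hxi.
  unfold vert_norm2 in E0.
  pose proof (pow2_ge_0 (Cmod (vert1 w xi))). pose proof (pow2_ge_0 (Cmod (vert2 k w xi))).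
  assert (V2 : vert2 k w xi = RtoC 0).
  { destruct (excluded_middle_informative (vert2 k w xi = RtoC 0)) as [|N]; auto.
    apply Cmod_sqr_pos in N. exfalso. nra. }
  assert (V1 : vert1 w xi = RtoC 0).
  { destruct (excluded_middle_informative (vert1 w xi = RtoC 0)) as [|N]; auto.
    apply Cmod_sqr_pos in N. exfalso. nra. }
  unfold vert2 in V2. rewrite Ez in V2.
  assert (X2 : coord xi Iv2 = RtoC 0) by (rewrite <- V2; ring).
  unfold vert1 in V1. rewrite Ez, X2 in V1.
  assert (X1 : coord xi Iv1 = RtoC 0) by (rewrite <- V1; ring).
  destruct xi as [[xz x1] x2]. simpl in *. congruence.
- pose proof (Rmult_lt_0_compat _ _ Hh (Cmod_sqr_pos _ Ez)). lra.
Qed.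

Lemma metric_entry_hform (g : metric) (w : C3) (a b : idx) :
  g w a b = hform g w (basis3 1 a) (basis3 1 b).
Proof.
unfold hform, sum3. generalize (g w).  intros m.
destruct a, b; apply injective_projections; simpl; ring.
Qed.

(** The form depends on its arguments only through fibre coordinates and a coframe that both deck
    transformations preserve; descent to [X] is then a check on these. *)
Lemma hform_calabi_invariant (k : R) (u : R -> R) (w w' xi xi' eta eta' : C3) :
  0 < k -> smooth_half_line u ->
  fib1 w = fib1 w' -> fib2 w = fib2 w' ->
  coord xi Iz = coord xi' Iz -> coord eta Iz = coord eta' Iz ->
  vert1 w xi = vert1 w' xi' -> vert1 w eta = vert1 w' eta' ->
  vert2 k w xi = vert2 k w' xi' -> vert2 k w eta = vert2 k w' eta' ->
  hform (calabi_metric k u) w xi eta = hform (calabi_metric k u) w' xi' eta'.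
Proof.
intros Hk Hu E1 E2 E3 E4 E5 E6 E7 E8.
rewrite !hform_calabi by auto. cbv zeta. unfold radial.
rewrite !fiber_norm2_fib, E1, E2, E3, E4, E5, E6, E7, E8. reflexivity.
Qed.

Lemma calabi_metric_kahler (k : R) (u : R -> R) :
  0 < k -> smooth_half_line u -> admissible k u -> kahler (calabi_metric k u).
Proof.
intros Hk Hu Hadm. constructor.
- split; intros w xi eta; apply hform_calabi_invariant; auto;
    destruct w as [[[x y] [a b]] [c d]], xi as [[[x1 y1] [a1 b1]] [c1 d1]],
      eta as [[[x2 y2] [a2 b2]] [c2 d2]];
    unfold vert1, vert2, fib1, fib2, Re, Im; simpl; try reflexivity;
    apply injective_projections; simpl; field; lra.
- intros a b. rewrite (calabi_metric_cev k u a b Hk Hu). now apply smooth3_cev.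
- intros w a b. rewrite (metric_entry_hform (calabi_metric k u) w b a), (metric_entry_hform (calabi_metric k u) w a b).
  rewrite !hform_calabi by auto. cbv zeta.
  generalize (radial k w (basis3 1 a)) (radial k w (basis3 1 b)) (vert1 w (basis3 1 a))
    (vert1 w (basis3 1 b)) (vert2 k w (basis3 1 a)) (vert2 k w (basis3 1 b))
    (coord (basis3 1 a) Iz) (coord (basis3 1 b) Iz).
  generalize (Derive_n u 1 (fiber_norm2 k w)) (Derive_n u 2 (fiber_norm2 k w)).
  intros u1 u2. set (h := 1 + _ * (_ / _)). clearbody h.
  intros [? ?] [? ?] [? ?] [? ?] [? ?] [? ?] [? ?] [? ?].
  apply injective_projections; simpl; ring.
- intros w xi Hxi. now apply calabi_metric_positive.
(* The constant [base_form] is killed by a derivative, so closedness concerns third derivatives of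
   the potential alone. *)
- assert (D : forall (s : R) a b c w, cev k u (ewirt s k c (calabi_expr k a b)) w =
     cev k u (ewirt s k c (ewirt (-1) k a (ewirt 1 k b (EFun 0, ECst 0)))) w).
  { intros s a b c w. unfold calabi_expr.
    generalize (ewirt (-1) k a (ewirt 1 k b (EFun 0, ECst 0))). intros [P Q].
    unfold ewirt, cev, ederiv. simpl. f_equal; ring. }
  split; intros a b c w.
  + rewrite !(calabi_metric_cev k u _ _ Hk Hu), !dw_cev, !D by auto. apply ewirt_comm.
  + rewrite !(calabi_metric_cev k u _ _ Hk Hu), !dwbar_cev, !D by auto.
    assert (Cg : forall E E', (forall w, cev k u E w = cev k u E' w) -> forall a w,
      cev k u (ewirt (-1) k a E) w = cev k u (ewirt (-1) k a E') w).
    { intros E E' HE a' w'. rewrite <- !(dw_cev k u) by auto. f_equal.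
      apply functional_extensionality. auto. }
    (* The holomorphic derivative is moved outermost; the two antiholomorphic ones are then
       exchanged beneath it by [Cg]. *)
    rewrite (ewirt_comm k u 1 (-1) c a), (ewirt_comm k u 1 (-1) b a).
    apply Cg. intros w'. apply ewirt_comm.
Qed.

(** * Lengths and distances *)

Lemma proj_surjective (x : X) : exists w, x = proj w.
Proof. destruct x as [A [w HA]]. subst A. now exists w. Qed.

Lemma proj_eq_orbit (w w' : C3) : proj w = proj w' -> same_orbit w w'.
Proof.
intros H. apply (f_equal (@proj1_sig _ _)) in H. simpl in H.
rewrite H. apply rst_refl.
Qed.

Lemma orbit_proj_eq (w w' : C3) : same_orbit w w' -> proj w = proj w'.
Proof.
intros H. apply subset_eq_compat. apply functional_extensionality. intros v.
apply propositional_extensionality. split; intros Hv.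
- apply rst_trans with w; auto. now apply rst_sym.
- now apply rst_trans with w'.
Qed.

Lemma proj_deck1 (w : C3) : proj (deck1 w) = proj w.
Proof. symmetry. apply orbit_proj_eq, rst_step. now left. Qed.

Lemma proj_deck2 (w : C3) : proj (deck2 w) = proj w.
Proof. symmetry. apply orbit_proj_eq, rst_step. now right. Qed.

Lemma orbit_invariant {T : Type} (F : C3 -> T) :
  (forall w, F (deck1 w) = F w) -> (forall w, F (deck2 w) = F w) ->
  forall w w', proj w = proj w' -> F w = F w'.
Proof.
intros H1 H2 w w' H. apply proj_eq_orbit in H.
induction H as [w w' [->| ->]|w|w w' _ IH|w w' w'' _ IH1 _ IH2]; congruence.
Qed.

Definition disp (w w' : C3) : C3 :=
  ((coord w' Iz - coord w Iz)%C, (coord w' Iv1 - coord w Iv1)%C, (coord w' Iv2 - coord w Iv2)%C).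

Definition segment (w w' : C3) (s : R) : C3 := move w s (disp w w').

Lemma segment_0 (w w' : C3) : segment w w' 0 = w.
Proof. apply move_0. Qed.

Lemma segment_1 (w w' : C3) : segment w w' 1 = w'.
Proof.
destruct w as [[[x y] [a b]] [c d]], w' as [[[x' y'] [a' b']] [c' d']]. unfold segment, disp; simpl.
repeat (apply injective_projections; simpl); ring.
Qed.

Lemma curve_of_derivatives (c : R -> C3) (dc : R -> C3) :
  (forall a s, is_derive (fun r => Re (coord (c r) a)) s (Re (coord (dc s) a))) ->
  (forall a s, is_derive (fun r => Im (coord (c r) a)) s (Im (coord (dc s) a))) ->
  (forall a s, continuous (fun r => Re (coord (dc r) a)) s) ->
  (forall a s, continuous (fun r => Im (coord (dc r) a)) s) ->
  C1_curve c /\ forall s, velocity c s = dc s.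
Proof.
intros H1 H2 H3 H4. split.
- intros a s _. split; [eexists; apply H1|]. split; [eexists; apply H2|]. split.
  + apply continuous_ext with (fun r => Re (coord (dc r) a)); auto.
    intros r. symmetry. now apply is_derive_unique.
  + apply continuous_ext with (fun r => Im (coord (dc r) a)); auto.
    intros r. symmetry. now apply is_derive_unique.
- intros s. unfold velocity.
  rewrite !(is_derive_unique _ _ _ (H1 _ s)), !(is_derive_unique _ _ _ (H2 _ s)).
  destruct (dc s) as [[[x y] [a b]] [c' d]]. reflexivity.
Qed.

Lemma segment_curve (w w' : C3) :
  C1_curve (segment w w') /\ forall s, velocity (segment w w') s = disp w w'.
Proof.
assert (L : forall p q s : R, is_derive (fun s => p + s * q) s q) by (intros; auto_derive; auto; ring).
apply (curve_of_derivatives _ (fun _ => disp w w')).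
- intros a s. apply is_derive_ext with (fun r => Re (coord w a) + r * Re (coord (disp w w') a)).
  + intros r. unfold segment. rewrite coord_move. unfold Re, Im. simpl. ring.
  + apply L.
- intros a s. apply is_derive_ext with (fun r => Im (coord w a) + r * Im (coord (disp w w') a)).
  + intros r. unfold segment. rewrite coord_move. unfold Re, Im. simpl. ring.
  + apply L.
- intros. apply continuous_const.
- intros. apply continuous_const.
Qed.

Definition continuous_parts (f : R -> C) (s : R) : Prop :=
  continuous (fun r => Re (f r)) s /\ continuous (fun r => Im (f r)) s.

Lemma continuous_parts_plus (f h : R -> C) (s : R) :
  continuous_parts f s -> continuous_parts h s -> continuous_parts (fun r => f r + h r)%C s.
Proof.
intros [F1 F2] [H1 H2]. split.
- now apply (continuous_plus (V := R_NormedModule) (fun r => Re (f r)) (fun r => Re (h r))).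
- now apply (continuous_plus (V := R_NormedModule) (fun r => Im (f r)) (fun r => Im (h r))).
Qed.

Lemma continuous_parts_mult (f h : R -> C) (s : R) :
  continuous_parts f s -> continuous_parts h s -> continuous_parts (fun r => f r * h r)%C s.
Proof.
intros [F1 F2] [H1 H2]. split.
- apply (continuous_minus (V := R_NormedModule) (fun r => Re (f r) * Re (h r)) (fun r => Im (f r) * Im (h r))).
  + now apply (continuous_mult (K := R_AbsRing) (fun r => Re (f r)) (fun r => Re (h r))).
  + now apply (continuous_mult (K := R_AbsRing) (fun r => Im (f r)) (fun r => Im (h r))).
- apply (continuous_plus (V := R_NormedModule) (fun r => Re (f r) * Im (h r)) (fun r => Im (f r) * Re (h r))).
  + now apply (continuous_mult (K := R_AbsRing) (fun r => Re (f r)) (fun r => Im (h r))).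
  + now apply (continuous_mult (K := R_AbsRing) (fun r => Im (f r)) (fun r => Re (h r))).
Qed.

Lemma continuous_parts_conj (f : R -> C) (s : R) :
  continuous_parts f s -> continuous_parts (fun r => Cconj (f r)) s.
Proof.
intros [F1 F2]. split; auto.
now apply (continuous_opp (V := R_NormedModule) (fun r => Im (f r))).
Qed.

Lemma continuous_pair {U V : UniformSpace} (f : R -> U) (h : R -> V) (s : R) :
  continuous f s -> continuous h s -> continuous (fun r => (f r, h r)) s.
Proof.
intros Hf Hh. apply filterlim_locally. intros eps.
generalize (filter_and _ _ (proj1 (filterlim_locally _ _) Hf eps) (proj1 (filterlim_locally _ _) Hh eps)).
apply filter_imp. intros r [A B]. now split.
Qed.

Lemma continuous_curve (c : R -> C3) (s : R) :
  C1_curve c -> 0 <= s <= 1 -> continuous (c : R -> C * C * C) s.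
Proof.
intros Hc Hs.
assert (D : forall a, continuous (fun r => coord (c r) a : C) s).
{ intros a. destruct (Hc a s Hs) as (H1 & H2 & _).
  apply continuous_ext with (fun r => (Re (coord (c r) a), Im (coord (c r) a))).
  - intros r. symmetry. apply surjective_pairing.
  - apply (continuous_pair (U := R_UniformSpace) (V := R_UniformSpace));
      now apply (ex_derive_continuous (V := R_NormedModule)). }
apply continuous_ext with (fun r => ((coord (c r) Iz, coord (c r) Iv1), coord (c r) Iv2)).
- intros r. destruct (c r) as [[? ?] ?]. reflexivity.
- apply (continuous_pair (U := prod_UniformSpace C_UniformSpace C_UniformSpace) (V := C_UniformSpace));
    [apply (continuous_pair (U := C_UniformSpace) (V := C_UniformSpace))|]; apply D.
Qed.

Lemma continuous_gnorm_curve (g : metric) (c : R -> C3) (s : R) :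
  (forall a b, smooth3 (fun w => g w a b)) -> C1_curve c -> 0 <= s <= 1 ->
  continuous (fun r => gnorm g (c r) (velocity c r)) s.
Proof.
intros Hg Hc Hs. unfold gnorm. apply continuous_sqrt_comp.
apply (continuous_scal_r (V := R_NormedModule) 2
  (fun r => Re (hform g (c r) (velocity c r) (velocity c r)))).
assert (V : forall a, continuous_parts (fun r => coord (velocity c r) a) s).
{ intros a. destruct (Hc a s Hs) as (_ & _ & H3 & H4). unfold velocity. destruct a; split; auto. }
assert (G : forall a b, continuous_parts (fun r => g (c r) a b) s).
{ intros a b. destruct (Hg a b nil (c s)) as [H _]. simpl in H.
  pose proof (continuous_comp (U := R_UniformSpace) c (fun w : C * C * C => g w a b : C) s
     (continuous_curve c s Hc Hs) H) as HG.
  split.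
  - apply (continuous_comp (fun r => g (c r) a b) (fst : C -> R)); [exact HG|].
    apply (continuous_fst (U := R_UniformSpace) (V := R_UniformSpace)).
  - apply (continuous_comp (fun r => g (c r) a b) (snd : C -> R)); [exact HG|].
    apply (continuous_snd (U := R_UniformSpace) (V := R_UniformSpace)). }
assert (T : forall a b, continuous_parts
  (fun r => g (c r) a b * coord (velocity c r) a * Cconj (coord (velocity c r) b))%C s).
{ intros a b. apply continuous_parts_mult; [apply continuous_parts_mult; auto|].
  now apply continuous_parts_conj. }
refine (proj1 (_ : continuous_parts (fun r => hform g (c r) (velocity c r) (velocity c r)) s)).
assert (S : forall F : idx -> R -> C, (forall a, continuous_parts (F a) s) ->
  continuous_parts (fun r => sum3 (fun a => F a r)) s).
{ intros F HF. unfold sum3.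
  exact (continuous_parts_plus _ _ s (continuous_parts_plus _ _ s (HF Iz) (HF Iv1)) (HF Iv2)). }
exact (S _ (fun a => S _ (T a))).
Qed.

Lemma ex_RInt_curve (g : metric) (c : R -> C3) :
  kahler g -> C1_curve c -> ex_RInt (fun s => gnorm g (c s) (velocity c s)) 0 1.
Proof.
intros Hg Hc. apply (ex_RInt_continuous (V := R_CompleteNormedModule)).
intros s Hs. rewrite Rmin_left, Rmax_right in Hs by lra.
apply continuous_gnorm_curve; auto. apply Hg.
Qed.

Lemma gnorm_nonneg (g : metric) (w xi : C3) : 0 <= gnorm g w xi.
Proof. apply sqrt_pos. Qed.

Lemma curve_length_nonneg (g : metric) (c : R -> C3) :
  kahler g -> C1_curve c -> 0 <= curve_length g c.
Proof.
intros Hg Hc. apply RInt_ge_0; [lra|now apply ex_RInt_curve|].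
intros; apply gnorm_nonneg.
Qed.

Lemma curve_length_le (g : metric) (c : R -> C3) (f : R -> R) (l : R) :
  kahler g -> C1_curve c -> is_RInt f 0 1 l ->
  (forall s, 0 < s < 1 -> gnorm g (c s) (velocity c s) <= f s) -> curve_length g c <= l.
Proof.
intros Hg Hc Hf H. rewrite <- (is_RInt_unique (V := R_CompleteNormedModule) _ _ _ _ Hf).
apply RInt_le; auto; [lra|now apply ex_RInt_curve|]. now exists l.
Qed.

Lemma is_RInt_const_unit (c : R) : is_RInt (fun _ => c) 0 1 c.
Proof.
evar_last; [exact (is_RInt_const (V := R_NormedModule) 0 1 c)|].
unfold scal; simpl; unfold mult; simpl. ring.
Qed.

Lemma path_length_nonneg (g : metric) (x y : X) (l : R) :
  kahler g -> path_length g x y l -> 0 <= l.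
Proof.
intros Hg H. induction H as [|c y l Hc _ IH]; [lra|].
pose proof (curve_length_nonneg g c Hg Hc). lra.
Qed.

Lemma path_single (g : metric) (c : R -> C3) :
  C1_curve c -> path_length g (proj (c 0)) (proj (c 1)) (curve_length g c).
Proof.
intros Hc. rewrite <- (Rplus_0_r (curve_length g c)). apply path_cons; auto. apply path_nil.
Qed.

Lemma path_app (g : metric) (x y z : X) (l m : R) :
  path_length g x y l -> path_length g y z m -> path_length g x z (l + m).
Proof.
intros H Hm. induction H as [|c y l Hc _ IH].
- now rewrite Rplus_0_l.
- rewrite Rplus_assoc. apply path_cons; auto.
Qed.

Lemma path_segment (g : metric) (w w' : C3) :
  path_length g (proj w) (proj w') (curve_length g (segment w w')).
Proof.
pose proof (path_single g _ (proj1 (segment_curve w w'))) as H.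
now rewrite segment_0, segment_1 in H.
Qed.

(** Any two points are joined by the image of a segment and lengths are nonnegative, so the infimum
    is finite and [real] in [dist] returns its true value. *)
Lemma dist_is_glb (g : metric) (x y : X) :
  kahler g -> is_glb_Rbar (path_length g x y) (Finite (dist g x y)) /\ 0 <= dist g x y.
Proof.
intros Hg. unfold dist.
destruct (proj_surjective x) as [w ->]. destruct (proj_surjective y) as [w' ->].
pose proof (Glb_Rbar_correct (path_length g (proj w) (proj w'))) as [H1 H2].
pose proof (H1 _ (path_segment g w w')) as H3.
assert (H4 : Rbar_le 0 (Glb_Rbar (path_length g (proj w) (proj w')))).
{ apply H2. intros l Hl. simpl. now apply path_length_nonneg in Hl. }
destruct (Glb_Rbar (path_length g (proj w) (proj w'))) as [r| |]; simpl in *; try contradiction.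
split; [|exact H4]. now split.
Qed.

Lemma dist_nonneg (g : metric) (x y : X) : kahler g -> 0 <= dist g x y.
Proof. intros Hg. now apply dist_is_glb. Qed.

Lemma dist_le_path (g : metric) (x y : X) (l : R) :
  kahler g -> path_length g x y l -> dist g x y <= l.
Proof. intros Hg H. destruct (dist_is_glb g x y Hg) as [[H1 _] _]. exact (H1 l H). Qed.

Lemma dist_approx (g : metric) (x y : X) (eps : R) :
  kahler g -> 0 < eps -> exists l, path_length g x y l /\ l < dist g x y + eps.
Proof.
intros Hg Heps. destruct (dist_is_glb g x y Hg) as [[_ H2] _].
destruct (excluded_middle_informative (exists l, path_length g x y l /\ l < dist g x y + eps)) as [|N]; auto.
exfalso. assert (Rbar_le (dist g x y + eps) (dist g x y)).
{ apply H2. intros l Hl. simpl. apply Rnot_lt_le. intros Hlt. apply N. eauto. }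
simpl in H. lra.
Qed.

Lemma dist_triangle (g : metric) (x y z : X) :
  kahler g -> dist g x z <= dist g x y + dist g y z.
Proof.
intros Hg. apply le_epsilon. intros eps Heps.
destruct (dist_approx g x y (eps / 2) Hg) as (l & Hl & Ll); [lra|].
destruct (dist_approx g y z (eps / 2) Hg) as (m & Hm & Lm); [lra|].
pose proof (dist_le_path g x z _ Hg (path_app g x y z l m Hl Hm)). lra.
Qed.

(** The lifts of consecutive pieces of a path need not match in the cover; invariance of [F] is what
    lets the increments along them be added. *)
Lemma dist_lipschitz (g : metric) (F : C3 -> R) :
  kahler g -> (forall w w', proj w = proj w' -> F w = F w') ->
  (forall c, C1_curve c -> Rabs (F (c 0) - F (c 1)) <= curve_length g c) ->
  forall w w', Rabs (F w - F w') <= dist g (proj w) (proj w').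
Proof.
intros Hg HF HL w w'.
assert (P : forall x y l, path_length g x y l -> forall w w', x = proj w -> y = proj w' ->
  Rabs (F w - F w') <= l).
{ clear w w'. intros x y l H. induction H as [x|c y l Hc H IH]; intros w w' E E'.
  - rewrite (HF w w') by congruence. rewrite Rminus_diag, Rabs_R0. lra.
  - rewrite <- (HF _ _ E). specialize (IH (c 1) w' eq_refl E'). specialize (HL c Hc).
    replace (F (c 0) - F w') with ((F (c 0) - F (c 1)) + (F (c 1) - F w')) by ring.
    eapply Rle_trans; [apply Rabs_triang|]. lra. }
destruct (dist_is_glb g (proj w) (proj w') Hg) as [[_ H2] _].
assert (Rbar_le (Rabs (F w - F w')) (dist g (proj w) (proj w'))); auto.
apply H2. intros l Hl. simpl. eapply P; eauto.
Qed.

(** * Metrics of the Calabi type have Hadamard order at least two *)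

Lemma calabi_type_potential (k : R) (g : metric) :
  calabi_type k g -> exists u, smooth_half_line u /\ g = calabi_metric k u.
Proof.
intros (u & Hu & Hg). exists u. split; auto.
apply functional_extensionality; intros w.
apply functional_extensionality; intros a.
apply functional_extensionality; intros b. apply Hg.
Qed.

(** At points with [fib2 w = 0] the curvature term is most negative for a given [t]. One test vector
    is used for each condition. *)
Lemma kahler_admissible (k : R) (u : R -> R) :
  0 < k -> smooth_half_line u -> kahler (calabi_metric k u) -> admissible k u.
Proof.
intros Hk Hu Hg t Ht.
set (w := ((0, 0), (sqrt t, 0), (0, 0)) : C3).
assert (Hw : fiber_norm2 k w = t).
{ rewrite fiber_norm2_coords. simpl. rewrite <- (sqrt_sqrt t Ht) at 3. ring. }
assert (P : forall xi, xi <> (RtoC 0, RtoC 0, RtoC 0) ->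
  0 < horizontal_coef k (Derive_n u 1 t) w * Cmod (coord xi Iz) ^ 2
      + (Derive_n u 1 t * vert_norm2 k w xi + Derive_n u 2 t * Cmod (radial k w xi) ^ 2)).
{ intros xi Hxi. rewrite <- Hw. rewrite <- Re_hform_calabi by auto. now apply Hg. }
split; [|split].
- specialize (P ((0, 0), (0, 0), (1, 0))).
  assert (H : (((0, 0), (0, 0), (1, 0)) : C3) <> (RtoC 0, RtoC 0, RtoC 0)).
  { intros E. injection E. intros; lra. }
  specialize (P H). revert P. unfold vert_norm2, radial, vert1, vert2, fib1, fib2, horizontal_coef.
  rewrite !Cmod_sqr. generalize (Derive_n u 1 t) (Derive_n u 2 t). intros u1 u2.
  unfold w, Re, Im. simpl. intros P.
  match type of P with 0 < ?X => replace X with (u1 * k) in P by (field; lra) end. nra.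
- specialize (P ((0, 0), (1, 0), (0, 0))).
  assert (H : (((0, 0), (1, 0), (0, 0)) : C3) <> (RtoC 0, RtoC 0, RtoC 0)).
  { intros E. injection E. intros; lra. }
  specialize (P H). revert P. unfold vert_norm2, radial, vert1, vert2, fib1, fib2, horizontal_coef.
  rewrite !Cmod_sqr. generalize (Derive_n u 1 t) (Derive_n u 2 t). intros u1 u2.
  unfold w, Re, Im. simpl. intros P.
  match type of P with 0 < ?X => replace X with (u1 + (sqrt t * sqrt t) * u2) in P by (field; lra) end.
  now rewrite sqrt_sqrt in P.
(* This vector annihilates [vert1] and [vert2]; it is the horizontal direction. *)
- specialize (P ((1, 0), (0, 0), (0, - sqrt t / (2 * k)))).
  assert (H : (((1, 0), (0, 0), (0, - sqrt t / (2 * k))) : C3) <> (RtoC 0, RtoC 0, RtoC 0)).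
  { intros E. injection E. intros; lra. }
  specialize (P H). revert P. unfold vert_norm2, radial, vert1, vert2, fib1, fib2, horizontal_coef.
  rewrite !Cmod_sqr. generalize (Derive_n u 1 t) (Derive_n u 2 t). intros u1 u2.
  unfold w, Re, Im. simpl. intros P.
  match type of P with 0 < ?X => replace X with (1 - (sqrt t * sqrt t) * u1 / (4 * k)) in P by (field; lra) end.
  rewrite sqrt_sqrt in P by auto.
  apply Rmult_lt_compat_r with (r := 4 * k) in P; [|lra].
  replace ((1 - t * u1 / (4 * k)) * (4 * k)) with (4 * k - t * u1) in P by (field; lra). lra.
Qed.

(** * Radial curves and the growth of the distance *)

Definition scale (l : C) (w : C3) : C3 :=
  (coord w Iz, (l * coord w Iv1)%C, (l * coord w Iv2)%C).

Lemma fiber_norm2_scale (k : R) (l : C) (w : C3) :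
  fiber_norm2 k (scale l w) = Cmod l ^ 2 * fiber_norm2 k w.
Proof.
rewrite !fiber_norm2_coords, Cmod_sqr.
destruct w as [[[x y] [a b]] [c d]], l as [p q]. unfold Re, Im. simpl. ring.
Qed.

Lemma Cmod_R_sqr (l : R) : Cmod l ^ 2 = l ^ 2.
Proof. rewrite Cmod_sqr. simpl. ring. Qed.

(** The derivative of [t u'(t)], which is also the squared length of the radial direction. *)
Definition moment_deriv (u : R -> R) (t : R) : R := Derive_n u 1 t + t * Derive_n u 2 t.

(** The velocity has no dz-component and is proportional to the fibre vector, so Cauchy-Schwarz is
    an equality and only the derivative of the moment survives. *)
Lemma scaling_curve (k : R) (u : R -> R) (l dl : R -> R) (w : C3) :
  0 < k -> smooth_half_line u ->
  (forall s, is_derive l s (dl s)) -> (forall s, continuous dl s) ->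
  C1_curve (fun s => scale (l s) w) /\
  forall s, gnorm (calabi_metric k u) (scale (l s) w) (velocity (fun s => scale (l s) w) s) =
    sqrt (2 * (dl s ^ 2 * fiber_norm2 k w * moment_deriv u (l s ^ 2 * fiber_norm2 k w))).
Proof.
intros Hk Hu Hl Hdl.
set (dc := fun s => (RtoC 0, (dl s * coord w Iv1)%C, (dl s * coord w Iv2)%C) : C3).
assert (L : forall p s, is_derive (fun s => l s * p) s (dl s * p)).
{ intros p s. apply (is_derive_scal_l (V := R_NormedModule) l). apply Hl. }
assert (L' : forall p s, continuous (fun s => dl s * p) s).
{ intros p s. apply (continuous_scal_l (V := R_NormedModule) dl). apply Hdl. }
destruct (curve_of_derivatives (fun s => scale (l s) w) dc) as [H1 H2].
- intros a s. destruct a; simpl.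
  + apply (is_derive_const (K := R_AbsRing) (V := R_NormedModule)).
  + apply is_derive_ext with (fun s => l s * Re (coord w Iv1)).
    * intros r. unfold Re. simpl. ring.
    * replace (dl s * _ - _) with (dl s * Re (coord w Iv1)) by (unfold Re; simpl; ring). apply L.
  + apply is_derive_ext with (fun s => l s * Re (coord w Iv2)).
    * intros r. unfold Re. simpl. ring.
    * replace (dl s * _ - _) with (dl s * Re (coord w Iv2)) by (unfold Re; simpl; ring). apply L.
- intros a s. destruct a; simpl.
  + apply (is_derive_const (K := R_AbsRing) (V := R_NormedModule)).
  + apply is_derive_ext with (fun s => l s * Im (coord w Iv1)).
    * intros r. unfold Im. simpl. ring.
    * replace (dl s * _ + _) with (dl s * Im (coord w Iv1)) by (unfold Im; simpl; ring). apply L.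
  + apply is_derive_ext with (fun s => l s * Im (coord w Iv2)).
    * intros r. unfold Im. simpl. ring.
    * replace (dl s * _ + _) with (dl s * Im (coord w Iv2)) by (unfold Im; simpl; ring). apply L.
- intros a s. destruct a; simpl.
  + apply continuous_const.
  + apply continuous_ext with (fun s => dl s * Re (coord w Iv1)); auto. intros r. unfold Re. simpl. ring.
  + apply continuous_ext with (fun s => dl s * Re (coord w Iv2)); auto. intros r. unfold Re. simpl. ring.
- intros a s. destruct a; simpl.
  + apply continuous_const.
  + apply continuous_ext with (fun s => dl s * Im (coord w Iv1)); auto. intros r. unfold Im. simpl. ring.
  + apply continuous_ext with (fun s => dl s * Im (coord w Iv2)); auto. intros r. unfold Im. simpl. ring.
- split; auto. intros s. rewrite H2. unfold gnorm. f_equal. f_equal.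
  rewrite Re_hform_calabi, fiber_norm2_scale, Cmod_R_sqr by auto.
  unfold moment_deriv.
  generalize (Derive_n u 1 (l s ^ 2 * fiber_norm2 k w)) (Derive_n u 2 (l s ^ 2 * fiber_norm2 k w)).
  intros u1 u2. rewrite fiber_norm2_fib.
  unfold vert_norm2, radial, horizontal_coef, vert1, vert2, fib1, fib2, dc.
  rewrite !Cmod_sqr. destruct w as [[[x y] [a b]] [c d]]. unfold Re, Im. simpl. field. lra.
Qed.

Lemma moment_deriv_pos (k : R) (u : R -> R) (t : R) :
  admissible k u -> 0 <= t -> 0 < moment_deriv u t.
Proof. intros H Ht. now destruct (H t Ht) as (_ & ? & _). Qed.

Lemma continuous_moment_deriv (u : R -> R) (t : R) :
  smooth_half_line u -> 0 <= t -> continuous (moment_deriv u) t.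
Proof.
intros (eps & Heps & Hu) Ht.
assert (D : forall n, continuous (Derive_n u n) t).
{ intros n. apply (ex_derive_continuous (V := R_NormedModule)). eexists.
  apply (Derive_n_is_derive u eps); auto. lra. }
apply (continuous_plus (V := R_NormedModule)); [apply D|].
apply (continuous_mult (K := R_AbsRing) (fun t => t)); [apply continuous_id|apply D].
Qed.

Lemma is_derive_moment (u : R -> R) (t : R) :
  smooth_half_line u -> 0 <= t ->
  is_derive (fun t => t * Derive_n u 1 t) t (moment_deriv u t).
Proof.
intros (eps & Heps & Hu) Ht. evar_last.
- apply (is_derive_mult (fun t => t) (Derive_n u 1)).
  + apply (is_derive_id (K := R_AbsRing)).
  + apply (Derive_n_is_derive u eps); auto. lra.
  + intros; apply Rmult_comm.
- unfold moment_deriv, plus, mult, one; simpl. ring.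
Qed.

Lemma sqrt_mult_le (L p : R) : 0 <= L -> 0 <= p -> sqrt (L * p) <= sqrt L / 2 * (1 + p).
Proof.
intros HL Hp. rewrite sqrt_mult by auto.
replace (sqrt L / 2 * (1 + p)) with (sqrt L * ((1 + p) / 2)) by field.
apply Rmult_le_compat_l; [apply sqrt_pos|].
pose proof (sqrt_sqrt p Hp). pose proof (pow2_ge_0 (sqrt p - 1)). nra.
Qed.

(* The moment [t u'(t)] is bounded by [4 k], so the length of a radial segment
   grows only like the square root of its logarithmic length. *)
Lemma radial_length (k : R) (u : R -> R) (w : C3) :
  0 < k -> smooth_half_line u -> kahler (calabi_metric k u) ->
  1 <= fiber_norm2 k w ->
  let L := ln (fiber_norm2 k w) / 2 in
  curve_length (calabi_metric k u) (fun s => scale (exp (- L * s)) w) <=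
    (1 + 4 * k) / 2 * sqrt L.
Proof.
intros Hk Hu Hg HT L. set (T := fiber_norm2 k w) in *.
pose proof (kahler_admissible k u Hk Hu Hg) as Hadm.
assert (HL : 0 <= L).
{ unfold L. pose proof (ln_le 1 T ltac:(lra) HT). rewrite ln_1 in H. lra. }
destruct (scaling_curve k u (fun s => exp (- L * s)) (fun s => - L * exp (- L * s)) w Hk Hu) as [HC HN].
{ intros s. auto_derive; auto. ring. }
{ intros s. apply (ex_derive_continuous (V := R_NormedModule)). auto_derive. auto. }
set (tau := fun s => exp (- L * s) ^ 2 * T).
assert (Htau : forall s, 0 < tau s).
{ intros s. apply Rmult_lt_0_compat; [|lra]. apply pow_lt, exp_pos. }
assert (Dtau : forall s, is_derive tau s (-2 * L * tau s)).
{ intros s. unfold tau. auto_derive; auto. ring. }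
(* Cauchy-Schwarz in pointwise form: the speed is [sqrt (L * p)], where
   [p = 2 * L * tau * moment_deriv] is minus the derivative of [tau * u'(tau)]. The majorant [f]
   thus has the explicit primitive [F], and only end values of the moment, between 0 and [4 * k],
   remain. *)
set (f := fun s => sqrt L / 2 * (1 + 2 * L * (tau s * moment_deriv u (tau s)))).
set (F := fun s => sqrt L / 2 * (s - tau s * Derive_n u 1 (tau s))).
assert (IF : is_RInt f 0 1 (minus (F 1) (F 0))).
{ apply (is_RInt_derive (V := R_CompleteNormedModule)).
  - intros s _. unfold F, f.
    assert (D1 : is_derive (fun s => tau s * Derive_n u 1 (tau s)) s (-2 * L * tau s * moment_deriv u (tau s))).
    { apply (is_derive_comp (V := R_NormedModule) (fun t => t * Derive_n u 1 t) tau).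
      - apply is_derive_moment; auto. specialize (Htau s). lra.
      - apply Dtau. }
    assert (D2 : is_derive (fun s => s - tau s * Derive_n u 1 (tau s)) s (1 - (-2 * L * tau s * moment_deriv u (tau s)))).
    { apply (is_derive_minus (V := R_NormedModule) (fun s => s)); auto. apply (is_derive_id (K := R_AbsRing)). }
    apply (is_derive_scal _ s (sqrt L / 2)) in D2.
    evar_last; [exact D2|]. unfold mult; simpl. ring.
  - intros s _.
    assert (Ct : continuous tau s) by (apply (ex_derive_continuous (V := R_NormedModule)); eexists; apply Dtau).
    unfold f. apply (continuous_scal_r (V := R_NormedModule) (sqrt L / 2)).
    apply (continuous_plus (V := R_NormedModule)); [apply continuous_const|].
    apply (continuous_scal_r (V := R_NormedModule) (2 * L) (fun s => tau s * moment_deriv u (tau s))).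
    apply (continuous_mult (K := R_AbsRing) tau); auto.
    apply (continuous_comp tau (moment_deriv u)); auto.
    apply continuous_moment_deriv; auto. specialize (Htau s). lra. }
eapply Rle_trans; [apply (curve_length_le _ _ f _ Hg HC IF)|].
- intros s _. rewrite HN. fold T. unfold f.
  replace (2 * ((- L * exp (- L * s)) ^ 2 * T * moment_deriv u (exp (- L * s) ^ 2 * T)))
    with (L * (2 * L * (tau s * moment_deriv u (tau s)))) by (unfold tau; ring).
  apply sqrt_mult_le; auto.
  pose proof (moment_deriv_pos k u (tau s) Hadm (Rlt_le _ _ (Htau s))).
  apply Rmult_le_pos; [lra|]. specialize (Htau s). apply Rmult_le_pos; lra.
- destruct (Hadm (tau 1) (Rlt_le _ _ (Htau 1))) as (A1 & _ & _).
  destruct (Hadm (tau 0) (Rlt_le _ _ (Htau 0))) as (_ & _ & A3).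
  pose proof (Rmult_lt_0_compat _ _ (Htau 1) A1).
  change (F 1 - F 0 <= (1 + 4 * k) / 2 * sqrt L). unfold F.
  replace ((1 + 4 * k) / 2 * sqrt L) with (sqrt L / 2 * (1 + 4 * k)) by field.
  rewrite <- Rmult_minus_distr_l.
  apply Rmult_le_compat_l; [pose proof (sqrt_pos L)|]; lra.
Qed.

Lemma scale_scale (l m : C) (w : C3) : scale l (scale m w) = scale (l * m) w.
Proof.
destruct w as [[z v1] v2]. unfold scale. simpl. now rewrite !Cmult_assoc.
Qed.

(** Exponential scaling never reaches the zero section, so it stops at norm 1 and a linear scaling
    takes over. The length [K] of that second leg is the same for all [w]; the last leg depends only
    on the foot [scale 0 w], which is constant along a complex line in the fibre. *)
Lemma distance_growth (k : R) (u : R -> R) (w0 : C3) :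
  0 < k -> smooth_half_line u -> kahler (calabi_metric k u) ->
  exists K, forall w, 1 <= fiber_norm2 k w ->
    dist (calabi_metric k u) (proj w) (proj w0) <=
      (1 + 4 * k) / 2 * sqrt (ln (fiber_norm2 k w) / 2) + K
      + curve_length (calabi_metric k u) (segment (scale 0 w) w0).
Proof.
intros Hk Hu Hg.
exists (RInt (fun s => sqrt (2 * ((-1) ^ 2 * 1 * moment_deriv u ((1 - s) ^ 2 * 1)))) 0 1).
intros w HT. set (T := fiber_norm2 k w) in *. set (L := ln T / 2).
assert (EL : exp (- L * 1) ^ 2 * T = 1).
{ assert (ET : T = exp (L + L)).
  { unfold L. replace (ln T / 2 + ln T / 2) with (ln T) by field. rewrite exp_ln; lra. }
  rewrite ET, Rmult_1_r, exp_plus. simpl.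
  pose proof (exp_plus (- L) L) as E. rewrite Rplus_opp_l, exp_0 in E.
  transitivity ((exp (- L) * exp L) * (exp (- L) * exp L)); [ring|]. rewrite <- E. ring. }
destruct (scaling_curve k u (fun s => exp (- L * s)) (fun s => - L * exp (- L * s)) w Hk Hu) as [C1 _].
{ intros s. auto_derive; auto. ring. }
{ intros s. apply (ex_derive_continuous (V := R_NormedModule)). auto_derive. auto. }
set (w1 := scale (exp (- L * 1)) w).
assert (T1 : fiber_norm2 k w1 = 1) by (unfold w1; now rewrite fiber_norm2_scale, Cmod_R_sqr).
destruct (scaling_curve k u (fun s => 1 - s) (fun _ => -1) w1 Hk Hu) as [C2 N2].
{ intros s. auto_derive; auto; ring. }
{ intros s. apply continuous_const. }
pose proof (path_single (calabi_metric k u) _ C1) as P1.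
pose proof (path_single (calabi_metric k u) _ C2) as P2.
simpl in P1, P2.
replace (scale (exp (- L * 0)) w) with w in P1.
2:{ rewrite Rmult_0_r, exp_0. destruct w as [[z v1] v2]. unfold scale. simpl. now rewrite !Cmult_1_l. }
replace (scale (RtoC (1 - 0)) w1) with w1 in P2.
2:{ rewrite Rminus_0_r. destruct w1 as [[z v1] v2]. unfold scale. simpl. now rewrite !Cmult_1_l. }
replace (scale (RtoC (1 - 1)) w1) with (scale 0 w) in P2.
2:{ unfold w1. rewrite scale_scale. f_equal. rewrite Rminus_diag. ring. }
fold w1 in P1.
pose proof (path_app _ _ _ _ _ _ P1 (path_app _ _ _ _ _ _ P2 (path_segment _ (scale 0 w) w0))) as P.
apply (dist_le_path _ _ _ _ Hg) in P.
pose proof (radial_length k u w Hk Hu Hg HT) as R1. cbv zeta in R1. fold T in R1. fold L in R1.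
assert (E2 : curve_length (calabi_metric k u) (fun s => scale (RtoC (1 - s)) w1) =
  RInt (fun s => sqrt (2 * ((-1) ^ 2 * 1 * moment_deriv u ((1 - s) ^ 2 * 1)))) 0 1).
{ unfold curve_length. apply RInt_ext. intros s _. rewrite N2. now rewrite T1. }
rewrite E2 in P. lra.
Qed.

(** * Holomorphic functions of order less than two *)

Definition translate (w e : C3) (l : C) : C3 :=
  ((coord w Iz + l * coord e Iz)%C, (coord w Iv1 + l * coord e Iv1)%C, (coord w Iv2 + l * coord e Iv2)%C).

Lemma C_ball_of_Cmod (a b : C) (d : R) : Cmod (b - a) < d -> ball (M := C_UniformSpace) a d b.
Proof.
intros H. pose proof (Rmax_Cmod (b - a)%C) as HM.
pose proof (Rmax_l (Rabs (fst (b - a)%C)) (Rabs (snd (b - a)%C))).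
pose proof (Rmax_r (Rabs (fst (b - a)%C)) (Rabs (snd (b - a)%C))).
split; (eapply Rle_lt_trans; [|exact H]); (eapply Rle_trans; [|exact HM]); auto.
Qed.

Lemma holomorphic_line (f : X -> C) (w e : C3) :
  holomorphic f -> complex_differentiable (fun l => f (proj (translate w e l))).
Proof.
intros Hf z. destruct (Hf (translate w e z)) as [l [Hlin Hdom]].
set (U := prod_NormedModule C_AbsRing
            (prod_NormedModule C_AbsRing C_NormedModule C_NormedModule) C_NormedModule) in *.
exists (l e). intros eps Heps.
assert (He : 0 < eps / (norm (e : U) + 1)).
{ apply Rdiv_lt_0_compat; auto. pose proof (norm_ge_0 (e : U)). lra. }
destruct (Hdom (translate w e z) (fun P H => H) (mkposreal _ He)) as [d Hd].
set (M := Cmod (coord e Iz) + Cmod (coord e Iv1) + Cmod (coord e Iv2) + 1).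
pose proof (Cmod_ge_0 (coord e Iz)) as M1. pose proof (Cmod_ge_0 (coord e Iv1)) as M2.
pose proof (Cmod_ge_0 (coord e Iv2)) as M3.
assert (HM : 0 < M) by (unfold M; lra).
exists (d / M). split; [apply Rdiv_lt_0_compat; auto; apply cond_pos|].
intros z' Hz'.
assert (Hc : forall a, Cmod (coord e a) <= M -> forall p : C,
   ball (M := C_UniformSpace) (p + z * coord e a)%C d (p + z' * coord e a)%C).
{ intros a Ha p. apply C_ball_of_Cmod.
  replace (p + z' * coord e a - (p + z * coord e a))%C with ((z' - z) * coord e a)%C by ring.
  rewrite Cmod_mult. apply Rle_lt_trans with (Cmod (z' - z) * M).
  - apply Rmult_le_compat_l; auto. apply Cmod_ge_0.
  - apply Rmult_lt_compat_r with (r := M) in Hz'; auto.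
    now replace (d / M * M) with (pos d) in Hz' by (field; lra). }
assert (HB : ball (M := U) (translate w e z) d (translate w e z')).
{ split; [split|]; apply Hc; unfold M; lra. }
specialize (Hd _ HB). simpl in Hd.
assert (Ed : minus (translate w e z' : U) (translate w e z) = scal (z' - z)%C (e : U)).
{ destruct w as [[w1 w2] w3], e as [[e1 e2] e3]. unfold translate. simpl.
  apply injective_projections; [apply injective_projections|].
  - change ((w1 + z' * e1) - (w1 + z * e1) = (z' - z) * e1)%C. ring.
  - change ((w2 + z' * e2) - (w2 + z * e2) = (z' - z) * e2)%C. ring.
  - change ((w3 + z' * e3) - (w3 + z * e3) = (z' - z) * e3)%C. ring. }
rewrite Ed in Hd. rewrite (linear_scal l Hlin) in Hd.
assert (N : norm (scal (z' - z)%C (e : U)) <= Cmod (z' - z) * norm (e : U)) by apply (norm_scal (V := U)).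
change (Cmod (f (proj (translate w e z')) - f (proj (translate w e z)) - (z' - z) * l e) <=
  eps / (norm (e : U) + 1) * norm (scal (z' - z)%C (e : U))) in Hd.
rewrite (Cmult_comm (l e)). eapply Rle_trans; [exact Hd|].
pose proof (norm_ge_0 (e : U)) as N0. set (n := norm (e : U)) in *.
eapply Rle_trans; [apply Rmult_le_compat_l; [lra|exact N]|].
replace (eps / (n + 1) * (Cmod (z' - z) * n)) with (eps * Cmod (z' - z) * (n / (n + 1))) by (field; lra).
rewrite <- (Rmult_1_r (eps * Cmod (z' - z))) at 2. apply Rmult_le_compat_l.
- apply Rmult_le_pos; [lra|apply Cmod_ge_0].
- apply Rmult_le_reg_r with (n + 1); [lra|]. unfold Rdiv. rewrite Rmult_assoc, Rinv_l; lra.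
Qed.

Lemma Rpower_subquadratic (rho eta : R) :
  0 < rho < 2 -> 0 < eta -> exists K, forall x, 1 <= x -> Rpower x rho <= K + eta * x ^ 2.
Proof.
intros Hrho Heta.
(* Beyond [X0] one has x^(2 - rho) >= 1 / eta, so the quadratic term dominates. *)
set (X0 := Rpower (/ eta) (/ (2 - rho))).
exists (Rpower X0 rho). intros x Hx.
assert (0 < Rpower X0 rho) by apply exp_pos.
assert (0 <= eta * x ^ 2) by (apply Rmult_le_pos; [lra|apply pow2_ge_0]).
destruct (Rle_dec x X0) as [Hle|Hgt].
- assert (Rpower x rho <= Rpower X0 rho) by (apply Rle_Rpower_l; lra). lra.
- apply Rnot_le_lt in Hgt.
  assert (E : x ^ 2 = Rpower x rho * Rpower x (2 - rho)).
  { rewrite <- Rpower_plus. replace (rho + (2 - rho)) with (INR 2) by (simpl; ring).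
    rewrite Rpower_pow; lra. }
  assert (E2 : / eta <= Rpower x (2 - rho)).
  { replace (/ eta) with (Rpower X0 (2 - rho)).
    - apply Rle_Rpower_l; [lra|]. split; [apply exp_pos|lra].
    - unfold X0. rewrite Rpower_mult. replace (/ (2 - rho) * (2 - rho)) with 1 by (field; lra).
      apply Rpower_1. now apply Rinv_0_lt_compat. }
  assert (0 < Rpower x rho) by apply exp_pos.
  assert (Rpower x rho <= eta * x ^ 2); [|lra].
  rewrite E. replace (Rpower x rho) with (eta * (Rpower x rho * / eta)) at 1 by (field; lra).
  apply Rmult_le_compat_l; [lra|]. apply Rmult_le_compat_l; lra.
Qed.

(** [L] will be the logarithm of the fibre norm; the coefficient 1/2 then turns an order below 2
    into square-root growth, within reach of [liouville]. *)
Lemma growth_exponent_bound (rho c D kap : R) :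
  0 < rho < 2 -> 0 < c -> 0 <= D -> 0 <= kap ->
  exists K, forall L d, 0 <= L -> 0 <= d -> d <= kap * sqrt L + D ->
    c * Rpower (d + 1) rho <= K + L / 2.
Proof.
intros Hrho Hc HD Hk.
(* Squaring [kap * sqrt L + (D + 1)] yields at most [2 * kap ^ 2 * L] plus a constant; this [eta]
   keeps [c * eta * (2 * kap ^ 2)] below 1/2. *)
set (eta := / (4 * c * (kap ^ 2 + 1))).
assert (Hk2 : 0 < kap ^ 2 + 1) by (pose proof (pow2_ge_0 kap); lra).
assert (Heta : 0 < eta).
{ apply Rinv_0_lt_compat. apply Rmult_lt_0_compat; lra. }
destruct (Rpower_subquadratic rho eta Hrho Heta) as [K HK].
exists (c * K + c * (eta * (2 * (D + 1) ^ 2))). intros L d HL Hd0 Hd.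
pose proof (sqrt_pos L) as Hs. pose proof (sqrt_sqrt L HL) as Hss.
assert (0 <= kap * sqrt L) by now apply Rmult_le_pos.
set (x := kap * sqrt L + (D + 1)).
assert (H1 : Rpower (d + 1) rho <= Rpower x rho) by (apply Rle_Rpower_l; unfold x; lra).
assert (H2 : Rpower x rho <= K + eta * x ^ 2) by (apply HK; unfold x; lra).
assert (H3 : x ^ 2 <= 2 * (D + 1) ^ 2 + 2 * kap ^ 2 * L).
{ unfold x. pose proof (pow2_ge_0 (kap * sqrt L - (D + 1))).
  rewrite <- Hss at 2. nra. }
assert (H4 : eta * x ^ 2 <= eta * (2 * (D + 1) ^ 2 + 2 * kap ^ 2 * L)) by (apply Rmult_le_compat_l; lra).
assert (H5 : c * eta * (2 * kap ^ 2 * L) <= L / 2).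
{ replace (c * eta * (2 * kap ^ 2 * L)) with (L / 2 * (kap ^ 2 / (kap ^ 2 + 1))) by (unfold eta; field; lra).
  rewrite <- (Rmult_1_r (L / 2)) at 2. apply Rmult_le_compat_l; [lra|].
  apply Rmult_le_reg_r with (kap ^ 2 + 1); [lra|]. unfold Rdiv. rewrite Rmult_assoc, Rinv_l; lra. }
assert (c * Rpower (d + 1) rho <= c * (K + eta * (2 * (D + 1) ^ 2 + 2 * kap ^ 2 * L))).
{ apply Rmult_le_compat_l; lra. }
replace (c * (K + eta * (2 * (D + 1) ^ 2 + 2 * kap ^ 2 * L))) with
  (c * K + c * (eta * (2 * (D + 1) ^ 2)) + c * eta * (2 * kap ^ 2 * L)) in H0 by ring.
lra.
Qed.

Lemma translate_origin (w : C3) (l : C) :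
  translate (scale 0 w) (RtoC 0, coord w Iv1, coord w Iv2) l = scale l w.
Proof.
destruct w as [[z v1] v2]. unfold translate, scale. simpl.
apply injective_projections; [apply injective_projections|]; simpl; ring.
Qed.

Definition growth_bound (g : metric) (p : X) (f : X -> C) (rho C1 C2 : R) : Prop :=
  forall q, Cmod (f q) <= C1 * exp (C2 * Rpower (dist g q p + 1) rho).

Lemma constant_on_fibers (k : R) (u : R -> R) (f : X -> C) (w0 : C3) (rho C1 C2 : R) :
  0 < k -> smooth_half_line u -> kahler (calabi_metric k u) -> holomorphic f ->
  0 < rho < 2 -> 0 < C1 -> 0 < C2 ->
  growth_bound (calabi_metric k u) (proj w0) f rho C1 C2 ->
  forall w, f (proj w) = f (proj (scale 0 w)).
Proof.
intros Hk Hu Hg Hf Hrho HC1 HC2 Hb w.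
set (F := fun l => f (proj (translate (scale 0 w) (RtoC 0, coord w Iv1, coord w Iv2) l))).
assert (E1 : forall l, F l = f (proj (scale l w))) by (intros l; unfold F; now rewrite translate_origin).
assert (Es : scale 1 w = w).
{ destruct w as [[z v1] v2]. unfold scale. simpl. now rewrite !Cmult_1_l. }
rewrite <- Es at 1. rewrite <- !E1.
destruct (Rle_lt_or_eq_dec _ _ (fiber_norm2_nonneg k w Hk)) as [HT|HT].
(* Here [w] lies on the zero section and all its scalings coincide. *)
2:{ rewrite !E1. f_equal. f_equal. symmetry in HT. rewrite fiber_norm2_fib in HT.
    pose proof (pow2_ge_0 (Cmod (fib1 w))). pose proof (pow2_ge_0 (Cmod (fib2 w))).
    assert (V2 : fib2 w = RtoC 0).
    { destruct (excluded_middle_informative (fib2 w = RtoC 0)) as [|N]; auto.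
      apply Cmod_sqr_pos in N. exfalso. nra. }
    assert (V1 : fib1 w = RtoC 0).
    { destruct (excluded_middle_informative (fib1 w = RtoC 0)) as [|N]; auto.
      apply Cmod_sqr_pos in N. exfalso. nra. }
    destruct w as [[z v1] v2]. unfold fib1, fib2 in *. simpl in *. subst v2.
    assert (v1 = RtoC 0) as -> by (rewrite <- V1; ring).
    unfold scale. simpl. now rewrite !Cmult_0_r. }
set (T := fiber_norm2 k w) in *.
destruct (distance_growth k u w0 Hk Hu Hg) as [K HK].
set (D := K + curve_length (calabi_metric k u) (segment (scale 0 w) w0)).
set (kap := (1 + 4 * k) / 2).
destruct (growth_exponent_bound rho C2 (Rmax D 0) kap) as [K' HK']; auto; [apply Rmax_r|unfold kap; lra|].
apply liouville; [apply holomorphic_line; auto|].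
intros eps Heps.
set (sT := sqrt T).
assert (HsT : 0 < sT) by now apply sqrt_lt_R0.
(* After multiplication by [sT] the desired inequality reads [eps * A * sqrt x <= eps * x], that is
   [A <= sqrt x]; the threshold [A ^ 2 + 1] also ensures [ln x >= 0]. *)
set (A := C1 * exp K' * sT / eps).
assert (HA : 0 < A).
{ apply Rdiv_lt_0_compat; auto. apply Rmult_lt_0_compat; auto. apply Rmult_lt_0_compat; auto. apply exp_pos. }
exists ((A ^ 2 + 1) / sT). intros l Hl. fold (F l). rewrite E1.
set (x := Cmod l * sT).
assert (Hx : A ^ 2 + 1 <= x).
{ unfold x. apply Rmult_le_compat_r with (r := sT) in Hl; [|lra].
  now replace ((A ^ 2 + 1) / sT * sT) with (A ^ 2 + 1) in Hl by (field; lra). }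
pose proof (pow2_ge_0 A) as HA2.
assert (ET : fiber_norm2 k (scale l w) = x ^ 2).
{ rewrite fiber_norm2_scale. fold T. unfold x. rewrite <- (sqrt_sqrt T) at 1 by lra. fold sT. ring. }
assert (EL : ln (fiber_norm2 k (scale l w)) / 2 = ln x).
{ rewrite ET. simpl. rewrite Rmult_1_r, ln_mult by lra. field. }
assert (HLx : 0 <= ln x) by (rewrite <- ln_1; apply ln_le; lra).
pose proof (HK (scale l w)) as HD. rewrite EL, scale_scale, Cmult_0_l, ET in HD.
assert (HD' : dist (calabi_metric k u) (proj (scale l w)) (proj w0) <= kap * sqrt (ln x) + Rmax D 0).
{ eapply Rle_trans; [apply HD; nra|]. fold kap. pose proof (Rmax_l D 0). unfold D in *. lra. }
eapply Rle_trans; [apply Hb|].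
specialize (HK' (ln x) _ HLx (dist_nonneg _ _ _ Hg) HD').
assert (Ex : exp (ln x / 2) = sqrt x).
{ symmetry. apply sqrt_lem_1; [lra|left; apply exp_pos|].
  rewrite <- exp_plus. replace (ln x / 2 + ln x / 2) with (ln x) by field. apply exp_ln. lra. }
apply Rle_trans with (C1 * (exp K' * sqrt x)).
{ apply Rmult_le_compat_l; [lra|]. rewrite <- Ex, <- exp_plus.
  destruct HK' as [HK'|HK']; [left; now apply exp_increasing|right; now rewrite HK']. }
assert (Hsx : A <= sqrt x).
{ rewrite <- (sqrt_Rsqr A) by lra. apply sqrt_le_1_alt. unfold Rsqr. simpl in Hx. lra. }
pose proof (sqrt_sqrt x ltac:(lra)) as Hss. pose proof (sqrt_pos x).
apply Rmult_le_reg_r with sT; auto.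
replace (eps * Cmod l * sT) with (eps * (sqrt x * sqrt x)) by (rewrite Hss; unfold x; ring).
replace (C1 * (exp K' * sqrt x) * sT) with (eps * (A * sqrt x)) by (unfold A; field; lra).
apply Rmult_le_compat_l; [lra|]. now apply Rmult_le_compat_r.
Qed.

(** * Lifts with bounded base coordinate *)

Lemma shift_Re (n : nat) (w : C3) :
  exists w', proj w' = proj w /\ Re (coord w' Iz) = Re (coord w Iz) + INR n /\
    Im (coord w' Iz) = Im (coord w Iz).
Proof.
induction n as [|n (w' & E & R1 & R2)].
- exists w. simpl. repeat split; ring.
- exists (deck1 w'). rewrite proj_deck1, S_INR. split; auto.
  destruct w' as [[[x y] v1] v2]. unfold Re, Im in *. simpl in *. lra.
Qed.

Lemma shift_Re_neg (n : nat) (w : C3) :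
  exists w', proj w' = proj w /\ Re (coord w' Iz) = Re (coord w Iz) - INR n /\
    Im (coord w' Iz) = Im (coord w Iz).
Proof.
induction n as [|n (w' & E & R1 & R2)].
- exists w. simpl. repeat split; ring.
- destruct w' as [[z v1] v2]. exists ((z - 1)%C, v1, v2). split.
  + rewrite <- E, <- (proj_deck1 ((z - 1)%C, v1, v2)). unfold deck1. do 3 f_equal. ring.
  + rewrite S_INR. unfold Re, Im in *. simpl in *. lra.
Qed.

Lemma shift_Im (n : nat) (w : C3) :
  exists w', proj w' = proj w /\ Im (coord w' Iz) = Im (coord w Iz) + INR n /\
    Re (coord w' Iz) = Re (coord w Iz).
Proof.
induction n as [|n (w' & E & R1 & R2)].
- exists w. simpl. repeat split; ring.
- exists (deck2 w'). rewrite proj_deck2, S_INR. split; auto.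
  destruct w' as [[[x y] v1] v2]. unfold Re, Im in *. simpl in *. lra.
Qed.

Lemma shift_Im_neg (n : nat) (w : C3) :
  exists w', proj w' = proj w /\ Im (coord w' Iz) = Im (coord w Iz) - INR n /\
    Re (coord w' Iz) = Re (coord w Iz).
Proof.
induction n as [|n (w' & E & R1 & R2)].
- exists w. simpl. repeat split; ring.
- destruct w' as [[z v1] v2]. exists ((z - Ci)%C, (v1 - v2)%C, v2). split.
  + rewrite <- E, <- (proj_deck2 ((z - Ci)%C, (v1 - v2)%C, v2)). unfold deck2. do 3 f_equal; ring.
  + rewrite S_INR. unfold Re, Im in *. simpl in *. lra.
Qed.

Lemma nat_near (x : R) : exists n : nat, Rabs (x - INR n) <= 1 \/ Rabs (x + INR n) <= 1.
Proof.
destruct (nfloor_ex (Rabs x) (Rabs_pos x)) as [n Hn]. exists n.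
revert Hn. unfold Rabs at 1 2. destruct (Rcase_abs x); intros Hn.
- right. apply Rabs_le_between. lra.
- left. apply Rabs_le_between. lra.
Qed.

Lemma fundamental_domain (w : C3) :
  exists w', proj w' = proj w /\ Rabs (Re (coord w' Iz)) <= 1 /\ Rabs (Im (coord w' Iz)) <= 1.
Proof.
assert (exists w1, proj w1 = proj w /\ Rabs (Re (coord w1 Iz)) <= 1) as (w1 & E1 & H1).
{ destruct (nat_near (Re (coord w Iz))) as [n [H|H]].
  - destruct (shift_Re_neg n w) as (w' & E & R1 & _). exists w'. now rewrite R1.
  - destruct (shift_Re n w) as (w' & E & R1 & _). exists w'. now rewrite R1. }
destruct (nat_near (Im (coord w1 Iz))) as [n [H|H]].
- destruct (shift_Im_neg n w1) as (w' & E & R1 & R2). exists w'. rewrite R1, R2. split; [congruence|auto].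
- destruct (shift_Im n w1) as (w' & E & R1 & R2). exists w'. rewrite R1, R2. split; [congruence|auto].
Qed.

Lemma low_order_constant (k : R) (u : R -> R) (f : X -> C) (p : X) (rho C1 C2 : R) :
  0 < k -> smooth_half_line u -> kahler (calabi_metric k u) -> holomorphic f ->
  0 < rho < 2 -> 0 < C1 -> 0 < C2 -> growth_bound (calabi_metric k u) p f rho C1 C2 ->
  forall q q', f q = f q'.
Proof.
intros Hk Hu Hg Hf Hrho HC1 HC2 Hb.
destruct (proj_surjective p) as [w0 ->].
pose proof (constant_on_fibers k u f w0 rho C1 C2 Hk Hu Hg Hf Hrho HC1 HC2 Hb) as HF.
set (o := ((RtoC 0, RtoC 0), RtoC 0) : C3).
set (F := fun z => f (proj (translate o (RtoC 1, RtoC 0, RtoC 0) z))).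
assert (EF : forall w, f (proj w) = F (coord w Iz)).
{ intros w. rewrite HF. unfold F. do 2 f_equal.
  destruct w as [[z v1] v2]. unfold translate, scale, o. simpl.
  apply injective_projections; [apply injective_projections|]; simpl; ring. }
set (D := curve_length (calabi_metric k u) (segment o w0)).
set (B := C1 * exp (C2 * Rpower (4 + D + 1) rho)).
assert (HD : 0 <= D) by (apply curve_length_nonneg; auto; apply segment_curve).
assert (HB : forall z, Cmod (F z) <= B).
{ intros z. destruct (fundamental_domain (z, RtoC 0, RtoC 0)) as (w & Ew & B1 & B2).
  assert (E : F z = F (coord w Iz)) by (rewrite <- EF, Ew, EF; reflexivity).
  rewrite E. set (w1 := (coord w Iz, RtoC 0, RtoC 0) : C3).
  replace (F (coord w Iz)) with (f (proj w1)) by now rewrite EF.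
  eapply Rle_trans; [apply Hb|]. unfold B. apply Rmult_le_compat_l; [lra|].
  (* Compactness of the base: along the zero section the metric is the flat one, so a segment from
     the square to the origin has length at most 4, uniformly in [z]. *)
  assert (Hd : dist (calabi_metric k u) (proj w1) (proj w0) <= 4 + D).
  { pose proof (path_app _ _ _ _ _ _ (path_segment (calabi_metric k u) w1 o) (path_segment _ o w0)) as P.
    apply (dist_le_path _ _ _ _ Hg) in P. fold D in P.
    assert (curve_length (calabi_metric k u) (segment w1 o) <= 4); [|lra].
    destruct (segment_curve w1 o) as [S1 S2].
    apply (curve_length_le _ _ (fun _ => 4)); auto.
    - apply is_RInt_const_unit.
    - intros s _. rewrite S2. unfold gnorm. rewrite Re_hform_calabi by auto.
      assert (Eh : forall u1, horizontal_coef k u1 (segment w1 o s) = 1).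
      { intros u1. unfold horizontal_coef. rewrite !Cmod_sqr.
        unfold segment, disp, w1, o, fib1, fib2, Re, Im. destruct (coord w Iz) as [x y]. simpl. field. lra. }
      rewrite Eh.
      assert (Er : radial k (segment w1 o s) (disp w1 o) = RtoC 0).
      { unfold radial, vert1, vert2, segment, disp, w1, o, fib1, fib2, Re, Im. destruct (coord w Iz) as [x y]. simpl.
        apply injective_projections; simpl; field; lra. }
      assert (Ev : vert_norm2 k (segment w1 o s) (disp w1 o) = 0).
      { unfold vert_norm2. rewrite !Cmod_sqr.
        unfold vert1, vert2, segment, disp, w1, o, fib1, fib2, Re, Im. destruct (coord w Iz) as [x y]. simpl.
        field; lra. }
      rewrite Er, Ev, Cmod_0, pow_i, !Rmult_0_r, !Rplus_0_r, Rmult_1_l by lia. rewrite <- (sqrt_Rsqr 4) by lra. apply sqrt_le_1_alt.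
      rewrite Cmod_sqr. unfold disp, w1, o, Rsqr. unfold Re, Im in *. simpl in *.
      apply Rabs_le_between in B1. apply Rabs_le_between in B2. nra. }
  pose proof (dist_nonneg (calabi_metric k u) (proj w1) (proj w0) Hg).
  assert (Hle : C2 * Rpower (dist (calabi_metric k u) (proj w1) (proj w0) + 1) rho <= C2 * Rpower (4 + D + 1) rho).
  { apply Rmult_le_compat_l; [lra|]. apply Rle_Rpower_l; lra. }
  destruct Hle as [Hle|Hle]; [left; now apply exp_increasing|right; now rewrite Hle]. }
intros q q'. destruct (proj_surjective q) as [w ->]. destruct (proj_surjective q') as [w' ->].
rewrite !EF. apply liouville; [apply holomorphic_line; auto|].
intros eps Heps. exists (B / eps). intros z Hz. eapply Rle_trans; [apply HB|].
apply Rmult_le_compat_l with (r := eps) in Hz; [|lra].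
now replace (eps * (B / eps)) with B in Hz by (field; lra).
Qed.

Lemma hadamard_order_ge2 (k : R) (g : metric) (p : X) :
  0 < k -> kahler g -> calabi_type k g -> Rbar_le (Finite 2) (d_Hmin g p).
Proof.
intros Hk Hg Hc. destruct (calabi_type_potential k g Hc) as (u & Hu & ->).
unfold d_Hmin. destruct (Rbar_ex_glb (fun d => exists f : X -> C,
    holomorphic f /\ (exists q q' : X, f q <> f q') /\ d = hadamard_order (calabi_metric k u) p f)) as [l Hl].
rewrite (Rbar_is_glb_unique _ _ Hl). apply Hl.
intros d (f & Hf & (q & q' & Hq) & ->). unfold hadamard_order.
apply Glb_Rbar_correct. intros rho (Hrho & C1 & C2 & HC1 & HC2 & Hb). simpl.
apply Rnot_lt_le. intros Hlt. apply Hq.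
apply (low_order_constant k u f p rho C1 C2); auto.
Qed.

(** * A complete metric of Hadamard order two *)

(** Polynomials in [1/(1+t)], [1/(1+ln(1+t))] and [1/(1+ln(1+ln(1+t)))]: an
    algebra closed under differentiation. *)
Inductive logpoly : Type :=
| LCst (r : R)
| LVar0
| LVar1
| LVar2
| LAdd (E F : logpoly)
| LMul (E F : logpoly).

Definition inv0 (t : R) : R := / (1 + t).
Definition inv1 (t : R) : R := / (1 + ln (1 + t)).
Definition inv2 (t : R) : R := / (1 + ln (1 + ln (1 + t))).

Fixpoint leval (E : logpoly) (t : R) : R :=
  match E with
  | LCst r => r
  | LVar0 => inv0 t
  | LVar1 => inv1 t
  | LVar2 => inv2 t
  | LAdd E F => leval E t + leval F t
  | LMul E F => leval E t * leval F t
  end.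

Fixpoint lderiv (E : logpoly) : logpoly :=
  match E with
  | LCst _ => LCst 0
  | LVar0 => LMul (LCst (-1)) (LMul LVar0 LVar0)
  | LVar1 => LMul (LCst (-1)) (LMul (LMul LVar1 LVar1) LVar0)
  | LVar2 => LMul (LCst (-1)) (LMul (LMul LVar2 LVar2) (LMul LVar1 LVar0))
  | LAdd E F => LAdd (lderiv E) (lderiv F)
  | LMul E F => LAdd (LMul (lderiv E) F) (LMul E (lderiv F))
  end.

Lemma ln_ge_1_minus_inv (x : R) : 0 < x -> 1 - / x <= ln x.
Proof.
intros Hx. pose proof (exp_ineq1_le (ln (/ x))) as H.
rewrite exp_ln in H by now apply Rinv_0_lt_compat. rewrite ln_Rinv in H by auto. lra.
Qed.

(** From [t > -1/10], two uses of ln x >= 1 - 1/x give logarithms above -1/9 and -1/8, so all three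
    denominators stay positive on a neighbourhood of the half line. *)
Lemma log_domain (t : R) :
  - (1 / 10) < t -> 0 < 1 + t /\ 0 < 1 + ln (1 + t) /\ 0 < 1 + ln (1 + ln (1 + t)).
Proof.
intros Ht. split; [lra|].
pose proof (ln_ge_1_minus_inv (1 + t) ltac:(lra)) as H1.
assert (I1 : / (1 + t) < 10 / 9).
{ replace (10 / 9) with (/ (9 / 10)) by field. apply Rinv_lt_contravar; lra. }
pose proof (ln_ge_1_minus_inv (1 + ln (1 + t)) ltac:(lra)) as H2.
assert (I2 : / (1 + ln (1 + t)) < 9 / 8).
{ replace (9 / 8) with (/ (8 / 9)) by field. apply Rinv_lt_contravar; lra. }
lra.
Qed.

Lemma is_derive_leval (E : logpoly) (t : R) :
  - (1 / 10) < t -> is_derive (leval E) t (leval (lderiv E) t).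
Proof.
intros Ht. destruct (log_domain t Ht) as (D0 & D1 & D2).
induction E as [r| | | |E IHE F IHF|E IHE F IHF]; simpl.
- apply (is_derive_const (K := R_AbsRing) (V := R_NormedModule) r).
- unfold inv0. auto_derive; [lra|]. field. lra.
- unfold inv1, inv0. auto_derive; [repeat split; lra|]. field. lra.
- unfold inv2, inv1, inv0. auto_derive; [repeat split; lra|]. field. lra.
- now apply (is_derive_plus (V := R_NormedModule) (leval E) (leval F)).
- apply (is_derive_mult (leval E) (leval F)); auto. intros; apply Rmult_comm.
Qed.

Lemma continuous_leval (E : logpoly) (t : R) : - (1 / 10) < t -> continuous (leval E) t.
Proof.
intros Ht. apply (ex_derive_continuous (V := R_NormedModule)).
eexists. now apply is_derive_leval.
Qed.

(** The moment becomes [4 * k * (1 - inv0) * (1 - inv2 / 2)], whose gap to [4 * k] is asymptotic to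
    [2 * k * inv2]. Since [inv2 0 = 1], the coefficient 1/2 keeps u'(0) positive. *)
Definition slope (k : R) : logpoly :=
  LMul (LCst (4 * k)) (LMul LVar0 (LAdd (LCst 1) (LMul (LCst (- / 2)) LVar2))).

(** [t u'(t)] tends to [4 k] so slowly that the metric is complete. *)
Definition potential (k : R) (t : R) : R := RInt (leval (slope k)) 0 t.

Lemma locally_domain (t : R) : - (1 / 10) < t -> locally t (fun y => - (1 / 10) < y).
Proof. apply (open_gt (- (1 / 10))). Qed.

Lemma is_derive_potential (k t : R) :
  - (1 / 10) < t -> is_derive (potential k) t (leval (slope k) t).
Proof.
intros Ht. apply (is_derive_RInt (V := R_NormedModule) (leval (slope k)) (potential k) 0).
- apply filter_imp with (2 := locally_domain t Ht). intros y Hy.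
  apply (RInt_correct (V := R_CompleteNormedModule)).
  apply (ex_RInt_continuous (V := R_CompleteNormedModule)). intros z Hz.
  apply continuous_leval. unfold Rmin in Hz. destruct (Rle_dec 0 y); lra.
- now apply continuous_leval.
Qed.

Fixpoint lderiv_n (n : nat) (E : logpoly) : logpoly :=
  match n with O => E | S n => lderiv (lderiv_n n E) end.

Lemma Derive_n_potential (k : R) (n : nat) (t : R) :
  - (1 / 10) < t -> Derive_n (potential k) (S n) t = leval (lderiv_n n (slope k)) t.
Proof.
revert t. induction n as [|n IH]; intros t Ht.
- apply is_derive_unique, is_derive_potential, Ht.
- change (Derive_n (potential k) (S (S n)) t) with (Derive (Derive_n (potential k) (S n)) t).
  rewrite (Derive_ext_loc _ (leval (lderiv_n n (slope k)))).
  + now apply is_derive_unique, is_derive_leval.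
  + apply filter_imp with (2 := locally_domain t Ht). exact IH.
Qed.

Lemma potential_smooth (k : R) : smooth_half_line (potential k).
Proof.
exists (1 / 10). split; [lra|]. intros [|[|n]] t Ht.
- exact I.
- exists (leval (slope k) t). now apply is_derive_potential.
- exists (leval (lderiv (lderiv_n n (slope k))) t).
  apply is_derive_ext_loc with (leval (lderiv_n n (slope k))).
  + apply filter_imp with (2 := locally_domain t Ht). intros y Hy. symmetry. now apply Derive_n_potential.
  + now apply is_derive_leval.
Qed.

Lemma inv_bounds (t : R) :
  0 <= t -> 0 < inv0 t <= 1 /\ 0 < inv1 t <= 1 /\ 0 < inv2 t <= 1.
Proof.
intros Ht.
assert (H : forall x, 1 <= x -> 0 < / x <= 1).
{ intros x Hx. split; [apply Rinv_0_lt_compat; lra|].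
  pose proof (Rinv_le_contravar 1 x ltac:(lra) Hx) as I. now rewrite Rinv_1 in I. }
assert (L : forall x, 1 <= x -> 0 <= ln x).
{ intros x Hx. rewrite <- ln_1. apply ln_le; lra. }
pose proof (L (1 + t) ltac:(lra)) as L1.
pose proof (L (1 + ln (1 + t)) ltac:(lra)) as L2.
split; [|split]; apply H; lra.
Qed.

(** The identity [1 - t * inv0 t = inv0 t] exhibits the derivative of the moment as a sum of two
    nonnegative terms. The second decays more slowly and governs distances. *)
Lemma potential_derivatives (k t : R) :
  0 <= t ->
  Derive_n (potential k) 1 t = 4 * k * (inv0 t * (1 - inv2 t / 2)) /\
  Derive_n (potential k) 1 t + t * Derive_n (potential k) 2 t =
    4 * k * (inv0 t ^ 2 * (1 - inv2 t / 2) + t * inv0 t ^ 2 * inv2 t ^ 2 * inv1 t / 2).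
Proof.
intros Ht.
assert (E : 1 - t * inv0 t = inv0 t) by (unfold inv0; field; lra).
rewrite !Derive_n_potential by lra. simpl. split; [field|].
transitivity (4 * k * (inv0 t * (1 - inv2 t / 2) * (1 - t * inv0 t)
   + t * inv0 t ^ 2 * inv2 t ^ 2 * inv1 t / 2)); [field|].
rewrite E. field.
Qed.

Lemma potential_admissible (k : R) : 0 < k -> admissible k (potential k).
Proof.
intros Hk t Ht. destruct (potential_derivatives k t Ht) as [E1 E2]. rewrite E2, E1.
destruct (inv_bounds t Ht) as (B0 & B1 & B2).
assert (0 < inv0 t * (1 - inv2 t / 2)) by (apply Rmult_lt_0_compat; lra).
split; [|split].
- apply Rmult_lt_0_compat; lra.
- apply Rmult_lt_0_compat; [lra|]. apply Rplus_lt_le_0_compat.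
  + apply Rmult_lt_0_compat; [apply pow_lt|]; lra.
  + apply Rmult_le_pos; [|lra]. repeat apply Rmult_le_pos; try apply pow2_ge_0; lra.
- assert (E : t * inv0 t = 1 - inv0 t) by (unfold inv0; field; lra).
  replace (t * (4 * k * (inv0 t * (1 - inv2 t / 2)))) with
    (4 * k * ((t * inv0 t) * (1 - inv2 t / 2))) by ring.
  rewrite E. nra.
Qed.

Lemma potential_kahler (k : R) : 0 < k -> kahler (calabi_metric k (potential k)).
Proof.
intros Hk. apply calabi_metric_kahler; auto; [apply potential_smooth|now apply potential_admissible].
Qed.

(** The radial length element is [sqrt (moment_deriv / (2 t)) dt], asymptotic to
    [sqrt k * inv0 * sqrt inv1 * inv2 dt]. This function has the same leading derivative and serves
    as an explicit substitute for the primitive. *)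
Definition exhaustion (k t : R) : R := 2 * sqrt k * sqrt (1 + ln (1 + t)) * inv2 t.

Definition exhaustion_deriv (k t : R) : R :=
  2 * sqrt k * (inv0 t * sqrt (inv1 t) * (inv2 t / 2 - inv2 t ^ 2)).

Lemma is_derive_exhaustion (k t : R) :
  0 <= t -> is_derive (exhaustion k) t (exhaustion_deriv k t).
Proof.
intros Ht. destruct (log_domain t ltac:(lra)) as (D0 & D1 & D2).
unfold exhaustion, exhaustion_deriv, inv2, inv1, inv0.
rewrite sqrt_inv.
pose proof (sqrt_lt_R0 _ D1) as Hs. pose proof (sqrt_sqrt _ (Rlt_le _ _ D1)) as Hss.
auto_derive; [repeat split; lra|].
set (s := sqrt (1 + ln (1 + t))) in *. rewrite <- Hss. set (l := ln (s * s)).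
assert (0 < 1 + l) by (unfold l; rewrite Hss; lra).
field. repeat split; lra.
Qed.

Lemma continuous_exhaustion_deriv (k t : R) : 0 <= t -> continuous (exhaustion_deriv k) t.
Proof.
intros Ht.
assert (C0 : continuous inv0 t) by (apply (continuous_leval LVar0); lra).
assert (C1 : continuous inv1 t) by (apply (continuous_leval LVar1); lra).
assert (C2 : continuous (fun t => inv2 t / 2 - inv2 t ^ 2) t).
{ apply continuous_ext with (leval (LAdd (LMul LVar2 (LCst (/ 2))) (LMul (LCst (-1)) (LMul LVar2 LVar2)))).
  - intros s. simpl. field.
  - apply continuous_leval. lra. }
unfold exhaustion_deriv.
apply (continuous_scal_r (V := R_NormedModule) (2 * sqrt k)
  (fun t => inv0 t * sqrt (inv1 t) * (inv2 t / 2 - inv2 t ^ 2))).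
apply (continuous_mult (K := R_AbsRing) (fun t => inv0 t * sqrt (inv1 t))); auto.
apply (continuous_mult (K := R_AbsRing) inv0); auto.
now apply continuous_sqrt_comp.
Qed.

Lemma exhaustion_deriv_sqr_le (k t : R) :
  0 < k -> 0 <= t -> exhaustion_deriv k t ^ 2 <= k * inv0 t ^ 2 * inv1 t * inv2 t ^ 2.
Proof.
intros Hk Ht. destruct (inv_bounds t Ht) as (B0 & B1 & B2). unfold exhaustion_deriv.
replace ((2 * sqrt k * (inv0 t * sqrt (inv1 t) * (inv2 t / 2 - inv2 t ^ 2))) ^ 2) with
  (4 * (sqrt k * sqrt k) * (sqrt (inv1 t) * sqrt (inv1 t)) * (inv0 t ^ 2 * inv2 t ^ 2) * (/ 2 - inv2 t) ^ 2) by field.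
rewrite !sqrt_sqrt by lra.
assert (0 <= inv0 t ^ 2 * inv2 t ^ 2) by (apply Rmult_le_pos; apply pow2_ge_0).
assert (0 <= k * inv1 t * (inv0 t ^ 2 * inv2 t ^ 2)).
{ apply Rmult_le_pos; auto. apply Rmult_le_pos; lra. }
assert ((/ 2 - inv2 t) ^ 2 <= / 4) by nra.
replace (4 * k * inv1 t * (inv0 t ^ 2 * inv2 t ^ 2) * (/ 2 - inv2 t) ^ 2) with
  (4 * (k * inv1 t * (inv0 t ^ 2 * inv2 t ^ 2)) * (/ 2 - inv2 t) ^ 2) by ring.
nra.
Qed.

(** The differential of t is [2 * Re (radial k w xi)], so this is a gradient bound for the
    exhaustion. By [fiber_form_ge] only the radial part of [xi] matters. *)
Lemma exhaustion_gnorm (k : R) (w xi : C3) :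
  0 < k ->
  Rabs (exhaustion_deriv k (fiber_norm2 k w) * (2 * Re (radial k w xi))) <=
  gnorm (calabi_metric k (potential k)) w xi.
Proof.
intros Hk. unfold gnorm. rewrite Re_hform_calabi by (auto using potential_smooth).
pose proof (potential_admissible k Hk) as Hadm.
pose proof (fiber_norm2_nonneg k w Hk) as Ht.
pose proof (radial_cauchy_schwarz k w xi Hk) as HR.
pose proof (vert_norm2_nonneg k w xi Hk) as HN.
destruct (fiber_form_nonneg k (potential k) w xi Hk Hadm) as [HF _].
pose proof (exhaustion_deriv_sqr_le k _ Hk Ht) as HP.
pose proof (potential_derivatives k _ Ht) as [_ E2].
destruct (inv_bounds _ Ht) as (B0 & B1 & B2).
destruct (Hadm _ Ht) as (H1 & _ & H3).
pose proof (horizontal_coef_pos k _ w Hk (Rlt_le _ _ H1) H3) as Hh.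
pose proof (pow2_ge_0 (Cmod (coord xi Iz))) as Hz.
pose proof (Rmult_le_pos _ _ (Rlt_le _ _ Hh) Hz) as Hhz.
pose proof (pow2_ge_0 (Cmod (radial k w xi))) as HR0.
assert (HRe : Re (radial k w xi) ^ 2 <= Cmod (radial k w xi) ^ 2).
{ rewrite Cmod_sqr. pose proof (pow2_ge_0 (Im (radial k w xi))). lra. }
rewrite <- sqrt_Rsqr_abs. apply sqrt_le_1_alt. unfold Rsqr.
set (a := exhaustion_deriv k (fiber_norm2 k w)) in *.
set (t := fiber_norm2 k w) in *. set (N := vert_norm2 k w xi) in *.
set (Rd := Cmod (radial k w xi) ^ 2) in *. set (re := Re (radial k w xi)) in *.
set (HH := horizontal_coef k _ w * _) in *.
clearbody Rd N re a HH.
set (u1 := Derive_n (potential k) 1 t) in *. set (u2 := Derive_n (potential k) 2 t) in *.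
pose proof (fiber_form_ge u1 u2 t N Rd Ht (conj HR0 HR) (Rlt_le _ _ H1)) as HG.
assert (HS : a ^ 2 * (2 * re ^ 2) <= u1 * N + u2 * Rd).
{ assert (t = 0 \/ 0 < t) as [E|Hp] by lra.
  - assert (Rd = 0) by (rewrite E in HR; lra).
    assert (re ^ 2 = 0) as -> by (pose proof (pow2_ge_0 re); lra). lra.
  - apply Rmult_le_reg_l with t; auto. eapply Rle_trans; [|exact HG]. rewrite E2.
    set (c := inv0 t ^ 2 * inv1 t * inv2 t ^ 2).
    assert (Hc : 0 <= c).
    { unfold c. apply Rmult_le_pos; [apply Rmult_le_pos|]; try apply pow2_ge_0; lra. }
    replace (k * inv0 t ^ 2 * inv1 t * inv2 t ^ 2) with (k * c) in HP by (unfold c; ring).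
    (* The summand [2 * (t * (k * c))] alone matches the bound on [a ^ 2]; the other is nonnegative
       and is dropped. *)
    replace (4 * k * (inv0 t ^ 2 * (1 - inv2 t / 2) + t * inv0 t ^ 2 * inv2 t ^ 2 * inv1 t / 2)) with
      (4 * k * (inv0 t ^ 2 * (1 - inv2 t / 2)) + 2 * (t * (k * c))) by (unfold c; field).
    assert (0 <= 4 * k * (inv0 t ^ 2 * (1 - inv2 t / 2)) * Rd).
    { repeat apply Rmult_le_pos; try apply pow2_ge_0; lra. }
    assert (a ^ 2 * re ^ 2 <= k * c * Rd).
    { apply Rmult_le_compat; auto; apply pow2_ge_0. }
    assert (t * (a ^ 2 * re ^ 2) <= t * (k * c * Rd)) by (apply Rmult_le_compat_l; lra).
    lra. }
replace (a * (2 * re) * (a * (2 * re))) with (2 * (a ^ 2 * (2 * re ^ 2))) by ring. lra.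
Qed.

Ltac solve_continuous :=
  repeat match goal with
  | H : continuous ?f ?s |- continuous ?f ?s => exact H
  | |- continuous (fun s => @?a s + @?b s) _ => apply (continuous_plus (V := R_NormedModule) a b)
  | |- continuous (fun s => @?a s - @?b s) _ => apply (continuous_minus (V := R_NormedModule) a b)
  | |- continuous (fun s => @?a s * @?b s) _ => apply (continuous_mult (K := R_AbsRing) a b)
  | |- continuous (fun s => ?c) _ => apply continuous_const
  end.

Lemma norm_along_curve (k : R) (y p q a b : R -> R) (s : R) :
  ex_derive y s -> ex_derive p s -> ex_derive q s -> ex_derive a s -> ex_derive b s ->
  is_derive (fun s => (p s - y s * a s) ^ 2 + (q s - y s * b s) ^ 2 + k * (a s ^ 2 + b s ^ 2)) s
    (2 * ((p s - y s * a s) * (Derive p s - (Derive y s * a s + y s * Derive a s))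
        + (q s - y s * b s) * (Derive q s - (Derive y s * b s + y s * Derive b s))
        + k * (a s * Derive a s + b s * Derive b s))).
Proof. intros. auto_derive; [tauto|]. 
  change (fun x => y x) with y. change (fun x => p x) with p. change (fun x => q x) with q.
  change (fun x => a x) with a. change (fun x => b x) with b. ring. Qed.

Lemma is_derive_norm_curve (k : R) (c : R -> C3) (s : R) :
  0 < k -> C1_curve c -> 0 <= s <= 1 ->
  is_derive (fun s => fiber_norm2 k (c s)) s (2 * Re (radial k (c s) (velocity c s))) /\
  continuous (fun s => 2 * Re (radial k (c s) (velocity c s))) s.
Proof.
intros Hk Hc Hs.
set (y := fun s => Im (coord (c s) Iz)). set (p := fun s => Re (coord (c s) Iv1)).
set (q := fun s => Im (coord (c s) Iv1)). set (a := fun s => Re (coord (c s) Iv2)).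
set (b := fun s => Im (coord (c s) Iv2)).
destruct (Hc Iz s Hs) as (_ & Dy & _ & Cy).
destruct (Hc Iv1 s Hs) as (Dp & Dq & Cp & Cq).
destruct (Hc Iv2 s Hs) as (Da & Db & Ca & Cb).
fold y in Dy, Cy. fold p in Dp, Cp. fold q in Dq, Cq. fold a in Da, Ca. fold b in Db, Cb.
assert (E : forall s, 2 * Re (radial k (c s) (velocity c s)) =
   2 * ((p s - y s * a s) * (Derive p s - (Derive y s * a s + y s * Derive a s))
        + (q s - y s * b s) * (Derive q s - (Derive y s * b s + y s * Derive b s))
        + k * (a s * Derive a s + b s * Derive b s))).
{ clear - Hk. intros s. unfold y, p, q, a, b, radial, vert1, vert2, fib1, fib2, velocity.
  generalize (Derive (fun r => Re (coord (c r) Iz)) s) (Derive (fun r => Im (coord (c r) Iz)) s)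
    (Derive (fun r => Re (coord (c r) Iv1)) s) (Derive (fun r => Im (coord (c r) Iv1)) s)
    (Derive (fun r => Re (coord (c r) Iv2)) s) (Derive (fun r => Im (coord (c r) Iv2)) s).
  destruct (c s) as [[[? ?] [? ?]] [? ?]]. intros. unfold Re, Im. simpl. field. lra. }
split.
- rewrite E. apply is_derive_ext with (fun s => (p s - y s * a s) ^ 2 + (q s - y s * b s) ^ 2 + k * (a s ^ 2 + b s ^ 2)).
  + intros r. symmetry. apply fiber_norm2_coords.
  + now apply norm_along_curve.
- eapply continuous_ext; [intros r; symmetry; apply E|].
  assert (Ky : continuous y s) by now apply (ex_derive_continuous (V := R_NormedModule)).
  assert (Kp : continuous p s) by now apply (ex_derive_continuous (V := R_NormedModule)).
  assert (Kq : continuous q s) by now apply (ex_derive_continuous (V := R_NormedModule)).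
  assert (Ka : continuous a s) by now apply (ex_derive_continuous (V := R_NormedModule)).
  assert (Kb : continuous b s) by now apply (ex_derive_continuous (V := R_NormedModule)).
  clearbody y p q a b. solve_continuous.
Qed.

Lemma exhaustion_curve (k : R) (c : R -> C3) :
  0 < k -> C1_curve c ->
  Rabs (exhaustion k (fiber_norm2 k (c 0)) - exhaustion k (fiber_norm2 k (c 1))) <=
  curve_length (calabi_metric k (potential k)) c.
Proof.
intros Hk Hc.
set (h := fun s => exhaustion k (fiber_norm2 k (c s))).
set (dh := fun s => exhaustion_deriv k (fiber_norm2 k (c s)) * (2 * Re (radial k (c s) (velocity c s)))).
assert (I : is_RInt dh 0 1 (minus (h 1) (h 0))).
{ apply (is_RInt_derive (V := R_CompleteNormedModule));
    intros s Hs; rewrite Rmin_left, Rmax_right in Hs by lra;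
    destruct (is_derive_norm_curve k c s Hk Hc Hs) as [D1 D2];
    pose proof (fiber_norm2_nonneg k (c s) Hk) as Ht.
  - unfold h, dh. rewrite Rmult_comm.
    apply (is_derive_comp (V := R_NormedModule) (exhaustion k) (fun s => fiber_norm2 k (c s))); auto.
    now apply is_derive_exhaustion.
  - unfold dh.
    apply (continuous_mult (K := R_AbsRing) (fun s => exhaustion_deriv k (fiber_norm2 k (c s)))); auto.
    apply (continuous_comp (fun s => fiber_norm2 k (c s)) (exhaustion_deriv k)).
    + apply (ex_derive_continuous (V := R_NormedModule)). eexists. exact D1.
    + now apply continuous_exhaustion_deriv. }
pose proof (ex_RInt_curve (calabi_metric k (potential k)) c (potential_kahler k Hk) Hc) as IG.
pose proof (norm_RInt_le (V := R_NormedModule) dh _ 0 1 _ _ ltac:(lra)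
  (fun s _ => exhaustion_gnorm k (c s) (velocity c s) Hk) I (RInt_correct (V := R_CompleteNormedModule) _ _ _ IG)) as H.
rewrite Rabs_minus_sym. exact H.
Qed.

Lemma exhaustion_lipschitz (k : R) (w w' : C3) :
  0 < k ->
  Rabs (exhaustion k (fiber_norm2 k w) - exhaustion k (fiber_norm2 k w')) <=
  dist (calabi_metric k (potential k)) (proj w) (proj w').
Proof.
intros Hk. apply (dist_lipschitz _ (fun w => exhaustion k (fiber_norm2 k w))).
- now apply potential_kahler.
- intros v v' H. f_equal. revert v v' H. apply orbit_invariant; intros v; apply fiber_norm2_deck.
- intros c Hc. now apply exhaustion_curve.
Qed.

(* [sqrt Y / (1 + ln Y)] dominates [Y^(1/rho)] because [1 + ln Y <= Y^e / e]. *)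
Lemma exhaustion_growth (k rho : R) :
  0 < k -> 2 < rho -> exists c, 0 < c /\ forall t, 0 <= t ->
    0 < exhaustion k t /\ 1 + ln (1 + t) <= Rpower (c * exhaustion k t) rho.
Proof.
intros Hk Hrho. pose proof (sqrt_lt_R0 k Hk) as Hsk.
(* [sqrt Y] is Y^(1/rho) times Y^e, and [rho > 2] is exactly what makes [e] positive. *)
set (e := / 2 - / rho).
assert (He : 0 < e < 1).
{ unfold e. pose proof (Rinv_lt_contravar 2 rho ltac:(lra) Hrho).
  pose proof (Rinv_0_lt_compat rho ltac:(lra)). lra. }
exists (/ (2 * e * sqrt k)). split.
{ apply Rinv_0_lt_compat. apply Rmult_lt_0_compat; lra. }
intros t Ht. destruct (inv_bounds t Ht) as (_ & _ & B2).
unfold exhaustion.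
assert (HL : 0 <= ln (1 + t)) by (rewrite <- ln_1; apply ln_le; lra).
unfold inv2 in *. set (Y := 1 + ln (1 + t)) in *.
assert (HY : 1 <= Y) by (unfold Y; lra).
assert (HsY : 0 < sqrt Y) by (apply sqrt_lt_R0; lra).
assert (Hpos : 0 < 2 * sqrt k * sqrt Y * / (1 + ln Y)).
{ apply Rmult_lt_0_compat; [|lra]. apply Rmult_lt_0_compat; lra. }
split; auto.
assert (HlY : 0 <= ln Y) by (rewrite <- ln_1; apply ln_le; lra).
assert (Hlog : (1 + ln Y) * e <= Rpower Y e).
{ unfold Rpower. pose proof (exp_ineq1_le (e * ln Y)). nra. }
assert (HYe : 0 < Rpower Y e) by apply exp_pos.
assert (Hbase : Rpower Y (/ rho) <= / (2 * e * sqrt k) * (2 * sqrt k * sqrt Y * / (1 + ln Y))).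
{ replace (/ (2 * e * sqrt k) * (2 * sqrt k * sqrt Y * / (1 + ln Y))) with (sqrt Y / ((1 + ln Y) * e)) by (field; lra).
  assert (E : sqrt Y = Rpower Y (/ rho) * Rpower Y e).
  { rewrite <- Rpower_plus. unfold e. replace (/ rho + (/ 2 - / rho)) with (/ 2) by ring.
    symmetry. apply Rpower_sqrt. lra. }
  apply Rmult_le_reg_r with ((1 + ln Y) * e); [apply Rmult_lt_0_compat; lra|].
  replace (sqrt Y / ((1 + ln Y) * e) * ((1 + ln Y) * e)) with (sqrt Y) by (field; lra).
  rewrite E. apply Rmult_le_compat_l; auto. left. apply exp_pos. }
replace Y with (Rpower (Rpower Y (/ rho)) rho) at 1.
- apply Rle_Rpower_l; [lra|]. split; auto. apply exp_pos.
- rewrite Rpower_mult, Rinv_l by lra. apply Rpower_1. lra.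
Qed.

(** * Compactness and completeness *)

Lemma bounded_subsequence (x : nat -> R) (B : R) :
  (forall n, Rabs (x n) <= B) ->
  exists (s : nat -> nat) (l : R), (forall n, (n <= s n)%nat) /\ is_lim_seq (fun n => x (s n)) l.
Proof.
intros Hx.
destruct (Bolzano_Weierstrass x (fun c => - B <= c <= B) (compact_P3 (- B) B)) as [l Hl].
{ intros n. now apply Rabs_le_between. }
assert (Hs : forall n, exists m, (n <= m)%nat /\ Rabs (x m - l) < / INR (S n)).
{ intros n. assert (Hp : 0 < / INR (S n)) by (apply Rinv_0_lt_compat, lt_0_INR; lia).
  destruct (Hl (disc l (mkposreal _ Hp)) n) as (m & Hm & Hd).
  - exists (mkposreal _ Hp). now intros y Hy.
  - exists m. split; auto. }
set (s := fun n => proj1_sig (constructive_indefinite_description _ (Hs n))).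
assert (Hs' : forall n, (n <= s n)%nat /\ Rabs (x (s n) - l) < / INR (S n)).
{ intros n. unfold s. apply (proj2_sig (constructive_indefinite_description _ (Hs n))). }
exists s, l. split; [intros n; apply Hs'|].
apply is_lim_seq_spec. intros eps.
destruct (archimed_cor1 eps (cond_pos eps)) as (N & HN & HN0).
exists N. intros n Hn. eapply Rlt_trans; [apply Hs'|].
eapply Rle_lt_trans; [|exact HN].
apply Rinv_le_contravar; [now apply lt_0_INR|]. apply le_INR. lia.
Qed.

(** The condition [n <= s n] replaces strict monotonicity: it is stable under composition and
    preserves limits. *)
Lemma common_subsequence (x : nat -> nat -> R) (B : R) (m : nat) :
  (forall i n, Rabs (x i n) <= B) ->
  exists s : nat -> nat, (forall n, (n <= s n)%nat) /\
    forall i, (i < m)%nat -> exists l : R, is_lim_seq (fun n => x i (s n)) l.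
Proof.
intros Hx. induction m as [|m (s & Hs & IH)].
- exists (fun n => n). split; auto. intros i Hi. lia.
- destruct (bounded_subsequence (fun n => x m (s n)) B) as (r & l & Hr & Hl); [auto|].
  exists (fun n => s (r n)). split.
  + intros n. specialize (Hs (r n)). specialize (Hr n). lia.
  + intros i Hi. assert (i = m \/ (i < m)%nat) as [->|Hi'] by lia; [now exists l|].
    destruct (IH i Hi') as [l' Hl']. exists l'.
    apply (is_lim_seq_subseq (fun n => x i (s n)) l' r); auto.
    intros P [N HN]. exists N. intros n Hn. apply HN. specialize (Hr n). lia.
Qed.

Lemma hform_bound (g : metric) (w xi : C3) (G d : R) :
  0 <= d -> (forall a b, Cmod (g w a b) <= G) -> (forall a, Cmod (coord xi a) <= d) ->
  Re (hform g w xi xi) <= 9 * (G * d ^ 2).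
Proof.
intros Hd HG Hx.
assert (T : forall a b, Cmod (g w a b * coord xi a * Cconj (coord xi b))%C <= G * d ^ 2).
{ intros a b. rewrite !Cmod_mult, Cmod_conj.
  replace (G * d ^ 2) with (G * d * d) by ring.
  pose proof (Cmod_ge_0 (g w a b)). pose proof (Cmod_ge_0 (coord xi a)). pose proof (Cmod_ge_0 (coord xi b)).
  apply Rmult_le_compat; auto. apply Rmult_le_pos; auto. apply Rmult_le_compat; auto. }
assert (S : forall F K, (forall a, Cmod (F a) <= K) -> Cmod (sum3 F) <= 3 * K).
{ intros F K HF. unfold sum3. eapply Rle_trans; [apply Cmod_triangle|].
  pose proof (Cmod_triangle (F Iz) (F Iv1)). pose proof (HF Iz). pose proof (HF Iv1). pose proof (HF Iv2). lra. }
assert (H : Cmod (hform g w xi xi) <= 3 * (3 * (G * d ^ 2))).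
{ unfold hform. apply S. intros a. apply S. intros b. apply T. }
pose proof (Rmax_Cmod (hform g w xi xi)) as HM.
pose proof (Rmax_l (Rabs (fst (hform g w xi xi))) (Rabs (snd (hform g w xi xi)))).
pose proof (Rle_abs (fst (hform g w xi xi))). unfold Re. lra.
Qed.

Definition near (d : R) (w w' : C3) : Prop :=
  forall a, Rabs (Re (coord w' a) - Re (coord w a)) < d /\ Rabs (Im (coord w' a) - Im (coord w a)) < d.

Lemma near_ball (d : R) (w w' : C3) :
  near d w w' -> ball (M := prod_UniformSpace (prod_UniformSpace C_UniformSpace C_UniformSpace) C_UniformSpace) w d w'.
Proof. intros H. split; [split|]; [apply (H Iz)|apply (H Iv1)|apply (H Iv2)]. Qed.

Lemma metric_locally_bounded (g : metric) (w : C3) :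
  kahler g -> exists d G : R, 0 < d /\ 0 < G /\
    forall w', near d w w' -> forall a b, Cmod (g w' a b) <= G.
Proof.
intros Hg.
assert (P : forall a b, exists d, 0 < d /\ forall w', near d w w' -> Cmod (g w' a b) <= Cmod (g w a b) + 2).
{ intros a b. destruct (kahler_smooth g Hg a b nil w) as [H _]. simpl in H.
  destruct (proj1 (filterlim_locally _ _) H (mkposreal 1 Rlt_0_1)) as [d Hd].
  exists d. split; [apply cond_pos|]. intros w' Hw'. destruct (Hd w' (near_ball d w w' Hw')) as [B1 B2].
  change (Rabs (fst (g w' a b) - fst (g w a b)) < 1) in B1.
  change (Rabs (snd (g w' a b) - snd (g w a b)) < 1) in B2.
  replace (g w' a b) with (g w a b + (g w' a b - g w a b))%C by ring.
  eapply Rle_trans; [apply Cmod_triangle|]. apply Rplus_le_compat_l.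
  eapply Rle_trans; [apply Cmod_2Rmax|].
  assert (Hm : Rmax (Rabs (fst (g w' a b - g w a b)%C)) (Rabs (snd (g w' a b - g w a b)%C)) <= 1).
  { apply Rmax_lub; left; assumption. }
  assert (sqrt 2 <= 2).
  { rewrite <- (sqrt_Rsqr 2) at 2 by lra. apply sqrt_le_1_alt. unfold Rsqr. lra. }
  pose proof (sqrt_pos 2). pose proof (Rabs_pos (fst (g w' a b - g w a b)%C)).
  pose proof (Rmax_l (Rabs (fst (g w' a b - g w a b)%C)) (Rabs (snd (g w' a b - g w a b)%C))). nra. }
assert (Q : forall a, exists d G : R, 0 < d /\ 0 < G /\ forall w', near d w w' -> forall b, Cmod (g w' a b) <= G).
{ intros a. destruct (P a Iz) as (d1 & D1 & H1). destruct (P a Iv1) as (d2 & D2 & H2).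
  destruct (P a Iv2) as (d3 & D3 & H3).
  exists (Rmin d1 (Rmin d2 d3)), (Cmod (g w a Iz) + Cmod (g w a Iv1) + Cmod (g w a Iv2) + 2).
  pose proof (Cmod_ge_0 (g w a Iz)). pose proof (Cmod_ge_0 (g w a Iv1)). pose proof (Cmod_ge_0 (g w a Iv2)).
  pose proof (Rmin_l d1 (Rmin d2 d3)). pose proof (Rmin_r d1 (Rmin d2 d3)).
  pose proof (Rmin_l d2 d3). pose proof (Rmin_r d2 d3).
  split; [repeat apply Rmin_pos; auto|]. split; [lra|].
  intros w' Hw' b. destruct b.
  - apply Rle_trans with (Cmod (g w a Iz) + 2); [|lra]. apply H1. intros c. destruct (Hw' c). split; lra.
  - apply Rle_trans with (Cmod (g w a Iv1) + 2); [|lra]. apply H2. intros c. destruct (Hw' c). split; lra.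
  - apply Rle_trans with (Cmod (g w a Iv2) + 2); [|lra]. apply H3. intros c. destruct (Hw' c). split; lra. }
destruct (Q Iz) as (d1 & G1 & D1 & K1 & H1). destruct (Q Iv1) as (d2 & G2 & D2 & K2 & H2).
destruct (Q Iv2) as (d3 & G3 & D3 & K3 & H3).
exists (Rmin d1 (Rmin d2 d3)), (G1 + G2 + G3).
pose proof (Rmin_l d1 (Rmin d2 d3)). pose proof (Rmin_r d1 (Rmin d2 d3)).
pose proof (Rmin_l d2 d3). pose proof (Rmin_r d2 d3).
split; [repeat apply Rmin_pos; auto|]. split; [lra|].
intros w' Hw' a b. destruct a.
- apply Rle_trans with G1; [|lra]. apply H1. intros c. destruct (Hw' c). split; lra.
- apply Rle_trans with G2; [|lra]. apply H2. intros c. destruct (Hw' c). split; lra.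
- apply Rle_trans with G3; [|lra]. apply H3. intros c. destruct (Hw' c). split; lra.
Qed.

Lemma dist_locally_small (g : metric) (w : C3) (eps : R) :
  kahler g -> 0 < eps -> exists d, 0 < d /\
    forall w', near d w w' -> dist g (proj w') (proj w) < eps.
Proof.
intros Hg Heps. destruct (metric_locally_bounded g w Hg) as (d0 & G & Hd0 & HG & HB).
(* Entries of the displacement have modulus at most [2 * d]; nine terms give [36 * G * d ^ 2], and
   the factor 2 in [gnorm] gives 72. *)
set (K := sqrt (72 * G)).
assert (HK : 0 < K) by (apply sqrt_lt_R0; lra).
set (d := Rmin d0 (eps / (2 * K))).
assert (Hd : 0 < d) by (apply Rmin_pos; auto; apply Rdiv_lt_0_compat; lra).
exists d. split; auto. intros w' Hw'.
eapply Rle_lt_trans; [apply (dist_le_path _ _ _ _ Hg (path_segment g w' w))|].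
destruct (segment_curve w' w) as [S1 S2].
pose proof (is_RInt_const_unit (K * d)) as I.
apply Rle_lt_trans with (K * d).
2:{ apply Rle_lt_trans with (K * (eps / (2 * K))).
    - apply Rmult_le_compat_l; [lra|apply Rmin_r].
    - replace (K * (eps / (2 * K))) with (eps / 2) by (field; lra). lra. }
apply (curve_length_le g _ _ _ Hg S1 I). intros s Hs. rewrite S2. unfold gnorm.
assert (Hx : forall a, Cmod (coord (disp w' w) a) <= 2 * d).
{ intros a. destruct (Hw' a) as [B1 B2].
  assert (E : coord (disp w' w) a = (coord w a - coord w' a)%C) by (destruct a; reflexivity).
  rewrite E. eapply Rle_trans; [apply Cmod_2Rmax|].
  assert (Hm : Rmax (Rabs (fst (coord w a - coord w' a)%C)) (Rabs (snd (coord w a - coord w' a)%C)) <= d).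
  { apply Rmax_lub; rewrite Rabs_minus_sym in B1, B2; left; assumption. }
  assert (sqrt 2 <= 2).
  { rewrite <- (sqrt_Rsqr 2) at 2 by lra. apply sqrt_le_1_alt. unfold Rsqr. lra. }
  pose proof (sqrt_pos 2). pose proof (Rabs_pos (fst (coord w a - coord w' a)%C)).
  pose proof (Rmax_l (Rabs (fst (coord w a - coord w' a)%C)) (Rabs (snd (coord w a - coord w' a)%C))). nra. }
assert (HG' : forall a b, Cmod (g (segment w' w s) a b) <= G).
{ apply HB. intros a. unfold segment. rewrite coord_move.
  assert (E : coord (disp w' w) a = (coord w a - coord w' a)%C) by (destruct a; reflexivity).
  rewrite E. destruct (Hw' a) as [B1 B2].
  pose proof (Rmin_l d0 (eps / (2 * K))) as Hm. fold d in Hm.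
  split; [replace (Re _ - Re _) with ((1 - s) * (Re (coord w' a) - Re (coord w a))) by (unfold Re; simpl; ring)
         |replace (Im _ - Im _) with ((1 - s) * (Im (coord w' a) - Im (coord w a))) by (unfold Im; simpl; ring)];
  rewrite Rabs_mult, (Rabs_pos_eq (1 - s)) by lra.
  - apply Rle_lt_trans with (1 * Rabs (Re (coord w' a) - Re (coord w a))); [|lra].
    apply Rmult_le_compat_r; [apply Rabs_pos|lra].
  - apply Rle_lt_trans with (1 * Rabs (Im (coord w' a) - Im (coord w a))); [|lra].
    apply Rmult_le_compat_r; [apply Rabs_pos|lra]. }
pose proof (hform_bound g (segment w' w s) (disp w' w) G (2 * d) ltac:(lra) HG' Hx) as HF.
replace (K * d) with (sqrt (72 * G * d²)).
- apply sqrt_le_1_alt. unfold Rsqr.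
  replace (9 * (G * (2 * d) ^ 2)) with (36 * (G * (d * d))) in HF by ring. lra.
- rewrite sqrt_mult by (try apply Rle_0_sqr; lra). rewrite sqrt_Rsqr by lra. reflexivity.
Qed.

Lemma exhaustion_proper (k B : R) :
  0 < k -> exists T, forall t, 0 <= t -> exhaustion k t <= B -> t <= T.
Proof.
(* Any exponent above 2 would serve. *)
intros Hk. destruct (exhaustion_growth k 3 Hk ltac:(lra)) as (c & Hc & HE).
exists (exp (Rpower (c * B) 3)). intros t Ht HB. destruct (HE t Ht) as [P1 P2].
assert (H1 : Rpower (c * exhaustion k t) 3 <= Rpower (c * B) 3).
{ apply Rle_Rpower_l; [lra|]. split; [now apply Rmult_lt_0_compat|]. apply Rmult_le_compat_l; lra. }
assert (H2 : ln (1 + t) < Rpower (c * B) 3) by lra.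
apply exp_increasing in H2. rewrite exp_ln in H2 by lra. lra.
Qed.

Lemma coords_bounded (k T : R) (w : C3) :
  0 < k -> fiber_norm2 k w <= T -> Rabs (Re (coord w Iz)) <= 1 -> Rabs (Im (coord w Iz)) <= 1 ->
  forall a, Rabs (Re (coord w a)) <= 2 + T + T / k /\ Rabs (Im (coord w a)) <= 2 + T + T / k.
Proof.
intros Hk HT Hr Hi.
assert (HT0 : 0 <= T) by (pose proof (fiber_norm2_nonneg k w Hk); lra).
rewrite fiber_norm2_coords in HT.
set (y := Im (coord w Iz)) in *. set (p := Re (coord w Iv1)) in *. set (q := Im (coord w Iv1)) in *.
set (a := Re (coord w Iv2)) in *. set (b := Im (coord w Iv2)) in *.
assert (HTk : 0 <= T / k).
{ now apply Rdiv_le_0_compat. }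
pose proof (pow2_ge_0 (p - y * a)) as Q1. pose proof (pow2_ge_0 (q - y * b)) as Q2.
pose proof (pow2_ge_0 a) as Q3. pose proof (pow2_ge_0 b) as Q4.
assert (Q5 : 0 <= k * (a ^ 2 + b ^ 2)) by (apply Rmult_le_pos; lra).
assert (Hab : a ^ 2 + b ^ 2 <= T / k).
{ apply Rmult_le_reg_l with k; auto. replace (k * (T / k)) with T by (field; lra). lra. }
assert (Sq : forall x M, x ^ 2 <= M -> Rabs x <= (1 + M) / 2).
{ intros x M Hx. apply Rabs_le_between. pose proof (pow2_ge_0 (x - 1)). pose proof (pow2_ge_0 (x + 1)). split; nra. }
assert (Ha : Rabs a <= (1 + T / k) / 2) by (apply Sq; lra).
assert (Hb : Rabs b <= (1 + T / k) / 2) by (apply Sq; lra).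
assert (Prod : forall x, Rabs (y * x) <= Rabs x).
{ intros x. rewrite Rabs_mult. pose proof (Rabs_pos x). nra. }
assert (Hp : Rabs p <= (1 + T) / 2 + (1 + T / k) / 2).
{ replace p with ((p - y * a) + y * a) by ring. eapply Rle_trans; [apply Rabs_triang|].
  pose proof (Prod a). pose proof (Sq (p - y * a) T ltac:(lra)). lra. }
assert (Hq : Rabs q <= (1 + T) / 2 + (1 + T / k) / 2).
{ replace q with ((q - y * b) + y * b) by ring. eapply Rle_trans; [apply Rabs_triang|].
  pose proof (Prod b). pose proof (Sq (q - y * b) T ltac:(lra)). lra. }
intros [| |]; fold y p q a b; split; lra.
Qed.

(** The exhaustion is Lipschitz and proper in t, so a Cauchy sequence stays in a region of bounded
    t; lifts near the origin in [z] then have bounded coordinates, and a limit is found in the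
    cover. *)
Lemma potential_complete (k : R) : 0 < k -> complete (calabi_metric k (potential k)).
Proof.
intros Hk x HC. set (g := calabi_metric k (potential k)) in *.
pose proof (potential_kahler k Hk : kahler g) as Hg.
assert (Hw : forall n, exists w, proj w = x n /\ Rabs (Re (coord w Iz)) <= 1 /\ Rabs (Im (coord w Iz)) <= 1).
{ intros n. destruct (proj_surjective (x n)) as [w E]. rewrite E. apply fundamental_domain. }
set (w := fun n => proj1_sig (constructive_indefinite_description _ (Hw n))).
assert (Hw' : forall n, proj (w n) = x n /\ Rabs (Re (coord (w n) Iz)) <= 1 /\ Rabs (Im (coord (w n) Iz)) <= 1).
{ intros n. apply (proj2_sig (constructive_indefinite_description _ (Hw n))). }
destruct (HC 1 Rlt_0_1) as [N HN].
set (B := exhaustion k (fiber_norm2 k (w N)) + 1).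
destruct (exhaustion_proper k B Hk) as [T HT].
assert (Hb : forall n, fiber_norm2 k (w (N + n)%nat) <= T).
{ intros n. apply HT; [now apply fiber_norm2_nonneg|].
  pose proof (exhaustion_lipschitz k (w N) (w (N + n)%nat) Hk) as HL. fold g in HL.
  rewrite (proj1 (Hw' N)), (proj1 (Hw' (N + n)%nat)) in HL.
  specialize (HN N (N + n)%nat ltac:(lia) ltac:(lia)).
  apply Rabs_le_between in HL. unfold B. lra. }
(* [common_subsequence] wants a bound for every index; the default branch repeats the sixth
   coordinate. *)
set (fam := fun i n => match i with
  | 0 => Re (coord (w (N + n)%nat) Iz) | 1 => Im (coord (w (N + n)%nat) Iz)
  | 2 => Re (coord (w (N + n)%nat) Iv1) | 3 => Im (coord (w (N + n)%nat) Iv1)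
  | 4 => Re (coord (w (N + n)%nat) Iv2) | _ => Im (coord (w (N + n)%nat) Iv2) end%nat).
destruct (common_subsequence fam (2 + T + T / k) 6) as (s & Hs & Hlim).
{ intros i n. destruct (Hw' (N + n)%nat) as (_ & R1 & R2).
  pose proof (coords_bounded k T _ Hk (Hb n) R1 R2) as HB.
  do 5 (destruct i as [|i]; [apply HB|]). apply HB. }
destruct (Hlim 0%nat ltac:(lia)) as [l0 L0]. destruct (Hlim 1%nat ltac:(lia)) as [l1 L1].
destruct (Hlim 2%nat ltac:(lia)) as [l2 L2]. destruct (Hlim 3%nat ltac:(lia)) as [l3 L3].
destruct (Hlim 4%nat ltac:(lia)) as [l4 L4]. destruct (Hlim 5%nat ltac:(lia)) as [l5 L5].
set (v := ((l0, l1), (l2, l3), (l4, l5)) : C3).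
exists (proj v). intros eps Heps.
destruct (HC (eps / 2) ltac:(lra)) as [M HM].
destruct (dist_locally_small g v (eps / 2) Hg ltac:(lra)) as (d & Hd & Hnear).
apply is_lim_seq_spec in L0, L1, L2, L3, L4, L5.
destruct (L0 (mkposreal d Hd)) as [N0 K0]. destruct (L1 (mkposreal d Hd)) as [N1 K1].
destruct (L2 (mkposreal d Hd)) as [N2 K2]. destruct (L3 (mkposreal d Hd)) as [N3 K3].
destruct (L4 (mkposreal d Hd)) as [N4 K4]. destruct (L5 (mkposreal d Hd)) as [N5 K5].
set (m := (M + N0 + N1 + N2 + N3 + N4 + N5)%nat).
exists M. intros n Hn.
assert (Hm : dist g (x (N + s m)%nat) (proj v) < eps / 2).
{ rewrite <- (proj1 (Hw' (N + s m)%nat)). apply Hnear. intros a.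
  destruct a; split.
  - apply (K0 m). unfold m; lia.
  - apply (K1 m). unfold m; lia.
  - apply (K2 m). unfold m; lia.
  - apply (K3 m). unfold m; lia.
  - apply (K4 m). unfold m; lia.
  - apply (K5 m). unfold m; lia. }
specialize (HM n (N + s m)%nat Hn ltac:(specialize (Hs m); unfold m in *; lia)).
pose proof (dist_triangle g (x n) (x (N + s m)%nat) (proj v) Hg). lra.
Qed.

(** * The fibre coordinate as a function of order at most two *)

Lemma fiber_coordinate_on_X : exists f : X -> C, forall w, f (proj w) = coord w Iv2.
Proof.
assert (H : forall x : X, exists c, forall w, x = proj w -> coord w Iv2 = c).
{ intros x. destruct (proj_surjective x) as [w0 ->]. exists (coord w0 Iv2). intros w E.
  symmetry. revert w0 w E. apply orbit_invariant; intros [[z v1] v2]; reflexivity. }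
exists (fun x => proj1_sig (constructive_indefinite_description _ (H x))).
intros w. destruct (constructive_indefinite_description _ (H (proj w))) as [c Hc]. simpl.
symmetry. now apply Hc.
Qed.

Lemma fiber_coordinate_growth (k rho : R) (p : X) (f : X -> C) :
  0 < k -> 2 < rho -> (forall w, f (proj w) = coord w Iv2) ->
  exists C1 C2, 0 < C1 /\ 0 < C2 /\ growth_bound (calabi_metric k (potential k)) p f rho C1 C2.
Proof.
intros Hk Hrho Hf. destruct (proj_surjective p) as [w0 ->].
destruct (exhaustion_growth k rho Hk Hrho) as (c & Hc & HE).
set (P0 := exhaustion k (fiber_norm2 k w0)).
destruct (HE _ (fiber_norm2_nonneg k w0 Hk)) as [HP0 _]. fold P0 in HP0.
(* The Lipschitz bound gives an exhaustion of at most [d + P0 <= (P0 + 1) * (d + 1)], which bounds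
   [ln (1 + t)]; and [sqrt k * |v2| <= 1 + t], a crude bound that costs only a factor in the
   exponent. *)
exists (/ sqrt k), (Rpower (c * (P0 + 1)) rho).
assert (Hsk : 0 < sqrt k) by now apply sqrt_lt_R0.
split; [now apply Rinv_0_lt_compat|]. split; [apply exp_pos|].
intros q. destruct (proj_surjective q) as [w ->]. rewrite Hf.
pose proof (exhaustion_lipschitz k w w0 Hk) as HL. fold P0 in HL.
pose proof (dist_nonneg _ (proj w) (proj w0) (potential_kahler k Hk)) as Hd0.
set (d := dist (calabi_metric k (potential k)) (proj w) (proj w0)) in *.
pose proof (fiber_norm2_nonneg k w Hk) as Ht. destruct (HE _ Ht) as [HP HG].
set (t := fiber_norm2 k w) in *.
apply Rabs_le_between in HL.
assert (HY : 1 + ln (1 + t) <= Rpower (c * (P0 + 1)) rho * Rpower (d + 1) rho).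
{ rewrite Rpower_mult_distr by (try apply Rmult_lt_0_compat; lra).
  eapply Rle_trans; [exact HG|]. apply Rle_Rpower_l; [lra|]. split; [now apply Rmult_lt_0_compat|].
  rewrite Rmult_assoc. apply Rmult_le_compat_l; [lra|]. nra. }
assert (Hv : Cmod (coord w Iv2) <= / sqrt k * (1 + t)).
{ assert (k * Cmod (coord w Iv2) ^ 2 <= t).
  { unfold t. rewrite fiber_norm2_fib. unfold fib2. pose proof (pow2_ge_0 (Cmod (fib1 w))). lra. }
  apply Rmult_le_reg_l with (sqrt k); auto.
  replace (sqrt k * (/ sqrt k * (1 + t))) with (1 + t) by (field; lra).
  pose proof (sqrt_sqrt k ltac:(lra)) as E. pose proof (pow2_ge_0 (sqrt k * Cmod (coord w Iv2) - 1)).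
  assert ((sqrt k * Cmod (coord w Iv2)) ^ 2 <= t).
  { replace ((sqrt k * Cmod (coord w Iv2)) ^ 2) with (sqrt k * sqrt k * Cmod (coord w Iv2) ^ 2) by ring.
    now rewrite E. }
  nra. }
eapply Rle_trans; [exact Hv|]. apply Rmult_le_compat_l; [left; now apply Rinv_0_lt_compat|].
rewrite <- (exp_ln (1 + t)) by lra. left. apply exp_increasing. lra.
Qed.

Lemma fiber_coordinate_holomorphic (f : X -> C) :
  (forall w, f (proj w) = coord w Iv2) -> holomorphic f.
Proof.
intros Hf w. exists (fun w' : C * C * C => snd w').
apply filterdiff_ext with (fun w' : C * C * C => snd w').
- intros w'. symmetry. apply Hf.
- apply filterdiff_linear. apply is_linear_snd.
Qed.

Lemma hadamard_order_le2 (k : R) (p : X) :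
  0 < k -> Rbar_le (d_Hmin (calabi_metric k (potential k)) p) (Finite 2).
Proof.
intros Hk. destruct fiber_coordinate_on_X as [f Hf]. unfold d_Hmin.
destruct (Rbar_ex_glb (fun d => exists f : X -> C, holomorphic f /\ (exists q q' : X, f q <> f q') /\
    d = hadamard_order (calabi_metric k (potential k)) p f)) as [l Hl].
rewrite (Rbar_is_glb_unique _ _ Hl).
apply Rbar_le_trans with (hadamard_order (calabi_metric k (potential k)) p f).
- apply Hl. exists f. split; [now apply fiber_coordinate_holomorphic|]. split; auto.
  exists (proj (RtoC 0, RtoC 0, RtoC 0)), (proj (RtoC 0, RtoC 0, RtoC 1)). rewrite !Hf. simpl.
  intros E. injection E. lra.
- unfold hadamard_order.
  match goal with |- Rbar_le (Glb_Rbar ?S) _ => pose proof (proj1 (Glb_Rbar_correct S)) as H; destruct (Glb_Rbar S) as [r| |] end; simpl; auto.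
  + apply le_epsilon. intros eps Heps. apply (H (2 + eps)). split; [lra|].
    apply (fiber_coordinate_growth k (2 + eps) p f); auto. lra.
  (* The admissible exponent 3 excludes an infinite infimum. *)
  + assert (Rbar_le p_infty 3); [|contradiction]. apply (H 3). split; [lra|].
    apply (fiber_coordinate_growth k 3 p f); auto. lra.
Qed.

Theorem proposition2p2 : forall k : R, 0 < k ->
  (forall g : metric, kahler g -> calabi_type k g -> complete g ->
     forall p : X, Rbar_le (Finite 2) (d_Hmin g p)) /\
  (exists g : metric, kahler g /\ calabi_type k g /\ complete g /\
     forall p : X, d_Hmin g p = Finite 2).
Proof.
intros k Hk. split.
- intros g Hg Hc _ p. now apply (hadamard_order_ge2 k).
- exists (calabi_metric k (potential k)).
  assert (Hc : calabi_type k (calabi_metric k (potential k))).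
  { exists (potential k). split; [apply potential_smooth|reflexivity]. }
  split; [now apply potential_kahler|]. split; [exact Hc|]. split; [now apply potential_complete|].
  intros p. apply Rbar_le_antisym; [now apply hadamard_order_le2|].
  apply (hadamard_order_ge2 k); auto. now apply potential_kahler.
Qed.
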